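(* Let $K'<K''<0$ and $\eta\ge0$ be fixed constants. Suppose that the second order condition defined in the context holds with $\rho_\varphi\in[K',K'']$. Let $A=[a_\wedge,a_\vee]\subset(0,\infty)$ be a closed interval of positive length and let $m_\rho=m_\rho(n)$ be an increasing sequence of integers such that the condition $\mathrm{ECC}(m_\rho,A)$ defined in the context holds. Further assume that $\sqrt{n/m_\rho}\,\varphi(m_\rho)\to\infty$; that $M_n=\{k\in\mathbb N:k/m_\rho\in A\}$; and that the weights $w_{n,k}>0$, $k\in M_n$, satisfy $\sum_{k\in M_n}w_{n,k}=1$ for all $n$ and $\lim_{n\to\infty}m_\rho w_{n,\langle m_\rho a\rangle}=f(a)$ uniformly over $a\in A$ (with $\langle m_\rho a\rangle\in M_n$), for some continuous $f$ on $A$ with $\int_Af(a)\,da=1$. Let $\hat\rho_\varphi^{\mathrm{pen}}(\boldsymbol u)$ be the penalized estimator defined in the context. Then, for any compact $U\subset\{\boldsymbol u\in[0,1]^d:S(\boldsymbol u)\ne0\}$, $$\sup_{\boldsymbol u\in U}|\hat\rho_\varphi^{\mathrm{pen}}(\boldsymbol u)-\rho_\varphi|=o_{\mathbb P}(1).$$ Also, for any finite set $U\subset\{\boldsymbol u\in[0,1]^d:S(\boldsymbol u)\ne0\}$, the estimator $\hat\rho_{\varphi,U}^{\mathrm{pen,agg}}:=\frac1{|U|}\sum_{\boldsymbol u\in U}\hat\rho_\varphi^{\mathrm{pen}}(\boldsymbol u)$ satisfies $\hat\rho_{\varphi,U}^{\mathrm{pen,agg}}=\rho_\varphi+o_{\mathbb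 P}(1)$.
   Context: $(\boldsymbol X_t)_{t\in\mathbb Z}$, $\boldsymbol X_t=(X_{t,1},\dots,X_{t,d})$, is a strictly stationary $\mathbb R^d$-valued process such that $X_{1,1},\dots,X_{1,d}$ have continuous c.d.f.s; $\boldsymbol X_1,\dots,\boldsymbol X_n$ are observed. For $\xi\in\mathbb R$, $\langle\xi\rangle$ denotes $\xi$ rounded to an integer towards zero. Inequalities of vectors are componentwise. For a block size $m\ge1$ put $M_{m,i,j}=\max\{X_{t,j}:t\in[i,i+m)\cap\mathbb Z\}$, $F_{m,j}(x)=\mathbb P(M_{m,1,j}\le x)$, and let $C_m$ be the c.d.f. on $[0,1]^d$ of $(F_{m,1}(M_{m,1,1}),\dots,F_{m,d}(M_{m,1,d}))$ (the copula of the block maximum). For block size $m'$, $\hat F_{n,m',j}(x)=\frac1{n-m'+1}\sum_{i=1}^{n-m'+1}\mathbf 1(M_{m',i,j}\le x)$, $\hat{\boldsymbol U}_{n,m',i}=(\hat F_{n,m',j}(M_{m',i,j}))_{j=1}^d$, $\hat C_{n,m'}(\boldsymbol u)=\frac1{n-m'+1}\sum_{i=1}^{n-m'+1}\mathbf 1(\hat{\boldsymbol U}_{n,m',i}\le\boldsymbol u)$. Second order condition: there are a regularly varying $\varphi:\mathbb N\to(0,\infty)$ (i.e. $t\mapsto\varphi(\langle t\rangle)$ is regularly varying at infinity) with coefficient $\rho_\varphi<0$ and a non-null (necessarily continuous) $S$ on $[0,1]^d$ with $C_m(\boldsymbol u)-C_\infty(\boldsymbol u)=\varphi(m)S(\boldsymbol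 u)+o(\varphi(m))$ as $m\to\infty$, uniformly in $\boldsymbol u\in[0,1]^d$. Penalized estimator: with $$\widetilde{RSS}(b_0,b_1,\rho;\boldsymbol u)=\sum_{k\in M_n}w_{n,k}\{\hat C_{n,k}(\boldsymbol u)-b_0-b_1(k/m_\rho)^\rho\}^2,$$ $$\widehat{RSS}_\eta(b_0,b_1,\rho;\boldsymbol u)=\widetilde{RSS}(b_0,b_1,\rho;\boldsymbol u)+\frac\eta{|\rho|}\min_{a_0,a_1\in\mathbb R,\,K'\le\kappa\le K''}\widetilde{RSS}(a_0,a_1,\kappa;\boldsymbol u),$$ let $(\hat b_0(\boldsymbol u),\hat b_1(\boldsymbol u),\hat\rho_\varphi^{\mathrm{pen}}(\boldsymbol u))\in\operatorname{arg\,min}_{\rho\in[K',K''],\,b_0,b_1\in\mathbb R}\widehat{RSS}_\eta(b_0,b_1,\rho;\boldsymbol u)$ (any minimizer). For natural numbers $k_n\to\infty$: $\mathrm{SC}_1(k_n)$ means that $\sqrt{n/k_n}(C_{k_n}-C_\infty)$, $n\in\mathbb N$, is relatively compact in $\mathcal C([0,1]^d)$ (continuous functions, sup norm). $\mathrm{SC}_2(k_n)$ means that the second order condition holds, $S$ is uniformly Hölder-continuous of order $\delta\in(0,1]$, $(n/k_n)^{(1-\delta)/2}\varphi(k_n)=o(1)$, and $\sqrt{n/k_n}\{C_{k_n}-C_\infty-\varphi(k_n)S\}$, $n\in\mathbb N$, is relatively compact in $\mathcal C([0,1]^d)$. Let $\dot C_{m,j}(\boldsymbol v)=\limsup_{h\downarrow0}h^{-1}\{C_m(\boldsymbol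 v+h\boldsymbol e_j)-C_m(\boldsymbol v)\}$. $\mathrm{ECC}(m,A)$ (for $m=m_n\in\{1,\dots,n\}$ and a compact interval $A\subset(0,\infty)$) means: (1) $C_m\to C_\infty$ pointwise as $m\to\infty$ for a copula $C_\infty$; (2) $m_n\to\infty$, $n/m_n\to\infty$, and the $\alpha$- and $\beta$-mixing coefficients of $(\boldsymbol X_t)$ satisfy $\alpha(h)=o(h^{-(1+\varrho)})$ ($h\to\infty$) for some $\varrho>0$, $\beta(m_n)(n/m_n)^{1/2}\to0$, $\alpha(m_n)(n/m_n)^{1/2+\zeta}\to0$ for some $\zeta\in(0,1/2)$; (3) for each $j$, $\dot C_{\infty,j}=\partial C_\infty/\partial u_j$ exists and is continuous on $\{\boldsymbol u\in[0,1]^d:u_j\in(0,1)\}$; (4) at least one of: (a) $\mathrm{SC}_1(\langle m_na_n\rangle)$ for every converging sequence $(a_n)$ in $A$; (b) for every $\delta\in(0,1/2)$, $\max_j\sup\{|\dot C_{m,j}(\boldsymbol u)-\dot C_{\infty,j}(\boldsymbol u)|:\boldsymbol u\in[0,1]^d,u_j\in[\delta,1-\delta]\}\to0$ as $m\to\infty$; (c) $\mathrm{SC}_2(\langle m_na_n\rangle)$ for every converging sequence $(a_n)$ in $A$. *)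

(* Defs.v *)
From HB Require Import structures.
From mathcomp Require Import all_boot all_order all_algebra finmap.
From mathcomp Require Import all_classical all_reals all_analysis.

Set Implicit Arguments.
Unset Strict Implicit.
Unset Printing Implicit Defensive.

Import Order.TTheory GRing.Theory Num.Theory.
Import numFieldNormedType.Exports.

Local Open Scope classical_set_scope.
Local Open Scope ring_scope.

(* Rounding towards zero is only ever applied to nonnegative reals here, where
   it is the natural number Num.truncn x. *)

Section deterministic.
Context {R : realType}.

Definition cube (d : nat) : set 'rV[R]_d :=
  [set u | forall j : 'I_d, 0 <= u 0 j <= 1].

Definition unit_vec (d : nat) (j : 'I_d) : 'rV[R]_d := delta_mx 0 j.

(* A copula is the restriction to the cube of a c.d.f. with uniform margins;
   the values of C off the cube are irrelevant. *)
Definition is_copula (d : nat) (C : 'rV[R]_d -> R) : Prop :=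
  exists mu : probability (d.-tuple R) R,
    (forall (j : 'I_d) (x : R), 0 <= x <= 1 ->
       mu [set v | tnth v j <= x] = x%:E) /\
    (forall u, cube u -> mu [set v | forall j : 'I_d, tnth v j <= u 0 j] = (C u)%:E).

(* The difference quotients of a copula lie in [0, 1], so the limsup, taken in
   the extended reals, is finite. *)
Definition dotC (d : nat) (C : 'rV[R]_d -> R) (j : 'I_d) (v : 'rV[R]_d) : R :=
  fine (limf_esup (fun h : R => (h^-1 * (C (v + h *: unit_vec j) - C v))%:E) 0^'+).

(* Relative compactness in the space of continuous functions on the cube with
   the sup norm: {uniform` cube -> R} carries the topology of uniform
   convergence on the cube, for which continuity on the cube is a closed
   condition. *)
Definition relatively_compact_seq (d : nat) (f : nat -> 'rV[R]_d -> R) : Prop :=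
  (forall n, {within @cube d, continuous (f n)}) /\
  precompact (range f : set {uniform` @cube d -> R}).

Definition regularly_varying (phi : nat -> R) (rho : R) : Prop :=
  forall x : R, 0 < x ->
    phi (Num.truncn (t * x)) / phi (Num.truncn t) @[t --> +oo] --> x `^ rho.

(* |.| on row vectors is the sup norm *)
Definition holder_on_cube (d : nat) (delta : R) (S : 'rV[R]_d -> R) : Prop :=
  exists L : R, forall u v, cube u -> cube v ->
    `|S u - S v| <= L * `|u - v| `^ delta.

End deterministic.

Section process.
Context {disp : measure_display} {T : measurableType disp} {R : realType}.
Context {P : probability T R} {d : nat}.
Variable X : int -> 'I_d -> {RV P >-> R}.

Definition finite_dim (n : nat) (t : n.-tuple int) (w : T) : n.-tuple (d.-tuple R) :=
  [tuple [tuple X (tnth t k) j w | j < d] | k < n].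

Definition strictly_stationary : Prop :=
  forall (n : nat) (t : n.-tuple int) (h : int)
         (B : set (n.-tuple (d.-tuple R))), measurable B ->
    P (finite_dim [tuple tnth t k + h | k < n] @^-1` B) = P (finite_dim t @^-1` B).

Definition sigma_of (I : set int) : set (set T) :=
  <<s [set E | exists t j (B : set R),
         [/\ I t, measurable B & E = X t j @^-1` B] ] >>.

Definition past : set (set T) := sigma_of [set t | t <= 0].
Definition future (h : nat) : set (set T) := sigma_of [set t | h%:Z <= t].

Definition alpha_mix (h : nat) : R :=
  sup [set x | exists A B, [/\ past A, future h B &
         x = `|fine (P (A `&` B)) - fine (P A) * fine (P B)|]].

Definition finite_partition (G : set (set T)) (k : nat) (A : 'I_k -> set T) :=
  [/\ forall i, G (A i), trivIset setT A & \bigcup_i A i = setT].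

Definition beta_mix (h : nat) : R :=
  sup [set x | exists k l (A : 'I_k -> set T) (B : 'I_l -> set T),
    [/\ finite_partition past A, finite_partition (future h) B &
      x = 2^-1 * \sum_(i < k) \sum_(j < l)
            `|fine (P (A i `&` B j)) - fine (P (A i)) * fine (P (B j))|]].

Definition block_max (m : nat) (i : int) (j : 'I_d) (w : T) : R :=
  \big[Order.max/X i j w]_(k < m) X (i + k%:Z) j w.

Definition block_cdf (m : nat) (j : 'I_d) (x : R) : R :=
  fine (P [set w | block_max m 1 j w <= x]).

Definition block_copula (m : nat) (u : 'rV[R]_d) : R :=
  fine (P [set w | forall j : 'I_d, block_cdf m j (block_max m 1 j w) <= u 0 j]).

(* All empirical quantities are 0 when the block size exceeds n. *)
Definition nblocks (n m : nat) : nat := (n.+1 - m)%N.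

Definition emp_cdf (n m : nat) (j : 'I_d) (x : R) (w : T) : R :=
  (nblocks n m)%:R^-1 *
  \sum_(1 <= i < (nblocks n m).+1) (block_max m i%:Z j w <= x)%R%:R.

Definition pseudo_obs (n m i : nat) (j : 'I_d) (w : T) : R :=
  emp_cdf n m j (block_max m i%:Z j w) w.

Definition emp_copula (n m : nat) (u : 'rV[R]_d) (w : T) : R :=
  (nblocks n m)%:R^-1 *
  \sum_(1 <= i < (nblocks n m).+1) [forall j : 'I_d, (pseudo_obs n m i j w <= u 0 j)%R]%:R.

Definition second_order (Cinf : 'rV[R]_d -> R) (phi : nat -> R) (rho : R)
    (S : 'rV[R]_d -> R) : Prop :=
  [/\ forall m, (0 < m)%N -> 0 < phi m,
      regularly_varying phi rho,
      rho < 0,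
      exists2 u, cube u & S u != 0
    & forall eps : R, 0 < eps -> \forall m \near \oo, forall u, cube u ->
        `|block_copula m u - Cinf u - phi m * S u| <= eps * phi m].

Definition SC1 (Cinf : 'rV[R]_d -> R) (k : nat -> nat) : Prop :=
  relatively_compact_seq (fun n u =>
    Num.sqrt (n%:R / (k n)%:R) * (block_copula (k n) u - Cinf u)).

Definition SC2 (Cinf : 'rV[R]_d -> R) (phi : nat -> R) (rho : R)
    (S : 'rV[R]_d -> R) (k : nat -> nat) : Prop :=
  second_order Cinf phi rho S /\
  exists delta : R,
    [/\ 0 < delta <= 1,
        holder_on_cube delta S,
        (n%:R / (k n)%:R) `^ ((1 - delta) / 2) * phi (k n) @[n --> \oo] --> (0 : R)
      & relatively_compact_seq (fun n u =>
          Num.sqrt (n%:R / (k n)%:R) *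
          (block_copula (k n) u - Cinf u - phi (k n) * S u))].

Definition mixing_conditions (m : nat -> nat) : Prop :=
  [/\ m @ \oo --> \oo,
      (n%:R / (m n)%:R : R) @[n --> \oo] --> +oo,
      exists2 r : R, 0 < r & alpha_mix h * h%:R `^ (1 + r) @[h --> \oo] --> (0 : R),
      beta_mix (m n) * (n%:R / (m n)%:R) `^ (2^-1) @[n --> \oo] --> (0 : R)
    & exists2 zeta : R, 0 < zeta < 2^-1 &
        alpha_mix (m n) * (n%:R / (m n)%:R) `^ (2^-1 + zeta) @[n --> \oo] --> (0 : R)].

Definition smooth_limit (Cinf : 'rV[R]_d -> R) : Prop :=
  forall j : 'I_d,
    (forall u, cube u -> 0 < u 0 j < 1 -> derivable Cinf u (unit_vec j)) /\
    {within [set u : 'rV[R]_d | cube u /\ 0 < u 0 j < 1],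
       continuous (fun u => 'D_(unit_vec j) Cinf u)}.

Definition uniform_derivatives (Cinf : 'rV[R]_d -> R) : Prop :=
  forall delta : R, 0 < delta < 2^-1 ->
  forall eps : R, 0 < eps -> \forall m \near \oo,
    forall (j : 'I_d) u, cube u -> delta <= u 0 j <= 1 - delta ->
      `|dotC (block_copula m) j u - dotC Cinf j u| <= eps.

Definition ECC (Cinf : 'rV[R]_d -> R) (phi : nat -> R) (rho : R)
    (S : 'rV[R]_d -> R) (m : nat -> nat) (A : set R) : Prop :=
  [/\ forall n, (0 < n)%N -> (0 < m n <= n)%N,
      is_copula Cinf /\
        (forall u, cube u -> block_copula k u @[k --> \oo] --> Cinf u),
      mixing_conditions m,
      smooth_limit Cinf
    & [\/ forall a : nat -> R, (forall n, A (a n)) -> cvg (a @ \oo) ->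
            SC1 Cinf (fun n => Num.truncn ((m n)%:R * a n)),
          uniform_derivatives Cinf
        | forall a : nat -> R, (forall n, A (a n)) -> cvg (a @ \oo) ->
            SC2 Cinf phi rho S (fun n => Num.truncn ((m n)%:R * a n))]].

Definition block_sizes (m : nat -> nat) (A : set R) (n : nat) : set nat :=
  [set k | A (k%:R / (m n)%:R)].

Section estimator.
Variables (m : nat -> nat) (A : set R) (wt : nat -> nat -> R).

Definition RSS (n : nat) (w : T) (u : 'rV[R]_d) (b0 b1 rho : R) : R :=
  \sum_(k \in block_sizes m A n)
    wt n k * (emp_copula n k u w - b0 - b1 * (k%:R / (m n)%:R) `^ rho) ^+ 2.

Variables (K1 K2 eta : R).

(* The minimum over a0, a1, kappa is attained, so it is written as an infimum. *)
Definition RSS_pen (n : nat) (w : T) (u : 'rV[R]_d) (b0 b1 rho : R) : R :=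
  RSS n w u b0 b1 rho +
  eta / `|rho| *
  inf [set x | exists a0 a1 kappa, K1 <= kappa <= K2 /\ x = RSS n w u a0 a1 kappa].

Definition penalized_estimator (b0 b1 rho : nat -> T -> 'rV[R]_d -> R) : Prop :=
  forall n w u, (0 < n)%N -> cube u ->
    K1 <= rho n w u <= K2 /\
    forall c0 c1 r, K1 <= r <= K2 ->
      RSS_pen n w u (b0 n w u) (b1 n w u) (rho n w u) <= RSS_pen n w u c0 c1 r.

End estimator.

End process.

(* Convergence to 0 in probability, with respect to the outer probability
   mu_ext P, since minimizers and suprema need not be measurable; on measurable
   events mu_ext P coincides with P. *)
Definition oP1 {disp : measure_display} {T : measurableType disp} {R : realType}
    (P : probability T R) (Z : nat -> T -> R) : Prop :=
  forall eps : R, 0 < eps ->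
    mu_ext P [set w | eps < `|Z n w|] @[n --> \oo] --> 0%E.

(* Main.v *)
Require Import Defs.
From HB Require Import structures.
From mathcomp Require Import all_boot all_order all_algebra finmap.
From mathcomp Require Import all_classical all_reals all_analysis.
From mathcomp Require Import measurable_realfun.
From mathcomp Require Import ring lra zify.

(** Consistency of the penalized estimator rests on two facts about the least
squares problem with regressors [1] and [(k / m) ^ rho], whose target is
[C_k - C_inf], that is [phi m * S * (k / m) ^ rho_phi] up to [o(phi m)].

Identification.  The weights have a limiting density that is positive on some
interval, so a small weighted sum of squares forces small residuals at four
separated points of that interval ([weighted_pick]).  Two functions
[S x ^ r] and [b0 + b1 x ^ rho] that nearly agree at such points have nearly
equal exponents: the mean value theorem on two disjoint intervals removes [b0],
comparing the slopes removes [b1], and what remains is the difference of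
[x ^ (r - rho)] at two separated points ([four_points]).  The penalty only
multiplies the criterion at the true parameters by a constant
([penalized_minimizer_RSS]), so everything reduces to showing that the residual
at the true parameters is [o(phi m)] in weighted mean square over [k],
uniformly in [u].

Residual at the true parameters.  The deterministic part is the second order
condition together with the uniform convergence theorem for regularly varying
sequences ([regular_variation_uniform], [bias_expansion]).  The random part is
[emp_copula_L2]: the error of the empirical copula is of the exact order
[sqrt (m / n)], uniformly in [u] and in mean square over [k].  A logarithmic
loss is not affordable, because [phi m] may dominate [sqrt (m / n)] arbitrarily
slowly; but only a mean over [k] enters the criterion.

The proof of [emp_copula_L2] is as follows.  Ranks are within the empirical
error of the uniformized maxima and the copulas are Lipschitz, so it suffices to
control the empirical distribution function of the uniformized maxima
([emp_copula_close]), and this only on a grid of mesh of order [m / n].  Cut the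
observations into blocks of length of order [m] and take every third of them;
let [s] be of order [sqrt (n / m)], so that there are at most [s ^ 2] blocks.
The normalized deviation, a maximum over the grid followed by a quadratic mean
over [k], moves by at most [1 / s] when a single block changes.  Replacing the
blocks one after the other by independent copies hence costs
[s ^ 2 * beta m / s], which is bounded by the mixing condition ([decoupling]).
For independent blocks, fourth moments of the deviations of dyadic boxes, summed
over all boxes of one shape, decay geometrically with the depth of the boxes,
and chaining over the shapes bounds the maximum over the grid
([max_corner_moment]). *)

Set Implicit Arguments.
Unset Strict Implicit.
Unset Printing Implicit Defensive.

Import Order.TTheory GRing.Theory Num.Theory.
Import numFieldNormedType.Exports.

Local Open Scope ring_scope.

(** * Expectations of functions of finitely many finite-valued variables *)

Section expectation.
Context {R : realFieldType} {Y : finType}.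
Implicit Types (mu Phi : seq Y -> R) (B : nat) (a : seq Y).

(** Sequences list their coordinates newest first, so that one more observation is
one more [cons]. *)
Definition expect B mu Phi : R := \sum_(a : B.-tuple Y) mu a * Phi a.

Definition iid_law (pi : Y -> R) a : R := \prod_(y <- a) pi y.

Definition coordinate_lipschitz (delta : R) Phi :=
  forall a c c' b, `|Phi (a ++ c :: b) - Phi (a ++ c' :: b)| <= delta.

Lemma sum_tuple_cons B (F : seq Y -> R) :
  \sum_(a : B.+1.-tuple Y) F a = \sum_(a : B.-tuple Y) \sum_c F (c :: a).
Proof.
rewrite pair_big /= (reindex (fun p : B.-tuple Y * Y => cons_tuple p.2 p.1)) //=.
exists (fun a : B.+1.-tuple Y => (behead_tuple a, thead a)) => [[a c] _|a _] /=.
  by congr pair; apply/val_inj.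
by apply/val_inj; rewrite /= [in RHS](tuple_eta a).
Qed.

Lemma expectS B mu Phi :
  expect B.+1 mu Phi = \sum_(a : B.-tuple Y) \sum_c mu (c :: a) * Phi (c :: a).
Proof. exact: (sum_tuple_cons B (fun a => mu a * Phi a)). Qed.

Lemma expect0 mu Phi : expect 0 mu Phi = mu [::] * Phi [::].
Proof.
rewrite /expect (big_pred1 [tuple]) // => a /=.
by apply/esym/eqP; rewrite [a]tuple0; apply: val_inj.
Qed.

Lemma expectD B mu Phi Psi :
  expect B mu (fun a => Phi a + Psi a) = expect B mu Phi + expect B mu Psi.
Proof. by rewrite /expect -big_split; apply: eq_bigr => a _; rewrite mulrDr. Qed.

Lemma expectZ B mu (x : R) Phi :
  expect B mu (fun a => x * Phi a) = x * expect B mu Phi.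
Proof. by rewrite /expect mulr_sumr; apply: eq_bigr => a _; rewrite mulrCA. Qed.

Lemma expect_sum B mu (I : Type) (r : seq I) (Q : pred I) (Phi : I -> seq Y -> R) :
  expect B mu (fun a => \sum_(i <- r | Q i) Phi i a) =
  \sum_(i <- r | Q i) expect B mu (Phi i).
Proof.
by rewrite /expect exchange_big; apply: eq_bigr => a _; rewrite mulr_sumr.
Qed.

Lemma le_expect B mu Phi Psi : (forall a, 0 <= mu a) ->
  (forall a, size a = B -> Phi a <= Psi a) ->
  expect B mu Phi <= expect B mu Psi.
Proof.
move=> mu0 le; apply: ler_sum => a _; apply: ler_wpM2l => //.
by apply: le; rewrite size_tuple.
Qed.

Lemma eq_expect B mu Phi Psi :
  (forall a, size a = B -> Phi a = Psi a) -> expect B mu Phi = expect B mu Psi.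
Proof. by move=> e; apply: eq_bigr => a _; rewrite e// size_tuple. Qed.

Variable pi : Y -> R.
Hypotheses (pi_ge0 : forall y, 0 <= pi y) (pi_sum1 : \sum_y pi y = 1).

Lemma iid_law_ge0 a : 0 <= iid_law pi a.
Proof. by apply: prodr_ge0 => y _. Qed.

Lemma expect_iidS B Phi : expect B.+1 (iid_law pi) Phi =
  expect B (iid_law pi) (fun a => \sum_c pi c * Phi (c :: a)).
Proof.
rewrite expectS; apply: eq_bigr => a _; rewrite mulr_sumr.
apply: eq_bigr => c _; rewrite /iid_law big_cons; ring.
Qed.

Lemma expect_iid_cst B (x : R) : expect B (iid_law pi) (fun=> x) = x.
Proof.
elim: B => [|B IH]; first by rewrite expect0 /iid_law big_nil mul1r.
by rewrite expect_iidS -mulr_suml pi_sum1 mul1r.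
Qed.

(** Replacing the dependent coordinates one at a time by independent copies:
each swap costs the dependence of the newest coordinate on the earlier ones,
measured in total variation, times the variation of the functional in that
single coordinate.  Since only differences of values that agree in all other
coordinates enter, the size of the functional itself is irrelevant. *)
Lemma decoupling (J : seq Y -> R) (kappa delta : R) B :
  (0 < #|Y|)%N -> 0 <= delta ->
  J [::] = 1 -> (forall a, \sum_c J (c :: a) = J a) ->
  (forall b, (b < B)%N ->
     \sum_(a : b.-tuple Y) \sum_c `|J (c :: a) - pi c * J a| <= kappa) ->
  forall Phi, coordinate_lipschitz delta Phi ->
  expect B J Phi <= expect B (iid_law pi) Phi + B%:R * (kappa * delta).
Proof.
move=> /card_gt0P[c0 _] delta0 J1 JS; elim: B => [|B IH] dep Phi lip.
  by rewrite !expect0 J1 /iid_law big_nil !mul1r mul0r addr0.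
pose Phi' a := \sum_c pi c * Phi (c :: a).
have lip' : coordinate_lipschitz delta Phi'.
  move=> a c c' b; rewrite /Phi' -sumrB.
  apply: le_trans (ler_norm_sum _ _ _) _.
  rewrite -[leRHS]mul1r -pi_sum1 mulr_suml; apply: ler_sum => y _.
  rewrite -mulrBr normrM (ger0_norm (pi_ge0 y)) ler_wpM2l//.
  exact: (lip (y :: a)).
have -> : expect B.+1 J Phi = expect B J Phi' + \sum_(a : B.-tuple Y) \sum_c
    (J (c :: a) - pi c * J a) * (Phi (c :: a) - Phi (c0 :: a)).
  rewrite expectS /expect -big_split; apply: eq_bigr => a _ /=.
  have E : \sum_c (J (c :: a) - pi c * J a) = 0.
    by rewrite sumrB JS -mulr_suml pi_sum1 mul1r subrr.
  have -> : \sum_c (J (c :: a) - pi c * J a) * (Phi (c :: a) - Phi (c0 :: a)) =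
     \sum_c (J (c :: a) - pi c * J a) * Phi (c :: a).
    rewrite (eq_bigr (fun c => (J (c :: a) - pi c * J a) * Phi (c :: a) -
       (J (c :: a) - pi c * J a) * Phi (c0 :: a))); last first.
      by move=> c _; rewrite mulrBr.
    by rewrite sumrB -[X in _ - X]mulr_suml E mul0r subr0.
  rewrite /Phi' mulr_sumr -big_split; apply: eq_bigr => c _ /=; ring.
rewrite expect_iidS -/Phi'.
have le1 := IH (fun b lt => dep b (ltnW lt)) _ lip'.
have le2 : \sum_(a : B.-tuple Y) \sum_c
    (J (c :: a) - pi c * J a) * (Phi (c :: a) - Phi (c0 :: a)) <= kappa * delta.
  apply: le_trans (ler_wpM2r delta0 (dep B (ltnSn B))).
  rewrite mulr_suml; apply: ler_sum => a _; rewrite mulr_suml; apply: ler_sum => c _.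
  apply: le_trans (ler_norm _) _; rewrite normrM ler_wpM2l//.
  exact: (lip [::]).
rewrite mulrSr mulrDl mul1r; lra.
Qed.

(** The age of a coordinate, which selects the summand, is the number of
coordinates that follow it, the newest one coming first. *)
Fixpoint path_sum (h : nat -> Y -> R) a : R :=
  if a is c :: a' then h (size a') c + path_sum h a' else 0.

Section fourth_moment.
Variables (h : nat -> Y -> R) (v : R).
Hypotheses (h_centered : forall b, \sum_c pi c * h b c = 0)
  (h_bounded : forall b c, `|h b c| <= 1)
  (h_variance : forall b, \sum_c pi c * h b c ^+ 2 <= v).

Let sumM4 b (s : R) : \sum_c pi c * (h b c + s) ^+ 4 =
  \sum_c pi c * h b c ^+ 4 + s * (4 * \sum_c pi c * h b c ^+ 3) +
  (6 * \sum_c pi c * h b c ^+ 2) * s ^+ 2 + s ^+ 4.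
Proof.
have -> : s ^+ 4 = 4 * s ^+ 3 * (\sum_c pi c * h b c) + s ^+ 4 * \sum_c pi c.
  by rewrite h_centered pi_sum1; ring.
rewrite !mulr_sumr mulr_suml -!big_split; apply: eq_bigr => c _ /=; ring.
Qed.

Let E1 B : expect B (iid_law pi) (path_sum h) = 0.
Proof.
elim: B => [|B IH]; first by rewrite expect0 mulr0.
rewrite expect_iidS -[RHS]IH; apply: eq_expect => a _ /=.
rewrite (eq_bigr (fun c => pi c * h (size a) c + pi c * path_sum h a)).
  by rewrite big_split /= h_centered -mulr_suml pi_sum1 add0r mul1r.
by move=> c _; rewrite mulrDr.
Qed.

Let E2 B : expect B (iid_law pi) (fun a => path_sum h a ^+ 2) <= B%:R * v.
Proof.
elim: B => [|B IH]; first by rewrite expect0 /= expr0n mulr0 mul0r.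
rewrite expect_iidS.
apply: (@le_trans _ _ (expect B (iid_law pi) (fun a => v + path_sum h a ^+ 2))).
  apply: le_expect => [a|a _] /=; first exact: iid_law_ge0.
  have := h_variance (size a); set s := path_sum h a.
  have -> : s ^+ 2 = 2 * s * (\sum_c pi c * h (size a) c) + s ^+ 2 * \sum_c pi c.
    by rewrite h_centered pi_sum1; ring.
  have -> : \sum_c pi c * (h (size a) c + s) ^+ 2 = 
     \sum_c pi c * h (size a) c ^+ 2 +
     (2 * s * (\sum_c pi c * h (size a) c) + s ^+ 2 * \sum_c pi c).
    by rewrite !mulr_sumr -!big_split; apply: eq_bigr => c _ /=; ring.
  lra.
rewrite expectD expect_iid_cst mulrSr mulrDl mul1r; lra.
Qed.

(** Adding an independent centred summand to a sum [S] adds [6 v E S ^ 2 + v] to the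
fourth moment at most: the third moment of the summand meets [E S = 0], and its
fourth is at most its second. *)
Lemma fourth_moment B :
  expect B (iid_law pi) (fun a => path_sum h a ^+ 4) <=
  B%:R * v + 3 * B%:R ^+ 2 * v ^+ 2.
Proof.
have v0 : 0 <= v.
  by apply: le_trans (h_variance 0); apply: sumr_ge0 => c _; rewrite mulr_ge0// sqr_ge0.
elim: B => [|B IH]; first by rewrite expect0 /= expr0n /=; lra.
pose k := 4 * \sum_c pi c * h B c ^+ 3.
rewrite expect_iidS.
apply: (@le_trans _ _ (expect B (iid_law pi)
  (fun a => (v + k * path_sum h a) + ((6 * v) * path_sum h a ^+ 2 + path_sum h a ^+ 4)))).
  apply: le_expect => [a|a sa] /=; first exact: iid_law_ge0.
  rewrite sumM4 sa; set s := path_sum h a; rewrite -/k.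
  have le4 : \sum_c pi c * h B c ^+ 4 <= v.
    apply: le_trans (h_variance B); apply: ler_sum => c _; rewrite ler_wpM2l//.
    have : h B c ^+ 2 <= 1.
      by rewrite -(real_normK (num_real _)) expr_le1.
    have := sqr_ge0 (h B c); set x := h B c ^+ 2 => x0 x1.
    by rewrite (_ : h B c ^+ 4 = x * x) ?ler_piMl// /x; ring.
  have := ler_wpM2r (sqr_ge0 s) (h_variance B); lra.
rewrite !expectD !expectZ expect_iid_cst E1 mulr0 addr0.
have := ler_wpM2l (mulr_ge0 (ler0n R 6) v0) (E2 B).
rewrite mulrSr; have := mulr_ge0 (ler0n R B) (mulr_ge0 v0 v0); nra.
Qed.

End fourth_moment.

End expectation.

(** * Dyadic chaining *)

Lemma ltn_halving (a b : nat) :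
  ((a < b) = (a %/ 2 < b %/ 2) + (odd b && (a == b.-1)) :> nat)%N.
Proof.
case: (ltnP a b); case: (ltnP (a %/ 2) (b %/ 2)); case: (boolP (odd b)) => /=;
  case: (eqVneq a b.-1) => //=; rewrite ?addn0 //; lia.
Qed.

(** The canonical dyadic cover of an initial segment: the binary digits of
[x] that are set cut {0, ..., x - 1} into one dyadic interval per digit. *)
Lemma ltn_dyadic (S c x : nat) : (x < 2 ^ S)%N ->
  ((c < x) = \sum_(s < S) (odd (x %/ 2 ^ s) && (c %/ 2 ^ s == (x %/ 2 ^ s).-1)) :> nat)%N.
Proof.
move=> xS.
suff : ((c < x) = \sum_(s < S) (odd (x %/ 2 ^ s) && (c %/ 2 ^ s == (x %/ 2 ^ s).-1))
   + (c %/ 2 ^ S < x %/ 2 ^ S) :> nat)%N.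
  by rewrite (divn_small xS) addn0.
elim: S {xS} => [|S IH]; first by rewrite big_ord0 expn0 !divn1.
rewrite IH big_ord_recr /= -addnA; congr (_ + _)%N.
by rewrite ltn_halving -!divnMA -expnSr addnC.
Qed.

Section jensen.
Context {R : realFieldType} {I : finType}.

(** The weighted variance of [t] is nonnegative. *)
Lemma cauchy_weighted (w t : I -> R) : (forall i, 0 <= w i) ->
  (\sum_i w i * t i) ^+ 2 <= (\sum_i w i) * (\sum_i w i * t i ^+ 2).
Proof.
move=> w0; set W := \sum_i w i; set m := \sum_i w i * t i.
have W0 : 0 <= W by exact: sumr_ge0.
have [W_eq0|W_neq0] := eqVneq W 0.
  have w_eq0 i : w i = 0.
    by move: W_eq0 => /psumr_eq0P -> // i' _; exact: w0.
  by rewrite /m big1 ?expr0n ?W_eq0 ?mul0r// => i _; rewrite w_eq0 mul0r.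
have : 0 <= \sum_i w i * (t i - m / W) ^+ 2.
  by apply: sumr_ge0 => i _; rewrite mulr_ge0// sqr_ge0.
have -> : \sum_i w i * (t i - m / W) ^+ 2 =
   \sum_i w i * t i ^+ 2 - 2 * (m / W) * m + (m / W) ^+ 2 * W.
  rewrite /m /W !mulr_sumr -sumrB -big_split /=; apply: eq_bigr => i _; ring.
move=> /(mulr_ge0 W0); set Q := \sum_i _.
rewrite (_ : W * (_ + _) = W * Q - m ^+ 2) ?subr_ge0//.
by field.
Qed.

Lemma jensen4_weighted (w t : I -> R) : (forall i, 0 <= w i) ->
  (\sum_i w i * t i) ^+ 4 <= (\sum_i w i) ^+ 3 * (\sum_i w i * t i ^+ 4).
Proof.
move=> w0; have W0 : 0 <= \sum_i w i by exact: sumr_ge0.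
rewrite (_ : _ ^+ 4 = ((\sum_i w i * t i) ^+ 2) ^+ 2); last by rewrite -exprM.
have le1 := cauchy_weighted t w0.
have le2 := cauchy_weighted (fun i => t i ^+ 2) w0.
apply: le_trans (_ : ((\sum_i w i) * (\sum_i w i * t i ^+ 2)) ^+ 2 <= _).
  by rewrite ler_sqr ?nnegrE ?sqr_ge0// (le_trans _ le1)// sqr_ge0.
rewrite exprMn (exprSr _ 2) -mulrA ler_wpM2l ?sqr_ge0//.
apply: le_trans le2 _; rewrite ler_wpM2l//.
by apply: ler_sum => i _; rewrite -exprM.
Qed.

End jensen.

Lemma geometric_sum_le (R : realFieldType) (theta : R) (S : nat) :
  0 <= theta -> theta < 1 -> \sum_(s < S) theta ^+ s <= (1 - theta)^-1.
Proof.
move=> t0 t1.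
have : (1 - theta) * \sum_(s < S) theta ^+ s = 1 - theta ^+ S.
  by rewrite -[RHS]opprB subrX1; ring.
have d0 : 0 < 1 - theta by rewrite subr_gt0.
move=> e; rewrite -(ler_pM2l d0) e mulfV ?gt_eqF//.
by rewrite lerBlDr lerDl exprn_ge0.
Qed.

Section rectangles.
Context {R : realFieldType} {d L : nat}.

Notation D := ((2 ^ L).+1).
Notation cell := {ffun 'I_d -> 'I_D}.
Notation corner := {ffun 'I_d -> 'I_D.+1}.
Notation level := {ffun 'I_d -> 'I_(L.+2)}.

Definition below (x : corner) (c : cell) : bool := [forall j, (c j < x j)%N].

Definition dyadic_box (sg : level) (v : cell) (c : cell) : bool :=
  [forall j, (c j %/ 2 ^ sg j)%N == v j].

Lemma forall_prod (I : finType) (b : pred I) :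
  [forall i, b i]%:R = \prod_i (b i)%:R :> R.
Proof.
case: (boolP [forall i, b i]) => [/forallP h|]; first by rewrite big1// => i _; rewrite h.
by rewrite negb_forall => /existsP[i /negbTE h]; rewrite (bigD1 i)//= h mul0r.
Qed.

(** The dyadic decompositions of the coordinates, multiplied out: one box per
vector of scales. *)
Lemma below_dyadic (x : corner) (c : cell) : (below x c)%:R =
  \sum_(sg : level) ([forall j, odd (x j %/ 2 ^ sg j)] &&
     dyadic_box sg [ffun j => inord (x j %/ 2 ^ sg j).-1] c)%:R :> R.
Proof.
have xS j : (x j < 2 ^ L.+2)%N.
  apply: (leq_trans (ltn_ord (x j))); rewrite !expnS.
  have := expn_gt0 2 L; lia.
rewrite /below forall_prod.
under eq_bigr => j _ do rewrite (ltn_dyadic _ (xS j)) natr_sum.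
rewrite bigA_distr_bigA /=; apply: eq_bigr => sg _.
rewrite -mulnb natrM !forall_prod -big_split /=; apply: eq_bigr => j _.
rewrite -mulnb natrM ffunE; congr (_ * (_ : bool)%:R).
rewrite inordK//.
have : (x j %/ 2 ^ sg j <= x j)%N by exact: leq_div.
have := ltn_ord (x j); lia.
Qed.

Definition box_mass (z : cell -> R) (sg : level) (v : cell) : R :=
  \sum_c z c * (dyadic_box sg v c)%:R.

Definition corner_mass (z : cell -> R) (x : corner) : R :=
  \sum_c z c * (below x c)%:R.

(** Chaining in fourth powers: a corner is a disjoint union of at most one
dyadic box per vector of scales, so its mass is bounded by a weighted power
sum over all dyadic boxes, uniformly in the corner. *)
Lemma corner_mass_pow4 (z : cell -> R) (cw : level -> R) (x : corner) :
  (forall sg, 0 < cw sg) ->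
  corner_mass z x ^+ 4 <= (\sum_sg cw sg) ^+ 3 *
    \sum_sg (cw sg) ^- 3 * \sum_v box_mass z sg v ^+ 4.
Proof.
move=> cw0.
pose e (sg : level) : bool := [forall j, odd (x j %/ 2 ^ sg j)].
pose vx (sg : level) : cell := [ffun j => inord (x j %/ 2 ^ sg j).-1].
have -> : corner_mass z x =
    \sum_sg cw sg * ((cw sg)^-1 * ((e sg)%:R * box_mass z sg (vx sg))).
  under [RHS]eq_bigr => sg _ do rewrite mulrA mulfV ?gt_eqF// mul1r /box_mass mulr_sumr.
  rewrite exchange_big; apply: eq_bigr => c _.
  rewrite below_dyadic mulr_sumr; apply: eq_bigr => sg _.
  by rewrite -mulnb natrM mulrCA.
apply: le_trans (jensen4_weighted _ (fun sg => ltW (cw0 sg))) _.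
rewrite ler_wpM2l ?exprn_ge0 ?sumr_ge0// => [sg _|]; first exact: ltW.
apply: ler_sum => sg _.
rewrite (_ : cw sg * _ = cw sg ^- 3 * ((e sg)%:R * box_mass z sg (vx sg)) ^+ 4); last first.
  have := cw0 sg; rewrite lt0r => /andP[c0 _].
  by field.
rewrite ler_wpM2l ?invr_ge0 ?exprn_ge0 ?(ltW (cw0 sg))//.
rewrite (bigD1 (vx sg))//= exprMn -natrX ler_wpDr//.
  by apply: sumr_ge0 => v _; rewrite (_ : 4 = 2 * 2)%N// exprM sqr_ge0.
by case: (e sg); rewrite ?mul1r// ?mul0r// (_ : 4 = 2 * 2)%N// exprM sqr_ge0.
Qed.

End rectangles.

(** * Fourth moments of sums over independent blocks *)

Lemma bernoulli_le (R : realFieldType) (x : R) (n : nat) :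
  0 <= x <= 1 -> 1 - n%:R * x <= (1 - x) ^+ n.
Proof.
move=> /andP[x0 x1]; elim: n => [|n IH]; first by rewrite mul0r subr0 expr0.
rewrite exprS mulrSr.
have /(ler_wpM2l (_ : 0 <= 1 - x)) : 1 - n%:R * x <= (1 - x) ^+ n by [].
rewrite subr_ge0 x1 => /(_ isT); apply: le_trans.
have := mulr_ge0 (ler0n R n) (sqr_ge0 x); lra.
Qed.

Section scales.
Context {R : realFieldType} {d L : nat}.
Hypothesis d_gt0 : (0 < d)%N.
Notation D := ((2 ^ L).+1).
Notation cell := {ffun 'I_d -> 'I_D}.
Notation level := {ffun 'I_d -> 'I_(L.+2)}.

Let theta : R := 1 - (8 * d)%:R^-1.

Let d8 : 1 <= (8 * d)%:R :> R. Proof. by rewrite ler1n muln_gt0. Qed.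

Let d8V : 0 < ((8 * d)%:R : R)^-1 <= 1.
Proof. by rewrite invr_gt0 (lt_le_trans ltr01 d8)/= invf_le1// (lt_le_trans ltr01). Qed.

Let theta0 : 0 < theta.
Proof.
rewrite subr_gt0 invf_lt1 ?(lt_le_trans ltr01 d8)//.
by rewrite ltr1n; lia.
Qed.

Let theta1 : theta < 1.
Proof. by rewrite /theta ltrBlDr ltrDl; case/andP: d8V. Qed.

(** Scale [0] is the finest one and has the largest depth; a box of depth [e] in
some coordinate has mass at most [2 * 2 ^- e]. *)
Definition depth (sg : level) (j : 'I_d) : nat := (L.+1 - sg j)%N.

Definition scale_weight (sg : level) : R := \prod_j theta ^+ depth sg j.

Lemma scale_weight_gt0 sg : 0 < scale_weight sg.
Proof. by apply: prodr_gt0 => j _; rewrite exprn_gt0. Qed.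

Lemma sum_scale_weight : \sum_sg scale_weight sg <= (8 * d)%:R ^+ d.
Proof.
rewrite /scale_weight /depth.
rewrite -(bigA_distr_bigA (fun (j : 'I_d) (s : 'I_(L.+2)) => theta ^+ (L.+1 - s))) /=.
rewrite -[d in _ ^+ d]card_ord -prodr_const.
apply: ler_prod => j _; apply/andP; split.
  by apply: sumr_ge0 => s _; rewrite exprn_ge0// ltW.
rewrite (reindex_inj rev_ord_inj) /=.
under eq_bigr => s _.
  rewrite (_ : (L.+1 - (L.+2 - s.+1) = s)%N); last by have := ltn_ord s; lia.
  over.
apply: le_trans (geometric_sum_le _ (ltW theta0) theta1) _.
by rewrite /theta opprB addrC subrK invrK.
Qed.

(** A quantity below [2 ^- e_j] for every [j] is below a fixed fractional power
of the product of the [2 ^- e_j]; the base [theta] leaves three powers to pay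
for the weights in the chaining bound and one for summability. *)
Lemma min_scale_le (sg : level) (x : R) : (forall j, x <= 2 ^- depth sg j) ->
  x <= scale_weight sg ^+ 4.
Proof.
move=> xle.
have [j0 _ j0P] := arg_maxnP (depth sg) (erefl : xpredT (Ordinal d_gt0)).
apply: le_trans (xle j0) _; set e := depth sg j0.
(* This is where the value of [theta] comes from. *)
have half : 2^-1 <= theta ^+ (4 * d).
  have := @bernoulli_le R (8 * d)%:R^-1 (4 * d).
  case/andP: d8V => h1 h2; rewrite (ltW h1) h2 => /(_ isT); apply: le_trans.
  rewrite le_eqVlt (_ : 1 - _ = 2^-1) ?eqxx// !natrM.
  have d0 : (d%:R : R) != 0 by rewrite pnatr_eq0 -lt0n.
  by field.
rewrite -exprVn.
have /le_trans : (2^-1 : R) ^+ e <= (theta ^+ (4 * d)) ^+ e.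
  by rewrite lerXn2r ?nnegrE ?invr_ge0// exprn_ge0// ltW.
apply; rewrite -exprM /scale_weight.
have -> : theta ^+ (4 * d * e) = (\prod_(j < d) theta ^+ e) ^+ 4.
  rewrite prodr_const card_ord -!exprM; congr (_ ^+ _); lia.
rewrite lerXn2r ?nnegrE ?prodr_ge0// => [j _|j _|]; rewrite ?exprn_ge0 ?(ltW theta0)//.
apply: ler_prod => j _; rewrite exprn_ge0 ?(ltW theta0)//=.
by rewrite ler_wiXn2l ?(ltW theta0) ?(ltW theta1)//; exact: j0P.
Qed.

End scales.

Section block_sums.
Context {R : realFieldType} {Y : finType} {d L l : nat}.
Hypotheses (d_gt0 : (0 < d)%N) (l_gt0 : (0 < l)%N).
Notation D := ((2 ^ L).+1).
Notation cell := {ffun 'I_d -> 'I_D}.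
Notation corner := {ffun 'I_d -> 'I_D.+1}.
Notation level := {ffun 'I_d -> 'I_(L.+2)}.

Variables (pi : Y -> R) (cell_of : 'I_l -> Y -> cell) (act : nat -> 'I_l -> bool)
  (p : cell -> R).
Hypotheses (pi_ge0 : forall y, 0 <= pi y) (pi_sum1 : \sum_y pi y = 1)
  (cell_law : forall i c, \sum_y pi y * (cell_of i y == c)%:R = p c)
  (p_margin : forall j s v, (s < L.+2)%N ->
     \sum_(c : cell | (c j %/ 2 ^ s == v)%N) p c <= 2 ^+ s / 2 ^+ L).

Definition mean_of (g : cell -> R) : R := \sum_c p c * g c.

(** Division by the block length keeps the deviation of a block below one, so that
the number of blocks is the only size left in the moment bounds. *)
Definition block_dev (g : cell -> R) (b : nat) (y : Y) : R :=
  l%:R^-1 * \sum_i (act b i)%:R * (g (cell_of i y) - mean_of g).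

Definition cell_dev (a : seq Y) (c : cell) : R :=
  path_sum (block_dev (fun c' => (c' == c)%:R)) a.

Lemma sum_pick (g : cell -> R) (c0 : cell) : \sum_c (c0 == c)%:R * g c = g c0.
Proof.
rewrite (bigD1 c0)//= eqxx mul1r big1 ?addr0// => c; rewrite eq_sym => /negbTE ->.
by rewrite mul0r.
Qed.

Lemma expect_cell (g : cell -> R) i : \sum_y pi y * g (cell_of i y) = mean_of g.
Proof.
rewrite /mean_of; under [RHS]eq_bigr => c _ do rewrite -(cell_law i) mulr_suml.
rewrite exchange_big; apply: eq_bigr => y _.
by rewrite -(sum_pick g) mulr_sumr; apply: eq_bigr => c _; rewrite mulrA.
Qed.

Lemma block_dev_linear (g : cell -> R) b y :
  block_dev g b y = \sum_c block_dev (fun c' => (c' == c)%:R) b y * g c.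
Proof.
rewrite /block_dev; under [RHS]eq_bigr => c _ do rewrite -mulrA mulr_suml.
rewrite -mulr_sumr exchange_big; congr (_ * _); apply: eq_bigr => i _ /=.
under eq_bigr => c _ do rewrite -mulrA.
rewrite -mulr_sumr; congr (_ * _).
under eq_bigr => c _ do rewrite mulrBl.
rewrite sumrB sum_pick; congr (_ - _); rewrite /mean_of.
under [RHS]eq_bigr => c _ do rewrite mulr_suml.
rewrite [RHS]exchange_big /=; apply: eq_bigr => c _.
under eq_bigr => c' _ do rewrite -mulrA.
by rewrite -mulr_sumr sum_pick.
Qed.

Lemma cell_dev_sum (g : cell -> R) a :
  \sum_c cell_dev a c * g c = path_sum (block_dev g) a.
Proof.
elim: a => [|y a IH] /=; first by rewrite big1// => c _; rewrite /cell_dev /= mul0r.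
rewrite -IH (block_dev_linear g) -big_split; apply: eq_bigr => c _ /=.
by rewrite /cell_dev /= mulrDl.
Qed.

Lemma cell_prob_ge0 c : 0 <= p c.
Proof.
rewrite -(cell_law (Ordinal l_gt0)).
by apply: sumr_ge0 => y _; rewrite mulr_ge0.
Qed.

Lemma cell_prob_sum1 : \sum_c p c = 1.
Proof.
have := expect_cell (fun=> 1) (Ordinal l_gt0); rewrite /mean_of.
under eq_bigr do rewrite mulr1.
by under [in RHS]eq_bigr do rewrite mulr1; rewrite pi_sum1.
Qed.

Let lr : (l%:R : R) != 0. Proof. by rewrite pnatr_eq0 -lt0n. Qed.

(** All terms of one block may be arbitrarily dependent: averaging [l]
indicators still costs no more than the variance of one of them. *)
Lemma indicator_moment (A : pred cell) B :
  expect B (iid_law pi) (fun a => path_sum (block_dev (fun c => (A c)%:R)) a ^+ 4) <=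
  B%:R * mean_of (fun c => (A c)%:R) + 3 * B%:R ^+ 2 * mean_of (fun c => (A c)%:R) ^+ 2.
Proof.
pose g (c : cell) : R := (A c)%:R.
rewrite -/g; set q := mean_of g.
have q01 : 0 <= q <= 1.
  rewrite /q /mean_of sumr_ge0 /=; last first.
    by move=> c _; rewrite mulr_ge0// cell_prob_ge0.
  rewrite -[leRHS]cell_prob_sum1; apply: ler_sum => c _.
  by rewrite ler_piMr ?cell_prob_ge0// lern1; case: (A c).
have gE c : g c ^+ 2 = g c by rewrite /g -natrX; case: (A c).
have dev1 i y : `|g (cell_of i y) - q| <= 1.
  by rewrite ler_norml /g; move: q01; case: (A _) => /=; lra.
apply: fourth_moment => // [b|b y|b].
- rewrite /block_dev; under eq_bigr => y _ do rewrite mulrCA mulr_sumr.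
  rewrite -mulr_sumr exchange_big big1 ?mulr0// => i _ /=.
  under eq_bigr => y _ do rewrite mulrCA.
  rewrite -mulr_sumr; under eq_bigr => y _ do rewrite mulrBr.
  by rewrite sumrB -mulr_suml pi_sum1 mul1r expect_cell subrr mulr0.
- rewrite normrM ger0_norm ?invr_ge0// ler_pdivrMl ?ltr0n// mulr1.
  apply: le_trans (ler_norm_sum _ _ _) _.
  rewrite -[leRHS](_ : \sum_(i < l) 1 = l%:R); last by rewrite sumr_const card_ord.
  apply: ler_sum => i _; rewrite normrM -[leRHS]mul1r ler_pM// normr_nat lern1.
  by case: (act b i).
- have le y : block_dev g b y ^+ 2 <= l%:R^-1 * \sum_i (g (cell_of i y) - q) ^+ 2.
    rewrite /block_dev mulr_sumr.
    have l0 (_ : 'I_l) : 0 <= l%:R^-1 :> R by rewrite invr_ge0.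
    apply: le_trans (cauchy_weighted _ l0) _.
    rewrite sumr_const card_ord -[_ *+ l]mulr_natl mulfV// mul1r mulr_sumr.
    apply: ler_sum => i _.
    rewrite ler_wpM2l ?invr_ge0// exprMn ler_piMl ?sqr_ge0//.
    by rewrite -natrX lern1; case: (act b i).
  apply: le_trans (_ : \sum_c pi c * (l%:R^-1 * \sum_i (g (cell_of i c) - q) ^+ 2) <= _).
    by apply: ler_sum => y _; rewrite ler_wpM2l.
  under eq_bigr => y _ do rewrite mulrCA mulr_sumr.
  rewrite -mulr_sumr exchange_big /= ler_pdivrMl ?ltr0n// mulr_natl.
  rewrite -[l in leRHS](card_ord l) -sumr_const; apply: ler_sum => i _.
  have sqE y : pi y * (g (cell_of i y) - q) ^+ 2 =
      (1 - 2 * q) * (pi y * g (cell_of i y)) + q ^+ 2 * pi y.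
    by have := gE (cell_of i y); set x := g _ => xx; ring: xx.
  under eq_bigr => y _ do rewrite sqE.
  rewrite big_split /= -!mulr_sumr pi_sum1 (expect_cell g) -/q; nra.
Qed.

(** The boxes of one shape partition the cells, so their fourth moments add up to at
most a multiple of [s ^ 4] times the largest box mass.  The linear term of the fourth moment
fits into this bound because the mesh [2 ^- L] is no finer than [s ^- 2]. *)
Lemma max_corner_moment (s : R) B : 0 < s -> B%:R <= s ^+ 2 -> 2 ^+ L <= s ^+ 2 ->
  expect B (iid_law pi) (fun a =>
    (s^-1 * \big[Num.max/0]_(x : corner) `|corner_mass (cell_dev a) x|) ^+ 4) <=
  8 * ((8 * d)%:R ^+ d) ^+ 4.
Proof.
move=> s0 Bs Ls.
pose TH : R := (8 * d)%:R ^+ d.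
pose Phi a := s ^- 4 * (TH ^+ 3 * \sum_(sg : level) scale_weight sg ^- 3 *
  \sum_v box_mass (cell_dev a) sg v ^+ 4).
have sw0 (sg : level) : 0 < scale_weight sg :> R by exact: scale_weight_gt0.
have TH0 : 0 <= TH by rewrite exprn_ge0.
have sumge0 a : 0 <= \sum_(sg : level) scale_weight sg ^- 3 *
    \sum_v box_mass (cell_dev a) sg v ^+ 4.
  apply: sumr_ge0 => sg _; rewrite mulr_ge0 ?invr_ge0 ?exprn_ge0 ?(ltW (sw0 _))//.
  by apply: sumr_ge0 => v _; rewrite (_ : 4 = 2 * 2)%N// exprM sqr_ge0.
apply: (@le_trans _ _ (expect B (iid_law pi) Phi)).
  apply: le_expect => [a|a _]; first exact: iid_law_ge0.
  rewrite exprMn exprVn /Phi ler_wpM2l ?invr_ge0 ?exprn_ge0 ?(ltW s0)//.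
  apply: (big_ind (fun t => t ^+ 4 <= _)).
  - by rewrite expr0n /= mulr_ge0// exprn_ge0.
  - by move=> t u ht hu; rewrite /Num.max; case: ifP.
  - move=> x _; rewrite (_ : 4 = 2 * 2)%N// exprM real_normK ?num_real// -exprM.
    apply: le_trans (corner_mass_pow4 _ _ sw0) _.
    rewrite ler_wpM2r// lerXn2r ?nnegrE// ?sumr_ge0// => [sg _|]; first exact: ltW.
    exact: sum_scale_weight.
rewrite /Phi !expectZ expect_sum.
have TH4 : TH ^+ 4 = TH ^+ 3 * TH by rewrite exprSr.
rewrite -/TH TH4.
have box sg v : expect B (iid_law pi) (fun a => box_mass (cell_dev a) sg v ^+ 4) <=
    s ^+ 4 * 8 * scale_weight sg ^+ 4 * mean_of (fun c => (dyadic_box sg v c)%:R).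
  under [leLHS]eq_expect => a _ do rewrite /box_mass cell_dev_sum.
  apply: le_trans (indicator_moment _ _) _; set q := mean_of _.
  have q0 : 0 <= q.
    by apply: sumr_ge0 => c _; rewrite mulr_ge0// cell_prob_ge0.
  have depthE j : (2 : R) ^+ sg j / 2 ^+ L = 2 * 2 ^- depth sg j.
    have -> : (2 : R) ^+ L = 2 ^+ sg j * 2 ^+ depth sg j / 2.
      rewrite -exprD /depth subnKC; last by have := ltn_ord (sg j); lia.
      by rewrite exprS [2 * _]mulrC mulfK// pnatr_eq0.
    have x0 : (2 : R) ^+ sg j != 0 by rewrite expf_neq0// pnatr_eq0.
    have y0 : (2 : R) ^+ depth sg j != 0 by rewrite expf_neq0// pnatr_eq0.
    by move: x0 y0; move: (2 ^+ sg j) (2 ^+ depth sg j) => x y x0 y0; field; rewrite ?x0 ?y0 ?pnatr_eq0.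
  have q_le : q / 2 <= scale_weight sg ^+ 4.
    apply: min_scale_le => // j.
    rewrite ler_pdivrMr// mulrC -depthE.
    apply: le_trans (p_margin j (v j) (ltn_ord (sg j))).
    rewrite /q /mean_of [leRHS]big_mkcond; apply: ler_sum => c _.
    have := cell_prob_ge0 c; case: (boolP (dyadic_box sg v c)) => [/forallP/(_ j) ->|_].
      by rewrite mulr1.
    by rewrite mulr0; case: ifP.
  have L_le : 2 ^- L / 2 <= scale_weight sg ^+ 4 :> R.
    apply: min_scale_le => // j.
    rewrite ler_pdivrMr// mulrC -depthE -[leLHS]mul1r ler_wpM2r ?invr_ge0 ?exprn_ge0//.
    by rewrite exprn_ege1// ler1n.
  have {}L_le : s ^- 2 <= 2 * scale_weight sg ^+ 4.
    apply: (@le_trans _ _ (2 ^- L)); last by move: L_le; lra.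
    by rewrite lef_pV2 ?posrE ?exprn_gt0.
  set W := scale_weight sg ^+ 4 in q_le L_le *.
  have B0 : 0 <= (B%:R : R) by [].
  have s2 : 0 < s ^+ 2 by rewrite exprn_gt0.
  have -> : s ^+ 4 = s ^+ 2 * s ^+ 2 by rewrite -exprD.
  have L1 : 1 <= s ^+ 2 * (2 * W).
    by rewrite -[leLHS](_ : s ^+ 2 * s ^- 2 = 1) ?ler_wpM2l ?mulfV ?gt_eqF ?(ltW s2).
  move: Bs L1 s2; set t := s ^+ 2 => Bs L1 s2.
  have W0 : 0 <= W by rewrite exprn_ge0// ltW.
  have h1 : B%:R * q <= t * (t * (2 * W)) * q.
    rewrite ler_wpM2r//; apply: le_trans Bs _.
    by rewrite ler_peMr// ltW.
  have h2 : B%:R ^+ 2 * q ^+ 2 <= t ^+ 2 * (2 * W * q).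
    apply: ler_pM; rewrite ?sqr_ge0//.
      by rewrite lerXn2r ?nnegrE ?(ltW s2).
    rewrite expr2 ler_wpM2r//; move: q_le; lra.
  by move: h1 h2; lra.
apply: (@le_trans _ _ (s ^- 4 * (TH ^+ 3 * \sum_(sg : level) s ^+ 4 * 8 * scale_weight sg))).
  rewrite ler_wpM2l ?invr_ge0 ?exprn_ge0 ?(ltW s0)// ler_wpM2l ?exprn_ge0//.
  apply: ler_sum => sg _; rewrite expectZ expect_sum.
  apply: (@le_trans _ _ (scale_weight sg ^- 3 * \sum_v
     (s ^+ 4 * 8 * scale_weight sg ^+ 4 * mean_of (fun c => (dyadic_box sg v c)%:R)))).
    rewrite ler_wpM2l ?invr_ge0 ?exprn_ge0 ?(ltW (sw0 _))//.
    by apply: ler_sum => v _; exact: box.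
  rewrite -mulr_sumr.
  have -> : \sum_(v : cell) mean_of (fun c => (dyadic_box sg v c)%:R) = 1.
    rewrite /mean_of exchange_big -[RHS]cell_prob_sum1; apply: eq_bigr => c _ /=.
    rewrite -mulr_sumr -[RHS]mulr1; congr (_ * _).
    rewrite (bigD1 [ffun j => inord (c j %/ 2 ^ sg j)]) //= big1 => [|v vn].
      rewrite addr0 (_ : dyadic_box _ _ _ = true)//; apply/forallP => j.
      rewrite ffunE inordK//; have := leq_div (c j) (2 ^ sg j).
      by have := ltn_ord (c j); lia.
    case: (boolP (dyadic_box _ _ _)) => // /forallP h; case/eqP: vn.
    apply/ffunP => j; rewrite ffunE; apply/val_inj => /=.
    have /eqP e := h j; rewrite inordK// e; exact: ltn_ord.
  have := sw0 sg; rewrite lt0r => /andP[h _].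
  by rewrite mulr1 le_eqVlt; apply/orP; left; apply/eqP; field.
rewrite -mulr_sumr.
have := sum_scale_weight (L := L) (R := R) d_gt0; rewrite -/TH; set SS := \sum_sg _ => hS.
have -> : s ^- 4 * (TH ^+ 3 * (s ^+ 4 * 8 * SS)) = 8 * (TH ^+ 3 * SS).
  by field; rewrite gt_eqF.
by rewrite ler_wpM2l// ler_wpM2l// exprn_ge0.
Qed.

End block_sums.

(** * Weighted norms over the block sizes *)

Lemma path_sum_swap (R : realFieldType) (Y : finType) (h : nat -> Y -> R) a b c c' :
  path_sum h (a ++ c :: b) - path_sum h (a ++ c' :: b) = h (size b) c - h (size b) c'.
Proof. elim: a => [|y a IH] /=; first by ring. by rewrite -IH !size_cat /=; ring. Qed.

Lemma le_bigmax_add (R : realDomainType) (I : finType) (F G : I -> R) (delta : R) :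
  0 <= delta -> (forall i, 0 <= G i) -> (forall i, F i <= G i + delta) ->
  \big[Num.max/0]_i F i <= \big[Num.max/0]_i G i + delta.
Proof.
move=> d0 G0 FG; apply: bigmax_le => [|i _].
  by rewrite addr_ge0// bigmax_ge_id.
by apply: le_trans (FG i) _; rewrite lerD2r; exact: le_bigmax.
Qed.

Section weighted_norm.
Context {R : rcfType} {K : finType} (w : K -> R) (Q : pred K).
Hypotheses (w_ge0 : forall k, Q k -> 0 <= w k) (w_sum1 : \sum_(k | Q k) w k = 1).

Definition weighted_norm (F : K -> R) : R := Num.sqrt (\sum_(k | Q k) w k * F k ^+ 2).

Lemma weighted_sum_ge0 (F : K -> R) : 0 <= \sum_(k | Q k) w k * F k ^+ 2.
Proof. by apply: sumr_ge0 => k Qk; rewrite mulr_ge0 ?sqr_ge0 ?w_ge0. Qed.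

(** Minkowski's inequality against a constant function, the weights having total
mass one. *)
Lemma weighted_norm_add (F G : K -> R) (delta : R) : 0 <= delta ->
  (forall k, Q k -> 0 <= F k <= G k + delta) ->
  weighted_norm F <= weighted_norm G + delta.
Proof.
move=> d0 FG; set N := weighted_norm G.
have N0 : 0 <= N by exact: sqrtr_ge0.
have NE : \sum_(k | Q k) w k * G k ^+ 2 = N ^+ 2 by rewrite sqr_sqrtr// weighted_sum_ge0.
have meanG : \sum_(k | Q k) w k * G k <= N.
  have [m0|/ltW m0] := lerP (\sum_(k | Q k) w k * G k) 0; first exact: le_trans m0 N0.
  have w0 k : 0 <= (Q k)%:R * w k.
    by case: (boolP (Q k)) => [/w_ge0|_]; rewrite ?mul1r ?mul0r.
  rewrite -(@ler_pXn2r _ 2) ?nnegrE// -NE.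
  have := cauchy_weighted G w0.
  have e (t : K -> R) : \sum_k (Q k)%:R * w k * t k = \sum_(k | Q k) w k * t k.
    by rewrite [RHS]big_mkcond; apply: eq_bigr => k _; case: (Q k); rewrite /= ?(mul1r, mul0r).
  rewrite !e (_ : \sum_k (Q k)%:R * w k = 1) ?mul1r//.
  rewrite -[RHS]w_sum1 [RHS]big_mkcond; apply: eq_bigr => k _.
  by case: (Q k); rewrite /= ?(mul1r, mul0r).
rewrite -[leRHS]ger0_norm ?addr_ge0// -sqrtr_sqr ler_wsqrtr//.
apply: (@le_trans _ _ (\sum_(k | Q k) w k * (G k + delta) ^+ 2)).
  apply: ler_sum => k Qk; have /andP[F0 Fle] := FG k Qk.
  by rewrite ler_wpM2l ?w_ge0// lerXn2r ?nnegrE// (le_trans F0).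
have -> : \sum_(k | Q k) w k * (G k + delta) ^+ 2 = 
    N ^+ 2 + 2 * delta * (\sum_(k | Q k) w k * G k) + delta ^+ 2.
  have -> : delta ^+ 2 = \sum_(k | Q k) w k * delta ^+ 2.
    by rewrite -mulr_suml w_sum1 mul1r.
  rewrite -NE !mulr_sumr -!big_split /=.
  by apply: eq_bigr => k _; ring.
have := ler_wpM2l d0 meanG; nra.
Qed.

End weighted_norm.

Section weighted_deviation.
Context {R : rcfType} {Y : finType} {K : finType} {d L l : nat}.
Hypotheses (d_gt0 : (0 < d)%N) (l_gt0 : (0 < l)%N).
Notation D := ((2 ^ L).+1).
Notation cell := {ffun 'I_d -> 'I_D}.
Notation corner := {ffun 'I_d -> 'I_D.+1}.

Variables (pi : Y -> R) (w : K -> R) (Q : pred K)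
  (cell_of : K -> 'I_l -> Y -> cell) (act : K -> nat -> 'I_l -> bool)
  (p : K -> cell -> R).
Hypotheses (pi_ge0 : forall y, 0 <= pi y) (pi_sum1 : \sum_y pi y = 1)
  (w_ge0 : forall k, Q k -> 0 <= w k) (w_sum1 : \sum_(k | Q k) w k = 1)
  (cell_law : forall k, Q k -> forall i c, \sum_y pi y * (cell_of k i y == c)%:R = p k c)
  (p_margin : forall k, Q k -> forall j s v, (s < L.+2)%N ->
     \sum_(c : cell | (c j %/ 2 ^ s == v)%N) p k c <= 2 ^+ s / 2 ^+ L).

Definition max_dev (a : seq Y) (k : K) : R :=
  \big[Num.max/0]_(x : corner) `|corner_mass (cell_dev (cell_of k) (act k) (p k) a) x|.

Lemma block_dev_diff k (g : cell -> R) b y y' : (forall c, 0 <= g c <= 1) ->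
  `|block_dev (cell_of k) (act k) (p k) g b y - block_dev (cell_of k) (act k) (p k) g b y'| <= 1.
Proof.
move=> g01; rewrite -mulrBr -sumrB normrM ger0_norm ?invr_ge0//.
rewrite ler_pdivrMl ?ltr0n// mulr1.
apply: le_trans (ler_norm_sum _ _ _) _.
rewrite -[leRHS](_ : \sum_(i < l) 1 = l%:R); last by rewrite sumr_const card_ord.
apply: ler_sum => i _; rewrite -mulrBr normrM -[leRHS]mul1r ler_pM// ?normr_nat ?lern1.
  by case: (act k b i).
have := g01 (cell_of k i y); have := g01 (cell_of k i y'); rewrite ler_norml; lra.
Qed.

(** One block contributes an average of indicators, hence a number in the unit
interval up to centring. *)
Lemma max_dev_lip a b c c' k : max_dev (a ++ c :: b) k <= max_dev (a ++ c' :: b) k + 1.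
Proof.
apply: le_bigmax_add => // x.
rewrite -lerBlDl; apply: le_trans (lerB_dist _ _) _.
rewrite /corner_mass !cell_dev_sum path_sum_swap; apply: block_dev_diff => e.
by rewrite ler0n lern1; case: (below _ _).
Qed.

(** Chaining gives the constant, which does not depend on the number of blocks;
decoupling gives the last term, because one block moves the normalized norm by
at most [1 / s].  Moments are compared through [x <= (1 + x ^ 2) / 2], used
twice. *)
Lemma weighted_deviation (J : seq Y -> R) (kappa s : R) B :
  J [::] = 1 -> (forall a, \sum_c J (c :: a) = J a) ->
  (forall b, (b < B)%N ->
     \sum_(a : b.-tuple Y) \sum_c `|J (c :: a) - pi c * J a| <= kappa) ->
  0 < s -> B%:R <= s ^+ 2 -> 2 ^+ L <= s ^+ 2 ->
  expect B J (fun a => s^-1 * weighted_norm w Q (max_dev a)) <=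
  1 + 2 * ((8 * d)%:R ^+ d) ^+ 4 + B%:R * (kappa / s).
Proof.
move=> J1 JS dep s0 Bs Ls.
have sV0 : 0 <= s^-1 by rewrite invr_ge0 ltW.
have Y0 : (0 < #|Y|)%N.
  have [Y0|//] := posnP #|Y|; move: pi_sum1; rewrite big1 ?(@eqP _ 0 1) => [|y _].
    by move/eqP; rewrite eq_sym oner_eq0.
  by have := max_card (pred1 y); rewrite Y0 card1.
apply: le_trans (decoupling pi_ge0 pi_sum1 Y0 sV0 J1 JS dep (Phi := _) _) _.
  move=> a c c' b.
  suff le u u' : s^-1 * weighted_norm w Q (max_dev (a ++ u :: b)) <=
       s^-1 * weighted_norm w Q (max_dev (a ++ u' :: b)) + s^-1.
    by rewrite ler_distl; have := le c c'; have := le c' c; lra.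
  rewrite -[X in _ + X]mulr1 -mulrDr ler_wpM2l//.
  apply: weighted_norm_add => // k _; rewrite max_dev_lip andbT.
  exact: bigmax_ge_id.
rewrite lerD2r.
pose G k a := (s^-1 * max_dev a k) ^+ 4.
apply: (@le_trans _ _ (expect B (iid_law pi) (fun a => 3 / 4 + 4^-1 * \sum_(k | Q k) w k * G k a))).
  apply: le_expect => [a|a _]; first exact: iid_law_ge0.
  set x := s^-1 * _.
  have x2 : x ^+ 2 = \sum_(k | Q k) w k * (s^-1 * max_dev a k) ^+ 2.
    rewrite /x exprMn sqr_sqrtr ?weighted_sum_ge0// mulr_sumr.
    by apply: eq_bigr => k _; rewrite exprMn; ring.
  have : x ^+ 2 <= 2^-1 + 2^-1 * \sum_(k | Q k) w k * G k a.
    have half : 2^-1 = \sum_(k | Q k) w k * 2^-1 by rewrite -mulr_suml w_sum1 mul1r.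
    rewrite x2 [X in X + _]half mulr_sumr -big_split /=.
    apply: ler_sum => k Qk; rewrite /G; set t := s^-1 * _.
    have : 0 <= w k * (t ^+ 2 - 1) ^+ 2 by rewrite mulr_ge0 ?sqr_ge0 ?w_ge0.
    rewrite (_ : t ^+ 4 = (t ^+ 2) ^+ 2); last by rewrite -exprM.
    lra.
  have := sqr_ge0 (x - 1); lra.
rewrite expectD expect_iid_cst// expectZ expect_sum.
have : \sum_(k | Q k) expect B (iid_law pi) (fun a => w k * G k a) <=
    8 * ((8 * d)%:R ^+ d) ^+ 4.
  rewrite -[leRHS]mul1r -[X in X * _]w_sum1 mulr_suml; apply: ler_sum => k Qk.
  rewrite expectZ ler_wpM2l ?w_ge0//.
  exact: (max_corner_moment d_gt0 l_gt0 (act k) pi_ge0 pi_sum1 (cell_law Qk) (p_margin Qk)).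
lra.
Qed.

End weighted_deviation.

Local Open Scope classical_set_scope.
Local Open Scope ring_scope.

(** * Stationary processes: cylinders, time shifts and mixing *)

Section real_probability.
Context {disp : measure_display} {T : measurableType disp} {R : realType}.
Context (P : probability T R).

Definition pr (A : set T) : R := fine (P A).

Lemma pr_ge0 A : 0 <= pr A.
Proof. exact: fine_ge0. Qed.

Lemma EFin_pr A : measurable A -> (pr A)%:E = P A.
Proof. by move=> mA; rewrite fineK// fin_num_measure. Qed.

Lemma prT : pr setT = 1.
Proof. by rewrite /pr probability_setT. Qed.

Lemma le_pr A B : measurable A -> measurable B -> A `<=` B -> pr A <= pr B.
Proof. by move=> mA mB AB; rewrite -lee_fin !EFin_pr// le_measure ?inE. Qed.

Lemma pr_le1 A : measurable A -> pr A <= 1.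
Proof. by move=> mA; rewrite -prT le_pr. Qed.

Lemma prU A B : measurable A -> measurable B -> [disjoint A & B] ->
  pr (A `|` B) = pr A + pr B.
Proof.
move=> mA mB /disj_setPS AB; apply: EFin_inj.
rewrite EFinD !EFin_pr//; last exact: measurableU.
by apply: measureU => //; apply/seteqP; split.
Qed.

Lemma prD A B : measurable A -> measurable B -> A `<=` B ->
  pr (B `\` A) = pr B - pr A.
Proof.
move=> mA mB AB; rewrite -[in RHS](setDUK AB) prU.
- by rewrite addrAC subrr add0r.
- by [].
- exact: measurableD.
- by apply/disj_setPS => w [? []].
Qed.

Lemma prU_le A B : measurable A -> measurable B -> pr (A `|` B) <= pr A + pr B.
Proof.
move=> mA mB; rewrite -lee_fin EFinD !EFin_pr//; last exact: measurableU.
exact: measureU2.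
Qed.

Lemma pr_bigsetU_le (I : Type) (s : seq I) (A : I -> set T) :
  (forall i, measurable (A i)) ->
  pr (\big[setU/set0]_(i <- s) A i) <= \sum_(i <- s) pr (A i).
Proof.
move=> mA; elim: s => [|i s IH]; first by rewrite !big_nil /pr measure0.
rewrite !big_cons; apply: le_trans (prU_le _ _) _ => //.
  exact: bigsetU_measurable.
by rewrite lerD2l.
Qed.

Lemma prC A : measurable A -> pr (~` A) = 1 - pr A.
Proof.
move=> mA; apply: EFin_inj; rewrite EFinB !EFin_pr//; last exact: measurableC.
exact: probability_setC.
Qed.

Lemma measurable_fin_preimage (I : finType) (f : T -> I) (Q : set I) :
  (forall i, measurable (f @^-1` [set i])) -> measurable (f @^-1` Q).
Proof.
move=> mf; rewrite (_ : f @^-1` Q = \bigcup_(i in Q) (f @^-1` [set i])).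
  by apply: fin_bigcup_measurable => // i _.
by apply/seteqP; split=> [w Qw|w [i Qi /= ->]]//; exists (f w).
Qed.

Lemma pr_sum_fin (I : finType) (f : T -> I) (A : set T) (Q : pred I) :
  (forall i, measurable (f @^-1` [set i])) -> measurable A ->
  pr (A `&` [set w | Q (f w)]) = \sum_(i | Q i) pr (A `&` f @^-1` [set i]).
Proof.
move=> mf mA.
have gen (s : seq I) : uniq s -> 
    pr (A `&` [set w | f w \in s]) = \sum_(i <- s) pr (A `&` f @^-1` [set i]).
  elim: s => [_|i s IH /= /andP[ins us]].
    rewrite big_nil (_ : A `&` _ = set0) ?/pr ?measure0//.
    by apply/seteqP; split=> [w []|].
  rewrite big_cons -IH// -prU.
  - congr pr; apply/seteqP; split=> w /=.
      by rewrite inE => -[Aw /orP[/eqP ->|]]; [left|right].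
    by case=> -[Aw e]; split=> //; rewrite inE; [rewrite e eqxx|rewrite e orbT].
  - exact: measurableI.
  - by apply: measurableI => //; exact: (measurable_fin_preimage [set i | i \in s]).
  - apply/disj_setPS => w /= [[_ e] [_]]; rewrite e => h.
    by rewrite h in ins.
rewrite -big_enum /= -gen ?enum_uniq//; congr (pr (A `&` _)).
by apply/seteqP; split => w /=; rewrite mem_enum.
Qed.

Lemma pr_total (I : finType) (f : T -> I) (A : set T) :
  (forall i, measurable (f @^-1` [set i])) -> measurable A ->
  pr A = \sum_i pr (A `&` f @^-1` [set i]).
Proof.
move=> mf mA; rewrite -pr_sum_fin//; congr pr.
by apply/seteqP; split=> w //= [].
Qed.

Lemma sum_trivIset_le (n : nat) (A : 'I_n -> set T) (C : set T) :
  (forall i, measurable (A i)) -> trivIset setT A -> measurable C ->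
  \sum_i pr (C `&` A i) <= pr C.
Proof.
move=> mA tA mC.
have mCA i : measurable (C `&` A i) by exact: measurableI.
rewrite -lee_fin EFin_pr// -sumEFin; under eq_bigr do rewrite EFin_pr//.
have := @measure_bigsetU_ord _ _ _ P n xpredT (fun i => C `&` A i) mCA => <-.
  apply: le_measure; rewrite ?inE//; first exact: bigsetU_measurable.
  by move=> w; rewrite -bigcup_seq => -[i _ []].
exact: trivIset_setIl.
Qed.

End real_probability.

Section cylinders.
Context {R : realType} {d : nat}.

Definition trajectory := int -> 'I_d -> R.

Definition shift (h : int) (x : trajectory) : trajectory := fun t => x (t + h).

(** The finite Boolean algebra of events decided by finitely many coordinates
with times in [I]: membership in sigma-algebras, finite-dimensional laws and
time shifts are all checked by induction on these. *)
Inductive cylinder (I : set int) : set trajectory -> Prop :=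
| cylinderT : cylinder I setT
| cylinder_coord t j (B : set R) : I t -> measurable B ->
    cylinder I [set x | B (x t j)]
| cylinderI E F : cylinder I E -> cylinder I F -> cylinder I (E `&` F)
| cylinderC E : cylinder I E -> cylinder I (~` E).

Lemma cylinder_sub I J E : I `<=` J -> cylinder I E -> cylinder J E.
Proof.
move=> IJ; elim=> [|t j B It mB|A B _ cA _ cB|A _ cA].
- exact: cylinderT.
- by apply: cylinder_coord => //; exact: IJ.
- exact: cylinderI.
- exact: cylinderC.
Qed.

Lemma cylinder_forall I (K : finType) (E : K -> set trajectory) :
  (forall k, cylinder I (E k)) -> cylinder I [set x | forall k, E k x].
Proof.
move=> cE.
have gen (s : seq K) : cylinder I [set x | forall k, k \in s -> E k x].
  elim: s => [|k s IH].
    rewrite (_ : [set x | _] = setT); first exact: cylinderT.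
    by apply/seteqP; split=> // x _ k; rewrite in_nil.
  rewrite (_ : [set x | _] = E k `&` [set x | forall k, k \in s -> E k x]).
    exact: cylinderI.
  apply/seteqP; split=> x /=.
    by move=> h; split; [apply: h; rewrite mem_head|move=> k' k's; apply: h; rewrite inE k's orbT].
  by move=> [Ek h] k'; rewrite inE => /orP[/eqP ->|/h].
rewrite (_ : [set x | _] = [set x | forall k, k \in enum K -> E k x]) //.
apply/seteqP; split => x /= h k; first by move=> _; exact: h.
by apply: h; rewrite mem_enum.
Qed.

Lemma cylinder_shift I E (h : int) : cylinder I E ->
  cylinder [set t | I (t - h)] [set x | E (shift h x)].
Proof.
elim=> [|t j B It mB|A B _ cA _ cB|A _ cA].
- exact: cylinderT.
- by apply: (@cylinder_coord _ (t + h) j B) => //=; rewrite addrK.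
- exact: (cylinderI cA cB).
- exact: (cylinderC cA).
Qed.

Definition window (lo : int) (n : nat) (x : trajectory) : n.-tuple (d.-tuple R) :=
  [tuple [tuple x (lo + k%:Z) j | j < d] | k < n].

Lemma cylinder_window (lo : int) (n : nat) E :
  cylinder [set t | lo <= t < lo + n%:Z] E ->
  exists2 B : set (n.-tuple (d.-tuple R)), measurable B &
    E = window lo n @^-1` B.
Proof.
elim=> [|t j B /= It mB|A B _ [A' mA ->] _ [B' mB ->]|A _ [A' mA ->]].
- by exists setT.
- have [k kt] : exists k : 'I_n, t = lo + k%:Z.
    have lt : (`|t - lo| < n)%N by lia.
    by exists (Ordinal lt) => /=; lia.
  exists [set v | B (tnth (tnth v k) j)].
    have m1 : measurable_fun setT (fun v : n.-tuple (d.-tuple R) => tnth (tnth v k) j).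
      apply: (@measurableT_comp _ _ _ _ _ _ (fun u : d.-tuple R => tnth u j)
        _ (fun v : n.-tuple (d.-tuple R) => tnth v k)).
        exact: measurable_tnth.
      exact: measurable_tnth.
    by have := m1 measurableT B mB; rewrite setTI.
  by apply/seteqP; split=> x /=; rewrite /window !tnth_mktuple kt.
- by exists (A' `&` B'); first exact: measurableI.
- by exists (~` A'); first exact: measurableC.
Qed.

End cylinders.
Arguments trajectory : clear implicits.

Section stationary.
Context {disp : measure_display} {T : measurableType disp} {R : realType}.
Context {P : probability T R} {d : nat} (X : int -> 'I_d -> {RV P >-> R}).

Definition sample (w : T) : trajectory R d := fun t j => X t j w.

Lemma sigma_of_cylinder I E : cylinder I E -> sigma_of X I [set w | E (sample w)].
Proof.
elim=> [|t j B It mB|A B _ cA _ cB|A _ cA].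
- rewrite (_ : [set w | _] = ~` set0) ?setC0//.
  by rewrite -setC0; apply: sigma_algebraC; exact: sigma_algebra0.
- by apply: sub_sigma_algebra; exists t, j, B.
- rewrite (_ : [set w | _] = ~` (\bigcup_n (if n == 0%N then ~` [set w | A (sample w)]
      else ~` [set w | B (sample w)]))).
    apply: sigma_algebraC; apply: sigma_algebra_bigcup => n.
    by case: ifP => _; exact: sigma_algebraC.
  apply/seteqP; split=> w /=.
    by move=> [Aw Bw] [n _]; case: ifP => _ /=.
  move=> h; split; apply: contrapT => h'; apply: h; first by exists 0%N.
  by exists 1%N.
- exact: sigma_algebraC.
Qed.

Lemma sigma_of_measurable I A : sigma_of X I A -> measurable A.
Proof.
move=> sA; apply: (sA measurable); split=> [|B [t [j [D [_ mD ->]]]]].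
  exact: sigma_algebra_measurable.
by have := measurable_funPT (X t j) measurableT D mD; rewrite setTI.
Qed.

Lemma measurable_cylinder I E : cylinder I E -> measurable [set w | E (sample w)].
Proof. by move=> /sigma_of_cylinder/sigma_of_measurable. Qed.

Hypothesis X_stationary : strictly_stationary X.

(** An event decided inside a finite window is an event about a finite-dimensional
marginal. *)
Lemma pr_shift (lo : int) (n : nat) (h : int) E :
  cylinder [set t | lo <= t < lo + n%:Z] E ->
  pr P [set w | E (shift h (sample w))] = pr P [set w | E (sample w)].
Proof.
move=> /cylinder_window[B mB ->].
have := X_stationary [tuple lo + (k : nat)%:Z | k < n] h mB.
have e1 w : finite_dim X [tuple tnth [tuple lo + (k : nat)%:Z | k < n] k + h | k < n] w =
    window lo n (shift h (sample w)).
  apply: eq_from_tnth => k; apply: eq_from_tnth => j.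
  by rewrite !tnth_mktuple /shift /sample.
have e2 w : finite_dim X [tuple lo + (k : nat)%:Z | k < n] w = window lo n (sample w).
  by apply: eq_from_tnth => k; apply: eq_from_tnth => j; rewrite !tnth_mktuple.
rewrite /pr => e; congr fine; apply: etrans (etrans e _); congr (P _).
  by apply/seteqP; split=> w /=; rewrite e1.
by apply/seteqP; split=> w /=; rewrite e2.
Qed.

Lemma beta_mix_ub h : has_ubound [set x : R | exists k l (A : 'I_k -> set T) (B : 'I_l -> set T),
    [/\ finite_partition (past X) A, finite_partition (future X h) B &
      x = 2^-1 * \sum_(i < k) \sum_(j < l)
            `|fine (P (A i `&` B j)) - fine (P (A i)) * fine (P (B j))|]].
Proof.
exists 1 => _ [k [l [A [B [[sA tA cA] [sB tB cB] ->]]]]].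
have mA i : measurable (A i) by exact: sigma_of_measurable (sA i).
have mB i : measurable (B i) by exact: sigma_of_measurable (sB i).
have sumA : \sum_i pr P (A i) <= 1.
  rewrite -(prT P); apply: le_trans (sum_trivIset_le _ mA tA measurableT).
  by apply: ler_sum => i _; rewrite setTI.
have sumB : \sum_i pr P (B i) <= 1.
  rewrite -(prT P); apply: le_trans (sum_trivIset_le _ mB tB measurableT).
  by apply: ler_sum => i _; rewrite setTI.
have le2 : \sum_(i < k) \sum_(j < l) `|pr P (A i `&` B j) - pr P (A i) * pr P (B j)| <= 1 + 1.
  apply: (@le_trans _ _ (\sum_(i < k) (pr P (A i) + pr P (A i)))); last first.
    by rewrite big_split lerD.
  apply: ler_sum => i _.
  apply: (@le_trans _ _ (\sum_(j < l) (pr P (A i `&` B j) + pr P (A i) * pr P (B j)))).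
    apply: ler_sum => j _; apply: le_trans (ler_normB _ _) _.
    by rewrite !ger0_norm ?mulr_ge0 ?pr_ge0.
  rewrite big_split lerD//=; first exact: sum_trivIset_le.
  by rewrite -mulr_sumr ler_piMr ?pr_ge0.
by rewrite ler_pdivrMl// mulr1; exact: le2.
Qed.

(** Once time is shifted so that [t0] becomes the origin, the level sets of the two
observables are a partition of the past and one of the future at distance [h],
as in the supremum that defines the mixing coefficient. *)
Lemma beta_mix_cylinder (A C : finType) (y1 : trajectory R d -> A) (y2 : trajectory R d -> C)
    (lo t0 : int) (n h : nat) :
  (forall a, cylinder [set t | lo <= t < lo + n%:Z /\ t <= t0] [set x | y1 x = a]) ->
  (forall c, cylinder [set t | lo <= t < lo + n%:Z /\ t0 + h%:Z <= t] [set x | y2 x = c]) ->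
  \sum_a \sum_c `|pr P [set w | y1 (sample w) = a /\ y2 (sample w) = c] -
     pr P [set w | y1 (sample w) = a] * pr P [set w | y2 (sample w) = c]| <=
  2 * beta_mix X h.
Proof.
move=> c1 c2.
have s1 : [set t | lo <= t < lo + n%:Z /\ t <= t0] `<=` [set t | lo <= t < lo + n%:Z].
  by move=> t [].
have s2 : [set t | lo <= t < lo + n%:Z /\ t0 + h%:Z <= t] `<=` [set t | lo <= t < lo + n%:Z].
  by move=> t [].
pose A' (i : 'I_#|A|) := [set w | y1 (shift (- t0) (sample w)) = enum_val i].
pose C' (i : 'I_#|C|) := [set w | y2 (shift (- t0) (sample w)) = enum_val i].
have pA : finite_partition (past X) A'.
  split=> [i|i j _ _ [w [/= e1 e2]]|].
  - apply: sigma_of_cylinder (cylinder_sub _ (cylinder_shift (- t0) (c1 (enum_val i)))).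
    by move=> t /=; lia.
  - by apply: enum_val_inj; rewrite -e1 -e2.
  - apply/seteqP; split=> // w _; exists (enum_rank (y1 (shift (- t0) (sample w)))) => //=.
    by rewrite /A' /= enum_rankK.
have pC : finite_partition (future X h) C'.
  split=> [i|i j _ _ [w [/= e1 e2]]|].
  - apply: sigma_of_cylinder (cylinder_sub _ (cylinder_shift (- t0) (c2 (enum_val i)))).
    by move=> t /=; lia.
  - by apply: enum_val_inj; rewrite -e1 -e2.
  - apply/seteqP; split=> // w _; exists (enum_rank (y2 (shift (- t0) (sample w)))) => //=.
    by rewrite /C' /= enum_rankK.
rewrite -ler_pdivrMl//; apply: ub_le_sup; first exact: beta_mix_ub.
exists _, _, A', C'; split=> //; congr (_ * _).
rewrite [LHS]big_enum_val /=; apply: eq_bigr => i _.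
rewrite [LHS]big_enum_val /=; apply: eq_bigr => j _.
rewrite -(pr_shift (- t0) (cylinder_sub s1 (c1 _))) -(pr_shift (- t0) (cylinder_sub s2 (c2 _))).
by rewrite -(pr_shift (- t0) (cylinderI (cylinder_sub s1 (c1 _)) (cylinder_sub s2 (c2 _)))).
Qed.

End stationary.

(** * Uniform margins of block maxima *)

Section down_closed.
Context {R : realType}.

Definition down_closed (D : set R) := forall y z, D z -> y <= z -> D y.

Lemma down_closed_measurable (D : set R) : down_closed D -> measurable D.
Proof.
move=> dD; apply: is_interval_measurable => y z Dy Dz u /andP[_ uz].
exact: dD Dz uz.
Qed.

Lemma down_closed_le a : down_closed [set z : R | z <= a].
Proof. by move=> y z /= + h; exact: le_trans. Qed.

Lemma down_closed_lt a : down_closed [set z : R | z < a].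
Proof. by move=> y z /= + h; exact: le_lt_trans. Qed.

Lemma down_closed_comp D (F : R -> R) : down_closed D ->
  {homo F : y z / y <= z} -> down_closed [set z | D (F z)].
Proof. by move=> dD mF y z /= Dz /mF; exact: dD Dz. Qed.

End down_closed.

Section block_maxima.
Context {R : realType} {d : nat}.

Definition traj_max (k : nat) (t : int) (j : 'I_d) (x : trajectory R d) : R :=
  \big[Order.max/x t j]_(i < k) x (t + i%:Z) j.

(** A down-closed condition holds for a maximum when it holds for every term; this
makes conditions on uniformized block maxima cylinders. *)
Lemma traj_max_down (D : set R) k t j x : down_closed D ->
  D (traj_max k t j x) <-> D (x t j) /\ forall i : 'I_k, D (x (t + i%:Z) j).
Proof.
move=> dD; split=> [h|[h0 h]].
  split; first by apply: dD h _; exact: bigmax_ge_id.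
  by move=> i; apply: dD h _; exact: (le_bigmax _ (fun i : 'I_k => x (t + i%:Z) j)).
apply: (big_ind D) => // u v Du Dv.
by rewrite /Order.max; case: ifP.
Qed.

Lemma cylinder_traj_max (I : set int) (D : set R) k t j : down_closed D ->
  I t -> (forall i, (i < k)%N -> I (t + i%:Z)) ->
  cylinder I [set x | D (traj_max k t j x)].
Proof.
move=> dD It Iti; have mD := down_closed_measurable dD.
rewrite (_ : [set x | _] = [set x : trajectory R d | D (x t j)] `&`
    [set x | forall i : 'I_k, D (x (t + (i : nat)%:Z) j)]).
  apply: cylinderI; first exact: cylinder_coord.
  by apply: cylinder_forall => i; apply: cylinder_coord => //; exact: Iti.
by apply/seteqP; split=> x /=; rewrite traj_max_down.
Qed.

Lemma traj_max_shift k t h j x : traj_max k t j (shift h x) = traj_max k (t + h) j x.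
Proof.
by rewrite /traj_max /shift; apply: eq_bigr => i _; rewrite addrAC.
Qed.

End block_maxima.

Section uniform_margins.
Context {disp : measure_display} {T : measurableType disp} {R : realType}.
Context {P : probability T R} {d : nat} (X : int -> 'I_d -> {RV P >-> R}).
Hypotheses (X_stationary : strictly_stationary X)
  (X_continuous : forall j, continuous (cdf (X 1 j))).

Notation F := (block_cdf X).

Lemma measurable_block_max (D : set R) k t j : down_closed D ->
  measurable [set w | D (block_max X k t j w)].
Proof.
move=> dD; apply: (measurable_cylinder X (I := setT)
  (E := [set x | D (traj_max k t j x)])).
exact: cylinder_traj_max.
Qed.

Lemma measurable_coord (D : set R) t j : measurable D -> measurable [set w | D (X t j w)].
Proof. by move=> mD; have := measurable_funPT (X t j) measurableT D mD; rewrite setTI. Qed.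

Lemma block_cdf_homo k j : {homo F k j : y z / y <= z}.
Proof.
move=> y z yz; apply: le_pr; try exact: (measurable_block_max _ _ _ (@down_closed_le _ _)).
by move=> w /= h; exact: le_trans yz.
Qed.

Lemma block_cdf01 k j x : 0 <= F k j x <= 1.
Proof.
by rewrite pr_ge0 pr_le1//; exact: (measurable_block_max _ _ _ (@down_closed_le _ _)).
Qed.

Let G j z : R := pr P [set w | X 1 j w <= z].

Let G_cdf j : G j = fine \o cdf (X 1 j).
Proof. by apply/funext => z; rewrite /G /pr /= /cdf /distribution /pushforward set_itvNyc. Qed.

Let G_continuous j : continuous (G j).
Proof.
move=> z; rewrite G_cdf; apply: fine_cvg; rewrite fineK ?fin_num_measure//.
exact: X_continuous.
Qed.

Lemma pr_coord (D : set R) t j : measurable D ->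
  pr P [set w | D (X t j w)] = pr P [set w | D (X 1 j w)].
Proof.
move=> mD; rewrite -(pr_shift X_stationary (lo := 1) (n := 1) (t - 1)
  (E := [set x | D (x 1 j)])).
  by rewrite /shift /sample /= subrKC.
by apply: cylinder_coord => //=.
Qed.

Lemma traj_max_attained k t j w : (0 < k)%N ->
  exists i : 'I_k, block_max X k t j w = X (t + (i : nat)%:Z) j w.
Proof.
move=> k0; rewrite /block_max.
apply: (big_ind (fun u => exists i : 'I_k, u = X (t + (i : nat)%:Z) j w)) => //.
- by exists (Ordinal k0); rewrite /= addr0.
- by move=> u v hu hv; rewrite /Order.max; case: ifP.
- by move=> i _; exists i.
Qed.

(** The maximum is one of its [k] terms.  This bound carries continuity, and the
behaviour at infinity, over from the margin of [X 1 j] to that of the block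
maximum. *)
Lemma pr_block_max_le (B : set R) k t j : (0 < k)%N -> measurable B ->
  measurable [set w | B (block_max X k t j w)] ->
  pr P [set w | B (block_max X k t j w)] <= k%:R * pr P [set w | B (X 1 j w)].
Proof.
move=> k0 mB mM.
have mX i : measurable [set w | B (X i j w)] by exact: measurable_coord.
apply: (@le_trans _ _ (pr P (\big[setU/set0]_(i < k) [set w | B (X (t + i%:Z) j w)]))).
  apply: le_pr => //; first by apply: bigsetU_measurable => i _; exact: mX.
  move=> w /=; have [i ->] := traj_max_attained t j w k0; move=> Bi.
  by rewrite -bigcup_seq; exists i => //=; exact: mem_index_enum.
apply: le_trans (pr_bigsetU_le _ _ _) _ => //.
under eq_bigr => i _ do rewrite (pr_coord _ _ mB).
by rewrite sumr_const card_ord mulr_natl.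
Qed.

Let itv_diff (M : T -> R) y z : [set w | y < M w <= z] = [set w | M w <= z] `\` [set w | M w <= y].
Proof.
apply/seteqP; split=> w /=.
  by move=> /andP[h ->]; split=> //; rewrite leNgt h.
by move=> [-> /negP]; rewrite -ltNge => ->.
Qed.

Let mle k j z : measurable [set w | block_max X k 1 j w <= z].
Proof. exact: (measurable_block_max _ _ _ (@down_closed_le _ _)). Qed.

Let mle1 j z : measurable [set w | X 1 j w <= z].
Proof. by apply: (measurable_coord 1 j (D := [set u | u <= z])); exact: down_closed_measurable (@down_closed_le _ _). Qed.

Lemma block_cdf_modulus k j y z : (0 < k)%N -> y <= z ->
  F k j z - F k j y <= k%:R * (G j z - G j y).
Proof.
move=> k0 yz; rewrite /block_cdf /G -!prD//.
- rewrite -itv_diff -itv_diff; apply: (pr_block_max_le (B := `]y, z])) => //.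
    by rewrite itv_diff; exact: measurableD.
- by move=> w /= h; exact: le_trans yz.
- by move=> w /= h; exact: le_trans yz.
Qed.

Lemma block_cdf_continuous k j : (0 < k)%N -> continuous (F k j).
Proof.
move=> k0 z; apply/cvgrPdist_le => e e0.
have e1 : 0 < e / k%:R by rewrite divr_gt0// ltr0n.
have /cvgrPdist_le/(_ _ e1) := @G_continuous j z.
apply: filterS => y; rewrite ler_pdivlMr ?ltr0n// mulrC.
have [yz|/ltW zy] := leP y z.
  have Fyz := block_cdf_modulus j k0 yz; have mono := block_cdf_homo k j yz.
  rewrite ger0_norm ?subr_ge0//; last by apply: le_pr => // w /= h; exact: le_trans yz.
  by rewrite ger0_norm ?subr_ge0//; exact: le_trans.
have Fyz := block_cdf_modulus j k0 zy; have mono := block_cdf_homo k j zy.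
rewrite distrC ger0_norm ?subr_ge0//; last by apply: le_pr => // w /= h; exact: le_trans zy.
by rewrite distrC ger0_norm ?subr_ge0//; exact: le_trans.
Qed.

Lemma block_cdf_onto k j v : (0 < k)%N -> 0 < v < 1 -> exists z, F k j z = v.
Proof.
move=> k0 /andP[v0 v1].
have [a Fa] : exists a, F k j a < v.
  have : G j x @[x --> -oo] --> (0:R).
    by rewrite G_cdf; apply: fine_cvg; exact: cvg_cdfNy0.
  have v0' : 0 < v / k%:R by rewrite divr_gt0// ltr0n.
  move=> /cvgr_lt/(_ _ v0') [N [_ /(_ (N - 1))]].
  rewrite ltrBlDr ltrDl ltr01 => /(_ isT) h; exists (N - 1).
  apply: le_lt_trans (pr_block_max_le (B := [set u | u <= N - 1]) k0 _ _) _ => //.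
  - exact: down_closed_measurable (@down_closed_le _ _).
  - exact: mle.
  - by rewrite mulrC -ltr_pdivlMr ?ltr0n.
have [b Fb] : exists b, v < F k j b.
  have : G j x @[x --> +oo] --> (1:R).
    by rewrite G_cdf; apply: fine_cvg; exact: cvg_cdfy1.
  have v1' : 1 - (1 - v) / k%:R < 1 by rewrite ltrBlDr ltrDl divr_gt0 ?ltr0n// subr_gt0.
  move=> /cvgr_gt/(_ _ v1') [N [_ /(_ (N + 1))]].
  rewrite ltrDl ltr01 => /(_ isT) h; exists (N + 1).
  have mB : measurable [set u : R | ~ u <= N + 1].
    by apply: measurableC; exact: down_closed_measurable (@down_closed_le _ _).
  have mM : measurable [set w | ~ block_max X k 1 j w <= N + 1] by exact: (measurableC (mle k j _)).
  have := pr_block_max_le (B := [set u | ~ u <= N + 1]) k0 mB mM.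
  have e1 : pr P [set w | ~ block_max X k 1 j w <= N + 1] = 1 - F k j (N + 1).
    exact: prC (mle k j (N + 1)).
  have e2 : pr P [set w | ~ X 1 j w <= N + 1] = 1 - G j (N + 1).
    exact: prC (mle1 j (N + 1)).
  rewrite /= e1 e2.
  have : k%:R * (1 - G j (N + 1)) < 1 - v.
    by rewrite mulrC -ltr_pdivlMr ?ltr0n// ltrBlDr -ltrBlDl; exact: h.
  by lra.
have ab : a <= b.
  rewrite leNgt; apply/negP => /ltW/(block_cdf_homo k j); lra.
have [z _ <-] : exists2 z, z \in `[a, b] & F k j z = v.
  apply: IVT => //.
    by apply: continuous_subspaceT => z; exact: block_cdf_continuous.
  have := block_cdf_homo k j ab; rewrite /Num.min /Num.max; case: ifP; lra.
by exists z.
Qed.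

Let mcdf (D : set R) k t j : down_closed D ->
  measurable [set w | D (F k j (block_max X k t j w))].
Proof.
move=> dD; apply: (measurable_block_max (D := [set z | D (F k j z)])).
by apply: down_closed_comp => //; exact: block_cdf_homo.
Qed.

(** The probability integral transform; by continuity the margin attains every
level in the open unit interval, so strict and weak inequalities agree. *)
Lemma pr_block_cdf k j v : (0 < k)%N -> 0 <= v <= 1 ->
  pr P [set w | F k j (block_max X k 1 j w) < v] = v /\
  pr P [set w | F k j (block_max X k 1 j w) <= v] = v.
Proof.
move=> k0 /andP[v0 v1].
have mlt v' : measurable [set w | F k j (block_max X k 1 j w) < v'].
  exact: (mcdf _ _ _ (@down_closed_lt _ v')).
have mlev v' : measurable [set w | F k j (block_max X k 1 j w) <= v'].
  exact: (mcdf _ _ _ (@down_closed_le _ v')).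
have lelt v' : pr P [set w | F k j (block_max X k 1 j w) < v'] <=
    pr P [set w | F k j (block_max X k 1 j w) <= v'].
  by apply: le_pr => // w /=; exact: ltW.
have lb : v <= pr P [set w | F k j (block_max X k 1 j w) < v].
  apply/ler_addgt0Pr => e e0; rewrite -lerBlDr.
  have [h|h] := leP (v - e) 0; first exact: le_trans h (pr_ge0 _ _).
  have [|z Fz] := @block_cdf_onto k j (v - e) k0; first by rewrite h; lra.
  rewrite -[leLHS]Fz; apply: le_pr => //.
  move=> w /= h'; apply: (le_lt_trans (block_cdf_homo k j h')); rewrite Fz; lra.
have ub : pr P [set w | F k j (block_max X k 1 j w) <= v] <= v.
  apply/ler_addgt0Pr => e e0.
  have [h|h] := leP 1 (v + e); first by apply: le_trans h; exact: pr_le1.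
  have [|z Fz] := @block_cdf_onto k j (v + e) k0; first by rewrite h; lra.
  rewrite -[leRHS]Fz; apply: le_pr => //.
  move=> w /= h'; rewrite leNgt; apply/negP => /ltW/(block_cdf_homo k j).
  by rewrite Fz; lra.
by split; apply/eqP; rewrite eq_le; have := lelt v; lra.
Qed.

Lemma pr_block_cdf_itv k j y z : (0 < k)%N -> y <= z ->
  pr P [set w | y <= F k j (block_max X k 1 j w) <= z] <= z - y.
Proof.
move=> k0 yz; set U := fun w => F k j (block_max X k 1 j w).
have U01 w : 0 <= U w <= 1 by exact: block_cdf01.
have mU y' z' : measurable [set w | y' <= U w <= z'].
  rewrite (_ : [set w | _] = [set w | U w <= z'] `\` [set w | U w < y']).
    by apply: measurableD; [exact: (mcdf _ _ _ (@down_closed_le _ _))|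
      exact: (mcdf _ _ _ (@down_closed_lt _ _))].
  apply/seteqP; split=> w /=.
    by move=> /andP[h ->]; split=> //; apply/negP; rewrite -leNgt.
  by move=> [-> /negP]; rewrite -leNgt => ->.
have [y1|y1] := leP y 1; last first.
  rewrite (_ : [set w | _] = set0) ?/pr ?measure0 ?subr_ge0//.
  apply/seteqP; split=> w //= /andP[h _]; have /andP[_ h'] := U01 w.
  by have := le_trans h h'; rewrite leNgt y1.
have [z0|z0] := leP 0 z; last first.
  rewrite (_ : [set w | _] = set0) ?/pr ?measure0 ?subr_ge0//.
  apply/seteqP; split=> w //= /andP[_ h]; have /andP[h' _] := U01 w.
  by have := le_trans h' h; rewrite leNgt z0.
pose y' := Num.max 0 y; pose z' := Num.min 1 z.
have yz' : 0 <= y' <= 1 /\ 0 <= z' <= 1 /\ z' - y' <= z - y /\ y' <= z'.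
  by rewrite /y' /z'; case: (leP 0 y) => hy; case: (leP 1 z) => hz; repeat split; lra.
have [hy [hz [h1 h2]]] := yz'; apply: le_trans h1.
have <- : pr P [set w | U w <= z'] - pr P [set w | U w < y'] = z' - y'.
  by rewrite (pr_block_cdf j k0 hz).2 (pr_block_cdf j k0 hy).1.
rewrite -prD.
- apply: le_pr => //.
    by apply: measurableD; [exact: (mcdf _ _ _ (@down_closed_le _ _))|
      exact: (mcdf _ _ _ (@down_closed_lt _ _))].
  move=> w /= /andP[h3 h4]; have := U01 w => h5; split.
    by rewrite /z' le_min h4; case/andP: h5 => _ ->.
  by apply/negP; rewrite -leNgt /y' ge_max h3; case/andP: h5 => ->.
- exact: (mcdf _ _ _ (@down_closed_lt _ _)).
- exact: (mcdf _ _ _ (@down_closed_le _ _)).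
- by move=> w /= h; apply: ltW; exact: lt_le_trans h2.
Qed.

(** Copulas are Lipschitz; comparing two families of down-closed conditions
on the margins covers weak, strict and discretized corners alike. *)
Lemma pr_margins_le k (D D' : 'I_d -> set R) (delta : R) : (0 < k)%N -> 0 <= delta ->
  (forall j, down_closed (D j)) -> (forall j, down_closed (D' j)) ->
  (forall j, exists y, forall v, D j v -> ~ D' j v -> y <= v <= y + delta) ->
  pr P [set w | forall j, D j (F k j (block_max X k 1 j w))] <=
  pr P [set w | forall j, D' j (F k j (block_max X k 1 j w))] + d%:R * delta.
Proof.
move=> k0 delta0 dD dD' gap.
have mall E : (forall j, down_closed (E j)) ->
    measurable [set w | forall j, E j (F k j (block_max X k 1 j w))].
  move=> dE; apply: (measurable_cylinder X (I := setT)
    (E := [set x | forall j, E j (F k j (traj_max k 1 j x))])).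
  apply: cylinder_forall => j.
  apply: (@cylinder_traj_max _ _ _ [set z | E j (F k j z)]) => //.
  by apply: down_closed_comp => //; exact: block_cdf_homo.
pose V j := [set w | D j (F k j (block_max X k 1 j w))] `\`
  [set w | D' j (F k j (block_max X k 1 j w))].
have mV j : measurable (V j) by apply: measurableD; exact: mcdf.
apply: (@le_trans _ _ (pr P ([set w | forall j, D' j (F k j (block_max X k 1 j w))] `|`
    \big[setU/set0]_j V j))).
  apply: le_pr => [||w /= h]; first exact: mall.
    by apply: measurableU; [exact: mall|exact: bigsetU_measurable].
  have [[j hj]|nh] := pselect (exists j, ~ D' j (F k j (block_max X k 1 j w))).
    by right; rewrite -bigcup_seq; exists j; [exact: mem_index_enum|split].
  by left=> j; apply: contrapT => h'; apply: nh; exists j.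
have mbig : measurable (\big[setU/set0]_j V j) by exact: bigsetU_measurable.
apply: le_trans (prU_le _ (mall D' dD') mbig) _.
rewrite lerD2l; apply: le_trans (pr_bigsetU_le _ _ mV) _.
rewrite mulr_natl -[X in _ *+ X](card_ord d) -sumr_const; apply: ler_sum => j _.
have [y hy] := gap j.
have yd : y <= y + delta by rewrite lerDl.
have := pr_block_cdf_itv j k0 yd; rewrite addrAC subrr add0r; apply: le_trans.
apply: le_pr => // [|w [/= h1 h2]]; last exact: hy.
rewrite (_ : [set w | _] = [set w | F k j (block_max X k 1 j w) <= y + delta] `\`
   [set w | F k j (block_max X k 1 j w) < y]).
  by apply: measurableD; [exact: (mcdf _ _ _ (@down_closed_le _ _))|
    exact: (mcdf _ _ _ (@down_closed_lt _ _))].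
apply/seteqP; split=> w /=.
  by move=> /andP[h ->]; split=> //; apply/negP; rewrite -leNgt.
by move=> [-> /negP]; rewrite -leNgt => ->.
Qed.

End uniform_margins.

(** * Discretized blocks and their deviations *)

Section block_data.
Context {disp : measure_display} {T : measurableType disp} {R : realType}.
Context {P : probability T R} {d : nat} (X : int -> 'I_d -> {RV P >-> R}).
Hypotheses (X_stationary : strictly_stationary X)
  (X_continuous : forall j, continuous (cdf (X 1 j))).
Variables (L l : nat).
Hypotheses (d_gt0 : (0 < d)%N) (l_gt0 : (0 < l)%N).

Notation F := (block_cdf X).
Notation D := ((2 ^ L).+1).
Notation cell_type := {ffun 'I_d -> 'I_D}.
Notation corner := {ffun 'I_d -> 'I_D.+1}.
Notation block_type := {ffun 'I_l -> {ffun 'I_l -> cell_type}}.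

Definition uniformized k t j (x : trajectory R d) : R := F k j (traj_max k t j x).

Lemma uniformized01 k t j x : 0 <= uniformized k t j x <= 1.
Proof. exact: block_cdf01. Qed.

Definition cell k t (x : trajectory R d) : cell_type :=
  [ffun j => inord (Num.truncn (2 ^+ L * uniformized k t j x))].

Let pow2 : 0 < 2 ^+ L :> R. Proof. by rewrite exprn_gt0. Qed.

Lemma cell_lt k t x j n : (cell k t x j < n)%N = (uniformized k t j x < n%:R / 2 ^+ L).
Proof.
have /andP[u0 u1] := uniformized01 k t j x.
rewrite ffunE inordK; last first.
  rewrite ltnS truncn_le_nat; apply: le_lt_trans (_ : 2 ^+ L < _).
    by rewrite ler_piMr// ltW.
  by rewrite -natrX ltr_nat.
by rewrite truncn_lt_nat ?mulr_ge0 ?(ltW pow2)// ltr_pdivlMr// mulrC.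
Qed.

Lemma cell_shift k t h x : cell k t (shift h x) = cell k (t + h) x.
Proof. by apply/ffunP => j; rewrite !ffunE /uniformized traj_max_shift. Qed.

Lemma cylinder_uniformized (I : set int) (E : set R) k t j : down_closed E ->
  I t -> (forall i, (i < k)%N -> I (t + i%:Z)) ->
  cylinder I [set x | E (uniformized k t j x)].
Proof.
move=> dE It Iti; apply: (@cylinder_traj_max _ _ I [set z | E (F k j z)]) => //.
by apply: down_closed_comp => //; exact: block_cdf_homo.
Qed.

Lemma measurable_uniformized (E : set R) k t j : down_closed E ->
  measurable [set w | E (F k j (block_max X k t j w))].
Proof.
by move=> dE; apply: (measurable_cylinder X (cylinder_uniformized (I := setT) j dE _ _)).
Qed.

Lemma cylinder_cell (I : set int) k t c :
  I t -> (forall i, (i < k)%N -> I (t + i%:Z)) ->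
  cylinder I [set x | cell k t x = c].
Proof.
move=> It Iti.
pose E n j := [set x : trajectory R d | uniformized k t j x < n%:R / 2 ^+ L].
have cE n j : cylinder I (E n j).
  exact: (cylinder_uniformized j (@down_closed_lt _ _) It Iti).
rewrite (_ : [set x | _] = [set x | forall j, (E (c j).+1 j `&` ~` E (c j) j) x]).
  by apply: cylinder_forall => j; apply: cylinderI => //; exact: cylinderC.
apply/seteqP; split=> x /=.
  by move=> <- j; split; rewrite /E /= -cell_lt ?ltnn.
move=> h; apply/ffunP => j; apply/val_inj/eqP => /=; have [h1 h2] := h j.
rewrite eqn_leq -ltnS cell_lt h1 /= leqNgt; apply/negP.
by rewrite cell_lt => h3; exact: h2.
Qed.

Definition block_obs t (x : trajectory R d) : block_type :=
  [ffun k : 'I_l => [ffun i : 'I_l => cell k (t + i%:Z) x]].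

Lemma block_obs_shift t h x : block_obs t (shift h x) = block_obs (t + h) x.
Proof.
by apply/ffunP => k; apply/ffunP => i; rewrite !ffunE cell_shift addrAC.
Qed.

Lemma cylinder_block_obs (I : set int) t y :
  (forall s, t <= s < t + (l + l)%:Z -> I s) ->
  cylinder I [set x | block_obs t x = y].
Proof.
move=> It.
rewrite (_ : [set x | _] = [set x | forall k : 'I_l, forall i : 'I_l,
    cell k (t + (i : nat)%:Z) x = y k i]).
  apply: cylinder_forall => k; apply: cylinder_forall => i; apply: cylinder_cell.
    by apply: It; have := ltn_ord i; lia.
  by move=> i' i'k; apply: It; have := ltn_ord i; have := ltn_ord k; lia.
apply/seteqP; split=> x /=; first by move=> <- k i; rewrite !ffunE.
by move=> h; apply/ffunP => k; apply/ffunP => i; rewrite !ffunE h.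
Qed.

(** Only every third block is observed: consecutive observed blocks, each of
which looks [2 l] time steps ahead, are then separated by more than [l]. *)
Definition block_start (r b : nat) : int := 1 + ((3 * b + r) * l)%:Z.

Fixpoint observed (r b : nat) (x : trajectory R d) : seq block_type :=
  if b is b'.+1 then block_obs (block_start r b') x :: observed r b' x else [::].

Lemma size_observed r b x : size (observed r b x) = b.
Proof. by elim: b => //= b ->. Qed.

Lemma path_sum_observed (h : nat -> block_type -> R) r b x :
  path_sum h (observed r b x) = \sum_(b' < b) h b' (block_obs (block_start r b') x).
Proof.
elim: b => [|b IH]; first by rewrite big_ord0.
by rewrite big_ord_recr /= size_observed IH addrC.
Qed.

(** The bound on [t] is where the next observed block starts, minus [l + 1]; it keeps
the already observed blocks in the past of the next one by more than [l]. *)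
Lemma cylinder_observed r b (a : seq block_type) :
  cylinder [set t | 1 <= t < 1 + ((3 * b + r + 2) * l)%:Z /\ t <= ((3 * b + r) * l)%:Z - l%:Z]
    [set x | observed r b x = a].
Proof.
elim: b a => [|b IH] a /=.
  case: a => [|y a].
    by rewrite (_ : [set x : trajectory R d | _] = setT); [exact: cylinderT|apply/seteqP; split].
  rewrite (_ : [set x : trajectory R d | _] = ~` setT); first by apply: cylinderC; exact: cylinderT.
  by rewrite setCT; apply/seteqP; split.
case: a => [|y a].
  rewrite (_ : [set x : trajectory R d | _] = ~` setT); first by apply: cylinderC; exact: cylinderT.
  by rewrite setCT; apply/seteqP; split.
rewrite (_ : [set x : trajectory R d | _] = [set x | block_obs (block_start r b) x = y] `&`
   [set x | observed r b x = a]).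
  apply: cylinderI.
    by apply: cylinder_block_obs => s; rewrite /block_start /=; nia.
  by apply: cylinder_sub (IH a) => t /=; nia.
by apply/seteqP; split=> x /=; [case=> -> ->|case=> -> ->].
Qed.

Definition joint_law r (a : seq block_type) : R :=
  pr P [set w | observed r (size a) (sample X w) = a].

Definition block_law (y : block_type) : R :=
  pr P [set w | block_obs 1 (sample X w) = y].

Definition cell_law_of k (c : cell_type) : R :=
  pr P [set w | cell k 1 (sample X w) = c].

Lemma measurable_observed r b a :
  measurable [set w | observed r b (sample X w) = a].
Proof. exact: (measurable_cylinder X (cylinder_observed r b a)). Qed.

Lemma measurable_block_obs t y :
  measurable [set w | block_obs t (sample X w) = y].
Proof. by apply: (measurable_cylinder X (cylinder_block_obs (I := setT) y _)). Qed.

Lemma measurable_cell k t c : measurable [set w | cell k t (sample X w) = c].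
Proof. by apply: (measurable_cylinder X (cylinder_cell (I := setT) c _ _)). Qed.

Lemma block_law_start t y :
  pr P [set w | block_obs t (sample X w) = y] = block_law y.
Proof.
rewrite /block_law -(pr_shift X_stationary (lo := 1) (n := l + l) (t - 1)
  (E := [set x | block_obs 1 x = y])).
  congr pr; apply/seteqP; split=> w /=; rewrite block_obs_shift subrKC //.
by apply: cylinder_block_obs => s /=; lia.
Qed.

Lemma cell_law_start k t c : (0 < k)%N ->
  pr P [set w | cell k t (sample X w) = c] = cell_law_of k c.
Proof.
move=> k0; rewrite /cell_law_of -(pr_shift X_stationary (lo := 1) (n := k) (t - 1)
  (E := [set x | cell k 1 x = c])).
  congr pr; apply/seteqP; split=> w /=; rewrite cell_shift subrKC //.
by apply: cylinder_cell => /= [|i ik]; lia.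
Qed.

Lemma block_law_ge0 y : 0 <= block_law y. Proof. exact: pr_ge0. Qed.

Lemma block_law_sum1 : \sum_y block_law y = 1.
Proof.
rewrite -(prT P) (pr_total _ (f := fun w => block_obs 1 (sample X w)))//.
  by apply: eq_bigr => y _; rewrite setTI.
exact: measurable_block_obs.
Qed.

Lemma block_law_cell (k i : 'I_l) c : (0 < k)%N ->
  \sum_(y : block_type) block_law y * (y k i == c)%:R = cell_law_of k c.
Proof.
move=> k0; rewrite -(cell_law_start (1 + (i : nat)%:Z) c k0).
have := @pr_sum_fin _ _ _ P _ (fun w => block_obs 1 (sample X w)) setT (fun y => y k i == c)
  (measurable_block_obs 1) measurableT.
rewrite setTI (_ : [set w | _] = [set w | cell k (1 + (i : nat)%:Z) (sample X w) = c]).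
  move=> ->; rewrite [RHS]big_mkcond; apply: eq_bigr => y _; rewrite setTI.
  by case: ifP => _; rewrite ?mulr1 ?mulr0.
by apply/seteqP; split=> w /=; rewrite !ffunE => /eqP.
Qed.

Lemma cell_law_event k (Q : pred cell_type) :
  \sum_(c | Q c) cell_law_of k c = pr P [set w | Q (cell k 1 (sample X w))].
Proof.
have := @pr_sum_fin _ _ _ P _ (fun w => cell k 1 (sample X w)) setT Q
  (measurable_cell k 1) measurableT.
by rewrite setTI => ->; apply: eq_bigr => y _; rewrite setTI.
Qed.

(** Cells with a common quotient by [2 ^ s] come from an interval of length
[2 ^ s / 2 ^ L], and uniformized maxima are uniform; the last interval may reach
beyond [1]. *)
Lemma cell_margin k (j : 'I_d) (s v : nat) : (0 < k)%N -> (s < L.+2)%N ->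
  \sum_(c : cell_type | (c j %/ 2 ^ s == v)%N) cell_law_of k c <= 2 ^+ s / 2 ^+ L.
Proof.
move=> k0 _; rewrite (cell_law_event k (fun c => (c j %/ 2 ^ s == v)%N)).
pose y : R := (v * 2 ^ s)%:R / 2 ^+ L; pose z : R := ((v + 1) * 2 ^ s)%:R / 2 ^+ L.
have zy : z - y = 2 ^+ s / 2 ^+ L.
  by rewrite /z /y -mulrBl mulnDl mul1n natrD addrAC subrr add0r natrX.
have yz : y <= z.
  by rewrite -subr_ge0 zy divr_ge0// exprn_ge0.
rewrite -zy; apply: le_trans (pr_block_cdf_itv X_stationary X_continuous j k0 yz).
apply: le_pr.
- apply: (measurable_fin_preimage (f := fun w => cell k 1 (sample X w))
    [set c : cell_type | (c j %/ 2 ^ s == v)%N]) => c; exact: measurable_cell.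
- rewrite (_ : [set w | _] = [set w | F k j (block_max X k 1 j w) <= z] `\`
     [set w | F k j (block_max X k 1 j w) < y]).
    by apply: measurableD; [exact: (measurable_uniformized _ _ _ (@down_closed_le _ _))|
      exact: (measurable_uniformized _ _ _ (@down_closed_lt _ _))].
  apply/seteqP; split=> w /=.
    by move=> /andP[h ->]; split=> //; apply/negP; rewrite -leNgt.
  by move=> [-> /negP]; rewrite -leNgt => ->.
- move=> w /= /eqP cv.
  have s0 : (0 < 2 ^ s)%N by rewrite expn_gt0.
  have h1 : ~~ (cell k 1 (sample X w) j < v * 2 ^ s)%N.
    by rewrite -leqNgt -cv leq_divM.
  have h2 : (cell k 1 (sample X w) j < (v + 1) * 2 ^ s)%N.
    by rewrite -cv addn1; exact: ltn_ceil.
  move: h1 h2; rewrite !cell_lt -leNgt => h1 h2.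
  by apply/andP; split; [exact: h1|exact: ltW].
Qed.

Lemma joint_law_nil r : joint_law r [::] = 1.
Proof.
by rewrite /joint_law -(prT P); congr pr; apply/seteqP; split.
Qed.

Lemma joint_law_sum r a : \sum_y joint_law r (y :: a) = joint_law r a.
Proof.
rewrite [RHS](pr_total _ (f := fun w => block_obs (block_start r (size a)) (sample X w))).
- apply: eq_bigr => y _; congr pr.
  by apply/seteqP; split=> w /=; [case=> -> ->|case=> -> ->].
- exact: measurable_block_obs.
- exact: measurable_observed.
Qed.

(** The total variation distance required for decoupling is twice a mixing
coefficient at a distance of at least [m]. *)
Lemma joint_law_beta r b (m : nat) : (m <= l)%N ->
  \sum_(a : b.-tuple block_type) \sum_c
    `|joint_law r (c :: a) - block_law c * joint_law r a| <= 2 * beta_mix X m.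
Proof.
move=> ml.
have sz x : size (observed r b x) == b by rewrite size_observed.
pose y1 x : b.-tuple block_type := Tuple (sz x).
have e1 (a : b.-tuple block_type) :
    [set x | y1 x = a] = [set x | observed r b x = a].
  apply/seteqP; split=> x /=; first by move=> /(congr1 val).
  by move=> h; apply: val_inj.
apply: le_trans (beta_mix_cylinder X_stationary (y1 := y1)
  (y2 := block_obs (block_start r b)) (lo := 1) (t0 := ((3 * b + r) * l)%:Z - l%:Z)
  (n := ((3 * b + r + 2) * l)%N) (h := m) _ _) => [|a|c].
- apply: ler_sum => a _; apply: ler_sum => c _.
  rewrite le_eqVlt; apply/orP; left; apply/eqP; congr `|_ - _|.
    rewrite /joint_law /= size_tuple; congr pr; apply/seteqP; split=> w /=.
      by move=> [-> e]; split=> //; apply: val_inj.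
    by move=> [e ->]; congr cons; exact: (congr1 val e).
  rewrite block_law_start mulrC /joint_law size_tuple; congr (pr _ _ * _).
  by apply/seteqP; split=> w /=; [move=> h; apply: val_inj|move=> <-].
- by rewrite e1; exact: cylinder_observed.
- by apply: cylinder_block_obs => s; rewrite /block_start /=; nia.
Qed.

Section deviation_bound.
Variables (w : 'I_l -> R) (Q : pred 'I_l) (act : nat -> 'I_l -> nat -> 'I_l -> bool).
Hypotheses (Q_gt0 : forall k, Q k -> (0 < k)%N)
  (w_ge0 : forall k, Q k -> 0 <= w k) (w_sum1 : \sum_(k | Q k) w k = 1).

Definition norm_dev r (a : seq block_type) : R :=
  weighted_norm w Q (max_dev (fun k i (y : block_type) => y k i) (act r)
    (fun k => cell_law_of k) a).

Lemma measurable_norm_dev r B (t : R) :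
  measurable [set v | t < norm_dev r (observed r B (sample X v))].
Proof.
have sz x : size (observed r B x) == B by rewrite size_observed.
apply: (measurable_fin_preimage (f := fun v => Tuple (sz (sample X v)))
  [set a : B.-tuple block_type | t < norm_dev r a]) => a.
rewrite (_ : _ @^-1` _ = [set v | observed r B (sample X v) = a]).
  exact: measurable_observed.
by apply/seteqP; split=> v /=; [move=> /(congr1 val)|move=> h; apply: val_inj].
Qed.

(** Markov's inequality, the mean being bounded by decoupling and chaining. *)
Lemma norm_dev_tail r B (m : nat) (s t : R) : (m <= l)%N -> 0 < s -> 0 < t ->
  B%:R <= s ^+ 2 -> 2 ^+ L <= s ^+ 2 ->
  pr P [set v | t * s < norm_dev r (observed r B (sample X v))] <=
  (1 + 2 * ((8 * d)%:R ^+ d) ^+ 4 + B%:R * (2 * beta_mix X m / s)) / t.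
Proof.
move=> ml s0 t0 Bs Ls.
have sz x : size (observed r B x) == B by rewrite size_observed.
have e1 (a : B.-tuple block_type) :
    [set v | Tuple (sz (sample X v)) = a] = [set v | observed r B (sample X v) = a].
  by apply/seteqP; split=> v /=; [move=> /(congr1 val)|move=> h; apply: val_inj].
have -> : pr P [set v | t * s < norm_dev r (observed r B (sample X v))] =
    \sum_(a : B.-tuple block_type | t * s < norm_dev r a) joint_law r a.
  have := @pr_sum_fin _ _ _ P _ (fun v => Tuple (sz (sample X v))) setT
    (fun a => t * s < norm_dev r a) _ measurableT.
  rewrite setTI => ->; last by move=> a; rewrite [_ @^-1` _]e1; exact: measurable_observed.
  apply: eq_bigr => a _; rewrite setTI [_ @^-1` _]e1.
  by rewrite /joint_law size_tuple.
rewrite ler_pdivlMr// mulr_suml.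
apply: le_trans (weighted_deviation d_gt0 l_gt0 (act r) block_law_ge0 block_law_sum1 w_ge0 w_sum1
  _ _ (joint_law_nil r) (joint_law_sum r)
  (fun b _ => @joint_law_beta r b m ml) s0 Bs Ls).
- rewrite /expect big_mkcond; apply: ler_sum => a _.
  have J0 : 0 <= joint_law r a by exact: pr_ge0.
  have N0 : 0 <= norm_dev r a by exact: sqrtr_ge0.
  case: ifP => [h|_].
    by rewrite ler_wpM2l// ler_pdivlMl// [s * t]mulrC; exact: (ltW h).
  by rewrite mulr_ge0// mulr_ge0// invr_ge0 ltW.
- by move=> k Qk i c; exact: block_law_cell (Q_gt0 Qk).
- by move=> k Qk j s' v; exact: cell_margin (Q_gt0 Qk).
Qed.

End deviation_bound.

Definition grid_freq (k N : nat) (x : corner) (w : trajectory R d) : R :=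
  \sum_(g < N) (below x (cell k (1 + g%:Z) w))%:R.

Definition grid_prob (k : nat) (x : corner) : R :=
  pr P [set w | forall j, F k j (block_max X k 1 j w) < (x j)%:R / 2 ^+ L].

Lemma grid_probE k x :
  mean_of (cell_law_of k) (fun c => (below x c)%:R) = grid_prob k x.
Proof.
rewrite /mean_of /grid_prob; have := cell_law_event k (below x).
rewrite (_ : [set w | below x _] =
    [set w | forall j, F k j (block_max X k 1 j w) < (x j)%:R / 2 ^+ L]).
  move=> <-; rewrite [RHS]big_mkcond; apply: eq_bigr => c _.
  by case: (below x c); rewrite ?mulr1 ?mulr0.
apply/seteqP; split=> w /=.
  by move=> /forallP h j; have := h j; rewrite cell_lt.
by move=> h; apply/forallP => j; rewrite cell_lt; exact: h.
Qed.

Definition active (n : nat) (r : nat) (k : 'I_l) (b : nat) (i : 'I_l) : bool :=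
  ((3 * b + r) * l + i < n.+1 - k)%N.

Lemma sum_blocks (N B : nat) (f : nat -> R) : (N <= 3 * B * l)%N ->
  \sum_(g < N) f g = \sum_(r < 3) \sum_(b < B) \sum_(i < l)
    ((3 * b + r) * l + i < N)%N%:R * f ((3 * b + r) * l + i)%N.
Proof.
move=> NB.
have -> : \sum_(g < N) f g = \sum_(g < 3 * B * l) (g < N)%N%:R * f g.
  rewrite (big_ord_widen _ f NB) big_mkcond; apply: eq_bigr => g _.
  by case: ifP; rewrite ?mul1r ?mul0r.
pose h g := (g < N)%N%:R * f g.
rewrite -(big_mkord xpredT h) big_nat_mul /=.
have -> : \sum_(0 <= i < 3 * B) \sum_(i * l <= j < i.+1 * l) h j =
   \sum_(c < 3 * B) \sum_(i < l) h (c * l + i)%N.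
  rewrite big_mkord; apply: eq_bigr => c _.
  rewrite -{1}[(c * l)%N]add0n big_addn mulSn addnK big_mkord.
  by apply: eq_bigr => i _; rewrite addnC.
pose H c := \sum_(i < l) h (c * l + i)%N.
rewrite mulnC -(big_mkord xpredT H) big_nat_mul big_mkord /= [RHS]exchange_big /=.
apply: eq_bigr => b _.
rewrite -{1}[(b * 3)%N]add0n big_addn mulSn addnK big_mkord.
by apply: eq_bigr => r _; rewrite [(r + _)%N]addnC [(b * 3)%N]mulnC.
Qed.

(** Every block belongs to one of three interleaved families, so the centred
count splits into three sums over separated blocks. *)
Lemma grid_freq_dev n B (k : 'I_l) (x : corner) (v : trajectory R d) : (0 < k)%N ->
  (n.+1 - k <= 3 * B * l)%N ->
  `|grid_freq k (n.+1 - k) x v - (n.+1 - k)%:R * grid_prob k x| <=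
  l%:R * \sum_(r < 3) max_dev (fun k i (y : block_type) => y k i) (active n r)
    (fun k => cell_law_of k) (observed r B v) k.
Proof.
move=> k0 nB.
pose h (g : nat) : R := (below x (cell k (1 + g%:Z) v))%:R - grid_prob k x.
have -> : grid_freq k (n.+1 - k) x v - (n.+1 - k)%:R * grid_prob k x =
    \sum_(g < n.+1 - k) h g.
  by rewrite /h sumrB sumr_const card_ord mulr_natl.
rewrite (sum_blocks _ nB) mulr_sumr; apply: le_trans (ler_norm_sum _ _ _) _.
apply: ler_sum => r _.
have -> : \sum_(b < B) \sum_(i < l) ((3 * b + r) * l + i < n.+1 - k)%N%:R *
    h ((3 * b + r) * l + i)%N = l%:R * corner_mass (cell_dev (fun i (y : block_type) => y k i)
      (active n r k) (cell_law_of k) (observed r B v)) x.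
  rewrite /corner_mass cell_dev_sum path_sum_observed mulr_sumr.
  apply: eq_bigr => b _; rewrite /block_dev mulrA mulfV ?mul1r ?pnatr_eq0 -?lt0n//.
  apply: eq_bigr => i _; rewrite /active /h grid_probE; congr (_ * (_ - _)).
  by rewrite !ffunE /block_start PoszD addrA.
rewrite normrM normr_nat ler_wpM2l// /max_dev.
exact: (le_bigmax _ (fun x => `|corner_mass _ x|)).
Qed.

End block_data.

(** * From the discretized deviation to the empirical copula *)

Section empirical_copula.
Context {disp : measure_display} {T : measurableType disp} {R : realType}.
Context {P : probability T R} {d : nat} (X : int -> 'I_d -> {RV P >-> R}).
Hypotheses (X_stationary : strictly_stationary X)
  (X_continuous : forall j, continuous (cdf (X 1 j))).
Variables (L : nat).
Notation D := ((2 ^ L).+1).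
Notation corner := {ffun 'I_d -> 'I_D.+1}.

Variables (n k : nat) (v : T) (Delta : R).
Let N := nblocks n k.
Hypotheses (k_gt0 : (0 < k)%N) (N_gt0 : (0 < N)%N) (Delta_ge0 : 0 <= Delta)
  (freq_close : forall x : corner,
     `|grid_freq X k N x (sample X v) - N%:R * grid_prob X k x| <= N%:R * Delta).

Let delta : R := 2 ^- L.
Let U (g : nat) j : R := uniformized X k (1 + g%:Z) j (sample X v).
Let c (g : nat) := cell X L k (1 + g%:Z) (sample X v).
Let NR : 0 < N%:R :> R. Proof. by rewrite ltr0n. Qed.
Let pow2 : 0 < 2 ^+ L :> R. Proof. by rewrite exprn_gt0. Qed.
Let delta0 : 0 < delta. Proof. by rewrite invr_gt0. Qed.
Let U01 g j : 0 <= U g j <= 1. Proof. exact: uniformized01. Qed.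
Let c_lt g j a : (c g j < a)%N = (U g j < a%:R * delta). Proof. exact: cell_lt. Qed.

Let sum1 (f : nat -> R) : \sum_(1 <= i < N.+1) f i = \sum_(g < N) f g.+1.
Proof. by rewrite big_add1 big_mkord. Qed.

(** This is the hypothesis at the corner that is unconstrained in all coordinates but
[j], whose probability is that of an interval under the uniform law. *)
Lemma marginal_freq j (y : nat) : (y <= D)%N ->
  `|\sum_(g < N) ((c g j < y)%N%:R : R) - N%:R * Num.min 1 (y%:R * delta)| <= N%:R * Delta.
Proof.
move=> yD.
pose x : corner := [ffun i => if i == j then inord y else ord_max].
have xj : x j = y :> nat by rewrite ffunE eqxx inordK.
have := freq_close x.
have xE i : x i = (if i == j then y else D) :> nat.
  by rewrite ffunE; case: (i == j); rewrite ?inordK.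
have D1 : 1 < D%:R * delta by rewrite ltr_pdivlMr// mul1r -natrX ltr_nat.
have -> : grid_freq X k N x (sample X v) = \sum_(g < N) (c g j < y)%N%:R.
  apply: eq_bigr => g _; congr (_ : bool)%:R.
  apply/forallP/idP => [/(_ j)|cj i]; first by rewrite xE eqxx.
  by rewrite xE; case: (i =P j) => [->//|_]; exact: ltn_ord.
have -> // : grid_prob X k x = Num.min 1 (y%:R * delta).
have -> : grid_prob X k x = pr P [set w | block_cdf X k j (block_max X k 1 j w) < y%:R * delta].
  congr pr; apply/seteqP; split=> w /=; first by move=> /(_ j); rewrite xE eqxx.
  move=> h i; rewrite xE; case: (i =P j) => [->//|_].
  by apply: le_lt_trans D1; case/andP: (block_cdf01 X k i (block_max X k 1 i w)).
case: (leP 1 (y%:R * delta)) => [h|/ltW h]; last first.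
  by apply: (pr_block_cdf X_stationary X_continuous j k_gt0 _).1; rewrite h mulr_ge0// ltW.
apply/eqP; rewrite eq_le pr_le1 /=; last first.
  exact: (measurable_uniformized X k 1 j (@down_closed_lt _ _)).
have one01 : 0 <= (1 : R) <= 1 by rewrite ler01 lexx.
rewrite -{1}(pr_block_cdf X_stationary X_continuous j k_gt0 one01).1; apply: le_pr;
  try exact: (measurable_uniformized X k 1 j (@down_closed_lt _ _)).
by move=> w /= h'; exact: lt_le_trans h.
Qed.

(** Ranks are insensitive to the increasing transformation by the margin, so a
rescaled rank deviates from the uniformized maximum by no more than the
empirical margin does from the uniform law. *)
Lemma pseudo_obs_close g j : (g < N)%N ->
  U g j - (delta + Delta) <= pseudo_obs X n k g.+1 j v <= U g j + (delta + Delta).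
Proof.
move=> gN; rewrite /pseudo_obs /emp_cdf -/N sum1.
have mono g1 g2 : block_max X k g1.+1%:Z j v <= block_max X k g2.+1%:Z j v -> U g1 j <= U g2 j.
  by move=> h; exact: block_cdf_homo.
have /andP[u0 u1] := U01 g j.
have cle : (c g j)%:R * delta <= U g j by rewrite leNgt -c_lt ltnn.
have clt : U g j < (c g j).+1%:R * delta by rewrite -c_lt.
have clt' : U g j + delta >= (c g j).+1%:R * delta by rewrite mulrSr mulrDl mul1r; lra.
have cD : (c g j <= D)%N by exact: ltnW.
have cD1 : ((c g j).+1 <= D)%N by [].
have lo := marginal_freq j cD; have hi := marginal_freq j cD1.
have minlo : (c g j)%:R * delta <= Num.min 1 ((c g j)%:R * delta).
  by rewrite le_min lexx (le_trans cle).
have minhi : Num.min 1 ((c g j).+1%:R * delta) <= U g j + delta.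
  by rewrite ge_min clt' orbT.
rewrite ler_pdivlMl// ler_pdivrMl//.
set A := \sum_(g' < N) _.
have A1 : \sum_(g' < N) ((c g' j < c g j)%N%:R : R) <= A.
  apply: ler_sum => g' _; rewrite ler_nat.
  case: (boolP (c g' j < c g j)%N) => // h.
  rewrite (_ : (_ <= _) = true)//; rewrite leNgt; apply/negP => /ltW/mono.
  rewrite leNgt => /negP; apply.
  by apply: lt_le_trans cle; rewrite -c_lt.
have A2 : A <= \sum_(g' < N) ((c g' j < (c g j).+1)%N%:R : R).
  apply: ler_sum => g' _; rewrite ler_nat.
  case: (boolP (_ <= _)) => //= /mono h.
  by rewrite c_lt (le_lt_trans h).
move: lo hi; rewrite !ler_norml => /andP[lo _] /andP[_ hi].
have := ler_wpM2l (ltW NR) minlo; have := ler_wpM2l (ltW NR) minhi.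
have c1 := ler_wpM2l (ltW NR) clt'; rewrite mulrSr in c1.
have : N%:R * U g j <= N%:R * ((c g j)%:R * delta + delta).
  by rewrite ler_wpM2l ?(ltW NR)// (le_trans (ltW clt))// mulrSr mulrDl mul1r.
by move=> *; apply/andP; split; lra.
Qed.

(** Rounding outwards and inwards by the rank error and one mesh width sandwiches
the rank condition at [u] between two grid corners, whose probabilities differ
from the copula at [u] by the Lipschitz property. *)
Lemma emp_copula_close (u : 'rV[R]_d) : cube u ->
  `|emp_copula X n k u v - block_copula X k u| <= Delta + d%:R * (2 * delta + Delta).
Proof.
move=> cu; set e := 2 * delta + Delta.
have e0 : 0 <= e by rewrite addr_ge0// mulr_ge0// ltW.
rewrite /emp_copula -/N sum1.
set A := \sum_(g < N) _.
have gp x := freq_close x.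
(* The outer and the inner grid corner; beyond the last grid point the outer one
   is unconstrained. *)
pose xup : corner := [ffun j => inord (minn D (Num.truncn (2 ^+ L * (u 0 j + delta + Delta))).+1)].
pose xlo : corner := [ffun j => inord (Num.truncn (2 ^+ L * (u 0 j - delta - Delta)))].
have xupE j : xup j = minn D (Num.truncn (2 ^+ L * (u 0 j + delta + Delta))).+1 :> nat.
  by rewrite ffunE inordK// ltnS geq_minl.
have xloE j : xlo j = Num.truncn (2 ^+ L * (u 0 j - delta - Delta)) :> nat.
  rewrite ffunE inordK// ltnS (leq_trans _ (leqnSn _))// truncn_le_nat.
  apply: le_lt_trans (_ : 2 ^+ L < _); last by rewrite -natrX ltr_nat.
  rewrite ler_piMr ?(ltW pow2)//; have /andP[_] := cu j.
  by move: Delta_ge0 delta0; lra.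
have up1 : A <= grid_freq X k N xup (sample X v).
  apply: ler_sum => g _; rewrite ler_nat.
  case: (boolP [forall j, _]) => // /forallP h.
  rewrite (_ : below _ _ = true)//; apply/forallP => j.
  rewrite xupE leq_min ltn_ord /= ltnS.
  have /andP[h1 _] := pseudo_obs_close j (ltn_ord g).
  rewrite -[(_ <= _)%N]/(c g j < (Num.truncn _).+1)%N c_lt ltr_pdivlMr//.
  apply: le_lt_trans (truncnS_gt _); rewrite mulrC ler_wpM2l ?(ltW pow2)//.
  have := h j; move: h1; lra.
have lo1 : grid_freq X k N xlo (sample X v) <= A.
  apply: ler_sum => g _; rewrite ler_nat.
  case: (boolP (below _ _)) => // /forallP h.
  rewrite (_ : [forall j, _] = true)//; apply/forallP => j.
  have := h j; rewrite -/(c g) c_lt xloE => h1.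
  have /andP[_ h2] := pseudo_obs_close j (ltn_ord g).
  apply: le_trans h2 _.
  set y := 2 ^+ L * (u 0 j - delta - Delta) in h1.
  have [y0|y0] := leP 0 y; last first.
    have : Num.truncn y = 0%N by apply/truncn0Pn; rewrite -ltNge (lt_trans y0).
    by move=> t0; move: h1; rewrite t0 mul0r => h1; have /andP[] := U01 g j; lra.
  have /andP[ty _] := truncn_itv y0.
  have : U g j < y * delta by apply: lt_le_trans h1 _; rewrite ler_wpM2r// ltW.
  by rewrite /y mulrAC mulfV ?gt_eqF// mul1r; lra.
have up2 : grid_prob X k xup <= block_copula X k u + d%:R * e.
  apply: (pr_margins_le X_stationary X_continuous
    (D := fun j => [set z | z < (xup j)%:R * delta]) (D' := fun j => [set z | z <= u 0 j])) => //.
  - by move=> j; exact: down_closed_lt.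
  - by move=> j; exact: down_closed_le.
  - move=> j; exists (u 0 j) => z /= z1 /negP; rewrite -ltNge => z2.
    rewrite (ltW z2)/=; apply: (ltW (lt_le_trans z1 _)).
    rewrite ler_pdivrMr// xupE.
    have /andP[uj0 _] := cu j.
    have y0 : 0 <= 2 ^+ L * (u 0 j + delta + Delta).
      by rewrite mulr_ge0 ?(ltW pow2)//; move: delta0 Delta_ge0; lra.
    have /andP[ty _] := truncn_itv y0.
    apply: (@le_trans _ _ ((Num.truncn (2 ^+ L * (u 0 j + delta + Delta))).+1)%:R).
      by rewrite ler_nat geq_minr.
    have dE : 2 ^+ L * delta = 1 by rewrite mulfV ?gt_eqF.
    by rewrite mulrSr /e; lra.
have lo2 : block_copula X k u <= grid_prob X k xlo + d%:R * e.
  apply: (pr_margins_le X_stationary X_continuous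
    (D' := fun j => [set z | z < (xlo j)%:R * delta]) (D := fun j => [set z | z <= u 0 j])) => //.
  - by move=> j; exact: down_closed_le.
  - by move=> j; exact: down_closed_lt.
  - move=> j; exists (u 0 j - e) => z /= z1 /negP; rewrite -leNgt => z2.
    rewrite subrK z1 andbT; apply: le_trans z2.
    rewrite ler_pdivlMr// xloE.
    have := truncnS_gt (2 ^+ L * (u 0 j - delta - Delta)).
    have dE : 2 ^+ L * delta = 1 by rewrite mulfV ?gt_eqF.
    by rewrite mulrSr /e; lra.
have := gp xup; have := gp xlo; rewrite !ler_norml => /andP[g1 _] /andP[_ g2].
have h1 := ler_wpM2l (ltW NR) up2; have h2 := ler_wpM2l (ltW NR) lo2.
rewrite lerBlDl lerBrDl ler_pdivlMl// ler_pdivrMl//.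
by apply/andP; split; lra.
Qed.

End empirical_copula.

(** * Identification of the exponent *)

Section identification.
Context {R : realType}.

Lemma powR_bounds (a1 a2 M : R) : 0 < a1 -> exists2 kappa : R, 0 < kappa &
  forall x p, a1 <= x <= a2 -> `|p| <= M -> kappa^-1 <= x `^ p <= kappa.
Proof.
move=> a10; pose La := `|ln a1| + `|ln a2|.
exists (expR (M * La)); first exact: expR_gt0.
move=> x p /andP[x1 x2] pM.
have x0 : 0 < x by exact: lt_le_trans x1.
have lnx : `|ln x| <= La.
  have h1 : ln a1 <= ln x by rewrite ler_ln ?posrE.
  have h2 : ln x <= ln a2 by rewrite ler_ln ?posrE// (lt_le_trans x0).
  rewrite /La ler_norml; have := ler_norm (- ln a1); have := ler_norm (ln a2).
  rewrite normrN; have := normr_ge0 (ln a1); have := normr_ge0 (ln a2); lra.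
rewrite /powR gt_eqF// -expRN !ler_expR -ler_norml normrM.
by apply: ler_pM.
Qed.

(** A mean value argument on two disjoint intervals eliminates the intercept
and then the slope; what is left compares [x `^ (r - rho)] at two separated
points. *)
Lemma four_points (a1 a2 K1 K2 gap s0 eps : R) :
  0 < a1 -> K1 < K2 -> K2 < 0 -> 0 < gap -> 0 < s0 -> 0 < eps ->
  exists2 tau : R, 0 < tau & forall S b0 b1 r rho x1 x2 x3 x4 : R,
    s0 <= `|S| -> K1 <= r <= K2 -> K1 <= rho <= K2 ->
    a1 <= x1 -> x1 + gap <= x2 -> x2 + gap <= x3 -> x3 + gap <= x4 -> x4 <= a2 ->
    (forall x, x \in [:: x1; x2; x3; x4] -> `|S * x `^ r - b0 - b1 * x `^ rho| <= tau) ->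
    `|rho - r| <= eps.
Proof.
move=> a10 K12 K20 gap0 s00 eps0.
have [kappa k0 kP] := @powR_bounds a1 a2 (1 - 2 * K1) a10.
(* The value for which the elimination below yields exactly [eps]. *)
pose tau := s0 * - K2 * eps * gap ^+ 2 / (4 * kappa ^+ 2).
have tau0 : 0 < tau by rewrite divr_gt0 ?mulr_gt0 ?oppr_gt0 ?exprn_gt0.
exists tau => // S b0 b1 r rho x1 x2 x3 x4 Ss hr hrho a1x1 x12 x23 x34 x4a2 close.
pose G x := S * x `^ r - b0 - b1 * x `^ rho.
pose G' x := S * (r * x `^ (r - 1)) - b1 * (rho * x `^ (rho - 1)).
have dG (x : R) : 0 < x -> is_derive x 1 G (G' x).
  move=> x0; have d1 := is_derive1_powR r x0; have d2 := is_derive1_powR rho x0.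
  have -> : G = (S *: (fun y : R => y `^ r)) - cst b0 - (b1 *: (fun y : R => y `^ rho)).
    by apply/funext => y.
  by apply: is_derive_eq; rewrite /G' subr0.
have slope u v : a1 <= u -> u + gap <= v -> v <= a2 -> `|G u| <= tau -> `|G v| <= tau ->
    exists2 xi, u < xi < v & `|S * r * xi `^ (r - rho) - b1 * rho| <= 2 * tau * kappa / gap.
  move=> a1u uv va2 Gu Gv.
  have u_lt_v : u < v by apply: lt_le_trans uv; rewrite ltrDl.
  have [||xi] := @MVT _ G G' u v u_lt_v.
  - by move=> x; rewrite in_itv /= => /andP[ux _]; apply: dG; apply: lt_trans ux; exact: lt_le_trans a1u.
  - apply: derivable_within_continuous => x; rewrite in_itv /= => /andP[ux _].
    have x0 : 0 < x by apply: lt_le_trans ux; exact: lt_le_trans a1u.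
    by have [] := dG x x0.
  rewrite in_itv /= => /andP[uxi xiv] e; exists xi; first by rewrite uxi.
  have xi0 : 0 < xi by apply: lt_trans uxi; exact: lt_le_trans a1u.
  have -> : S * r * xi `^ (r - rho) - b1 * rho = G' xi * xi `^ (1 - rho).
    have xi_neq0 : xi != 0 by rewrite gt_eqF.
    have eA : xi `^ (r - 1) * xi `^ (1 - rho) = xi `^ (r - rho).
      by rewrite -powRD ?xi_neq0 ?implybT// addrA subrK.
    have eB : xi `^ (rho - 1) * xi `^ (1 - rho) = 1.
      by rewrite -powRD ?xi_neq0 ?implybT// addrA subrK subrr powRr0.
    rewrite -eA (_ : b1 * rho = b1 * rho * (xi `^ (rho - 1) * xi `^ (1 - rho))).
      by rewrite /G'; ring.
    by rewrite eB mulr1.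
  have /andP[_ xik] : kappa^-1 <= xi `^ (1 - rho) <= kappa.
    apply: kP; first by rewrite (le_trans a1u (ltW uxi)) (le_trans (ltW xiv)).
    by rewrite ler_norml; lra.
  rewrite normrM (ger0_norm (powR_ge0 _ _)).
  have G'le : `|G' xi| <= 2 * tau / gap.
    rewrite ler_pdivlMr//.
    apply: (@le_trans _ _ (`|G' xi| * (v - u))).
      by rewrite ler_wpM2l// lerBrDl.
    rewrite -[v - u]gtr0_norm ?subr_gt0// -normrM -e.
    by apply: le_trans (ler_normB _ _) _; lra.
  rewrite (_ : 2 * tau * kappa / gap = 2 * tau / gap * kappa); last by ring.
  by apply: ler_pM => //; exact: powR_ge0.
have c1 : `|G x1| <= tau by apply: close; rewrite !inE eqxx.
have c2 : `|G x2| <= tau by apply: close; rewrite !inE eqxx orbT.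
have c3 : `|G x3| <= tau by apply: close; rewrite !inE eqxx !orbT.
have c4 : `|G x4| <= tau by apply: close; rewrite !inE eqxx !orbT.
have x2a2 : x2 <= a2 by lra.
have a1x3 : a1 <= x3 by lra.
have [xi /andP[xi1 xi2] hxi] := slope x1 x2 a1x1 x12 x2a2 c1 c2.
have [xi' /andP[xi3 xi4] hxi'] := slope x3 x4 a1x3 x34 x4a2 c3 c4.
pose p := r - rho.
have xixi' : xi + gap <= xi' by lra.
have xilt : xi < xi' by lra.
have dp (x : R) : 0 < x -> is_derive x 1 (fun y => y `^ p) (p * x `^ (p - 1)).
  exact: is_derive1_powR.
have [||eta] := @MVT _ (fun y => y `^ p) (fun x => p * x `^ (p - 1)) xi xi' xilt.
- by move=> x; rewrite in_itv /= => /andP[ux _]; apply: dp; lra.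
- apply: derivable_within_continuous => x; rewrite in_itv /= => /andP[ux _].
  have x0 : 0 < x by lra.
  by have [] := dp x x0.
rewrite in_itv /= => /andP[eta1 eta2] e.
have /andP[ek _] : kappa^-1 <= eta `^ (p - 1) <= kappa.
  by apply: kP; rewrite ?ler_norml /p; lra.
have h1 : `|p| * (kappa^-1 * gap) <= `|xi' `^ p - xi `^ p|.
  rewrite e !normrM -mulrA ler_wpM2l//; apply: ler_pM; rewrite ?invr_ge0 ?(ltW k0) ?(ltW gap0)//.
    exact: le_trans (ler_norm _).
  by rewrite gtr0_norm; lra.
have h2 : `|S| * `|r| * `|xi' `^ p - xi `^ p| <= 4 * tau * kappa / gap.
  rewrite -!normrM (_ : S * r * (xi' `^ p - xi `^ p) =
    (S * r * xi' `^ p - b1 * rho) - (S * r * xi `^ p - b1 * rho)); last by ring.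
  apply: le_trans (ler_normB _ _) _.
  rewrite (_ : 4 * tau * kappa / gap = 2 * tau * kappa / gap + 2 * tau * kappa / gap); last by ring.
  by rewrite lerD.
have h3 : s0 * - K2 * (`|p| * (kappa^-1 * gap)) <= 4 * tau * kappa / gap.
  apply: le_trans h2; apply: ler_pM => //.
  - by rewrite mulr_ge0// ?(ltW s00)// oppr_ge0 ltW.
  - by rewrite !mulr_ge0 ?invr_ge0// ltW.
  - apply: ler_pM => //; rewrite ?(ltW s00) ?oppr_ge0 ?(ltW K20)//.
    by rewrite ltr0_norm; lra.
have -> : `|rho - r| = `|p| by rewrite /p distrC.
have c0 : 0 < s0 * - K2 * (kappa^-1 * gap) by rewrite !mulr_gt0 ?invr_gt0 ?oppr_gt0.
rewrite -(ler_pM2l c0); apply: le_trans (_ : 4 * tau * kappa / gap <= _).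
  by apply: le_trans h3; rewrite le_eqVlt; apply/orP; left; apply/eqP; ring.
rewrite le_eqVlt; apply/orP; left; apply/eqP; rewrite /tau; field.
by rewrite !gt_eqF.
Qed.

End identification.

(** * Uniform convergence for regularly varying sequences *)

Section regular_variation.
Context {R : realType}.
Variables (phi : nat -> R) (rho : R).
Hypotheses (phi_gt0 : forall m, (0 < m)%N -> 0 < phi m)
  (phi_rv : regularly_varying phi rho).

(** Regular variation says that this ratio tends to [1]; it is a multiplicative
cocycle, so closeness to [1] can be transported along intermediate integers. *)
Definition rv_ratio (m j : nat) : R := phi j / phi m * (j%:R / m%:R) `^ (- rho).

Lemma rv_ratio_gt0 m j : (0 < m)%N -> (0 < j)%N -> 0 < rv_ratio m j.
Proof.
by move=> m0 j0; rewrite mulr_gt0 ?divr_gt0 ?phi_gt0// powR_gt0// divr_gt0 ?ltr0n.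
Qed.

Lemma rv_ratio_cocycle m k j : (0 < m)%N -> (0 < k)%N -> (0 < j)%N ->
  rv_ratio m j = rv_ratio m k * rv_ratio k j.
Proof.
move=> m0 k0 j0; rewrite /rv_ratio.
have -> : (j%:R / m%:R : R) = (k%:R / m%:R) * (j%:R / k%:R).
  by field; rewrite !pnatr_eq0 -!lt0n ?m0 ?k0.
rewrite powRM ?divr_ge0//.
have := phi_gt0 k0; have := phi_gt0 m0; rewrite !lt0r => /andP[h1 _] /andP[h2 _].
by field; rewrite ?h1 ?h2.
Qed.

Lemma cvg_truncn_ratio (x : R) : 0 < x ->
  ((Num.truncn (m%:R * x))%:R / m%:R : R) @[m --> \oo] --> x.
Proof.
move=> x0; apply/cvgrPdist_le => e e0.
near=> m.
have m0 : 0 < m%:R :> R by rewrite ltr0n; near: m; exists 1%N.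
have m1 : m%:R^-1 <= e.
  rewrite -[e]invrK lef_pV2 ?posrE ?invr_gt0//.
  near: m; exists (Num.truncn e^-1).+1 => // k /= ke.
  by apply: ltW; apply: (lt_le_trans (truncnS_gt _)); rewrite ler_nat.
have /andP[h1 h2] := truncn_itv (mulr_ge0 (ltW m0) (ltW x0)).
apply: le_trans m1; set t := Num.truncn _ in h1 h2 *.
have -> : x - t%:R / m%:R = (m%:R * x - t%:R) / m%:R by field; rewrite gt_eqF.
rewrite normrM (gtr0_norm (_ : 0 < m%:R^-1)) ?invr_gt0// ler_piMl ?invr_ge0 ?(ltW m0)//.
by rewrite ler_norml; move: h2; rewrite mulrSr; lra.
Unshelve. all: by end_near. Qed.

Lemma rv_ratio_cvg (x : R) : 0 < x ->
  rv_ratio m (Num.truncn (m%:R * x)) @[m --> \oo] --> (1 : R).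
Proof.
move=> x0; have one : x `^ rho * x `^ (- rho) = 1.
  by rewrite -powRD ?(gt_eqF x0) ?implybT// subrr powRr0.
rewrite -[X in _ --> X]one; apply: cvgM.
  apply/cvgrPdist_le => e e0.
  have /cvgrPdist_le/(_ _ e0) [N [_ hN]] := phi_rv x0.
  near=> m; have := hN m%:R; rewrite /= natrK => h; apply: h.
  apply: (@lt_le_trans _ _ (Num.truncn N).+1%:R); first exact: truncnS_gt.
  by rewrite ler_nat; near: m; exists (Num.truncn N).+1.
have cont : {for x, continuous (fun y : R => y `^ (- rho))}.
  apply: differentiable_continuous; apply/derivable1_diffP.
  by have [] := is_derive1_powR (- rho) x0.
exact: (continuous_cvg _ cont (cvg_truncn_ratio x0)).
Unshelve. all: by end_near. Qed.

Let mu := @lebesgue_measure R.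
Definition rv_bad (eta : R) (m j : nat) : bool := (eta < `|rv_ratio m j - 1|).

Let Bad eta c m : set R :=
  [set x | 1 <= x <= c /\ rv_bad eta m (Num.truncn (m%:R * x))].

Let piece m j : set R := `[j%:R / m%:R, j.+1%:R / m%:R[%classic.

Let pieceE m j x : (0 < m)%N -> 0 <= x -> piece m j x <-> Num.truncn (m%:R * x) = j.
Proof.
move=> m0 x0; have mR : 0 < m%:R :> R by rewrite ltr0n.
rewrite /piece /= in_itv /= ler_pdivrMr// ltr_pdivlMr// ![x * _]mulrC.
split=> [|<-]; first exact: truncn_def.
by apply: truncn_itv; rewrite mulr_ge0// ltW.
Qed.

Let mpiece m j : measurable (piece m j). Proof. exact: measurable_itv. Qed.

Let mBad eta c m : (0 < m)%N -> measurable (Bad eta c m).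
Proof.
move=> m0; rewrite (_ : Bad eta c m = `[1, c]%classic `&`
   \bigcup_(j in [set j | rv_bad eta m j]) piece m j).
  apply: measurableI; first exact: measurable_itv.
  by apply: bigcup_measurable => j _; exact: mpiece.
apply/seteqP; split=> x /=.
  move=> [x1 b]; rewrite in_itv /=; split=> //.
  exists (Num.truncn (m%:R * x)) => //; apply/pieceE => //.
  by case/andP: x1 => x1 _; apply: le_trans x1.
rewrite in_itv /= => -[x1 [j bj pj]]; split=> //.
have x0 : 0 <= x by case/andP: x1 => x1 _; apply: le_trans x1.
by move/(pieceE _ m0 x0): pj => ->.
Qed.

Let cvg_tail_measure eta c : 0 < eta ->
  mu (\bigcup_(m in [set m | (n < m)%N]) Bad eta c m) @[n --> \oo] --> 0%E.
Proof.
move=> eta0.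
pose E n := \bigcup_(m in [set m | (n < m)%N]) Bad eta c m.
have mE n : measurable (E n).
  by apply: bigcup_measurable => m /= nm; apply: mBad; exact: leq_trans nm.
have E0 : \bigcap_n E n = set0.
  apply/seteqP; split=> // x Ex.
  have [m0 _ [x1 _]] := Ex 0%N I.
  have x0 : 0 < x by case/andP: x1 => x1 _; apply: lt_le_trans x1.
  have /cvgrPdist_le/(_ _ eta0) [N _ hN] := rv_ratio_cvg x0.
  have [m /= Nm [_ bad]] := Ex N I.
  by have := hN m (ltnW Nm); rewrite distrC leNgt; move: bad; rewrite /rv_bad => ->.
rewrite -(measure0 mu) -E0; apply: nonincreasing_cvg_mu => //.
- apply: (@le_lt_trans _ _ (mu `[1, c]%classic)).
    apply: le_measure; rewrite ?inE; [exact: mE|exact: measurable_itv|].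
    by move=> x [m _ [x1 _]]; rewrite /= in_itv.
  by rewrite /mu lebesgue_measure_itv /=; case: ifP => _; rewrite ltry.
- by rewrite E0.
- move=> n n' nn'; apply/subsetPset => x [m /= h Bm]; exists m => //=.
  by apply: leq_ltn_trans h.
Qed.

(** Pointwise convergence of the ratios gives convergence in measure; since
the ratios only depend on integers, this bounds the number of bad integers. *)
Lemma rv_bad_density (eta c theta : R) : 0 < eta -> 0 < theta ->
  \forall m \near \oo, forall J : nat, J%:R <= c * m%:R ->
   (#|[set j : 'I_J | (m <= j)%N && rv_bad eta m j]%SET|%:R : R) <= theta * m%:R.
Proof.
move=> eta0 theta0.
have /fine_cvgP[_ /cvgrPdist_lt/(_ _ theta0)[N _ hN]] := cvg_tail_measure c eta0.
exists N.+1 => // m /= Nm J Jc.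
have m0 : (0 < m)%N by exact: leq_trans Nm.
have mR : 0 < m%:R :> R by rewrite ltr0n.
pose Q (j : 'I_J) := (m <= j)%N && rv_bad eta m j.
have tr : trivIset setT (fun j : 'I_J => piece m j).
  move=> i j _ _ [x [pi pj]]; apply: val_inj => /=.
  have x0 : 0 <= x.
    by move: pi; rewrite /piece /= in_itv /= => /andP[h _]; apply: le_trans h; rewrite divr_ge0.
  by move/(pieceE _ m0 x0): pi => <-; apply/pieceE.
have muU := measure_bigsetU_ord mu Q (fun j => mpiece m j) tr.
have sumE : (\sum_(j < J | Q j) mu (piece m j) = (#|[set j : 'I_J | Q j]%SET|%:R / m%:R : R)%:E)%E.
  transitivity (\sum_(j < J | Q j) ((m%:R^-1 : R)%:E)).
    apply: eq_bigr => j _; rewrite /mu /piece lebesgue_measure_itv /= lte_fin.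
    rewrite ltr_pM2r ?invr_gt0// ltr_nat ltnSn -EFinB -mulrBl mulrSr addrAC subrr add0r.
    by rewrite mul1r.
  by rewrite sumEFin sumr_const mulr_natl; congr (_%:E); congr (_ *+ _); apply: eq_card => j; rewrite inE.
have le1 : ((#|[set j : 'I_J | Q j]%SET|%:R / m%:R : R)%:E <=
    mu (\bigcup_(m' in [set m' | (N < m')%N]) Bad eta c m'))%E.
  rewrite -sumE -muU; apply: le_measure; rewrite ?inE.
  - by apply: bigsetU_measurable => j _; exact: mpiece.
  - by apply: bigcup_measurable => m' /= Nm'; apply: mBad; exact: leq_trans Nm'.
  - move=> x; rewrite -bigcup_seq_cond => -[j /= /andP[_ /andP[mj bj]] pj].
    have x1 : 1 <= x.
      move: pj; rewrite /piece /= in_itv /= => /andP[h _]; apply: le_trans h.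
      by rewrite ler_pdivlMr// mul1r ler_nat.
    exists m => //; split; last by move/(pieceE _ m0 (le_trans ler01 x1)): pj => ->.
    rewrite x1 /=; move: pj; rewrite /piece /= in_itv /= => /andP[_ h].
    apply: (ltW (lt_le_trans h _)); rewrite ler_pdivrMr//; apply: le_trans Jc.
    by rewrite ler_nat.
have fin : mu (\bigcup_(m' in [set m' | (N < m')%N]) Bad eta c m') \is a fin_num.
  rewrite ge0_fin_numE//; apply: (@le_lt_trans _ _ (mu `[1, c]%classic)).
    apply: le_measure; rewrite ?inE; [|exact: measurable_itv|].
      by apply: bigcup_measurable => m' /= Nm'; apply: mBad; exact: leq_trans Nm'.
    by move=> x [m' _ [x1 _]]; rewrite /= in_itv.
  by rewrite /mu lebesgue_measure_itv /=; case: ifP => _; rewrite ltry.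
have := hN N (leqnn N); rewrite sub0r normrN /= ger0_norm ?fine_ge0// => lt.
rewrite -ler_pdivrMr//; apply: le_trans (ltW lt).
by rewrite -lee_fin fineK.
Qed.

(** Bad integers have small density both at scale [m] and at the comparable scale
[k], hence do not exhaust a stretch of [m] consecutive integers above both. *)
Lemma rv_common_good (eta a1 a2 : R) : 0 < eta -> 0 < a1 ->
  \forall m \near \oo, forall k : nat, a1 <= k%:R / m%:R <= a2 ->
   exists2 j, (0 < j)%N & ~~ rv_bad eta m j && ~~ rv_bad eta k j.
Proof.
move=> eta0 a10.
have [a12|a21] := leP a1 a2; last first.
  by near=> m; move=> k /andP[h1 h2]; have := le_trans h1 h2; rewrite leNgt a21.
(* The stretch starts above [lo * m], hence above both [m] and [k <= a2 * m], and
   its [m] integers stay below [(hi + 1) * m]; since [k >= a1 * m], the factor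
   [c] bounds it relative to [m] and to [k]. *)
pose lo := 1 + a2; pose hi := 2 + a2.
pose c := hi + 1 + (hi + 1) / a1.
(* Bad integers number at most [theta * (m + k) <= m / 3]. *)
pose theta := (3 * (1 + a2))^-1.
have a20 : 0 < a2 by exact: lt_le_trans a12.
have theta0 : 0 < theta by rewrite invr_gt0 mulr_gt0// addr_gt0.
have [N1 _ hN] := rv_bad_density c eta0 theta0.
near=> m; move=> k /andP[km1 km2].
have m1 : (0 < m)%N by near: m; exists 1%N.
have mR : 0 < m%:R :> R by rewrite ltr0n.
have mR1 : 1 <= m%:R :> R by rewrite ler1n.
move: km1 km2; rewrite ler_pdivlMr// ler_pdivrMr// => km1 km2.
have kN : (N1 <= k)%N.
  rewrite -(ler_nat R); apply: le_trans km1.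
  rewrite mulrC -ler_pdivrMr//; near: m.
  exists (Num.truncn (N1%:R / a1)).+1 => // m' /= h.
  by apply: ltW; apply: (lt_le_trans (truncnS_gt _)); rewrite ler_nat.
have mN : (N1 <= m)%N by near: m; exists N1.
have k0 : (0 < k)%N.
  by rewrite -(ltr_nat R); apply: lt_le_trans km1; rewrite mulr_gt0.
have kR : 0 < k%:R :> R by rewrite ltr0n.
pose J0 := (Num.truncn (lo * m%:R)).+1.
pose J := (J0 + m)%N.
have lo0 : 0 <= lo * m%:R by rewrite mulr_ge0// addr_ge0// ltW.
have /andP[tr1 tr2] := truncn_itv lo0.
have J0_lo : lo * m%:R < J0%:R by [].
have J_hi : J%:R <= (hi + 1) * m%:R.
  rewrite /J natrD /J0 mulrSr; apply: (@le_trans _ _ (lo * m%:R + 1 + m%:R)).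
    by rewrite !lerD2r.
  by rewrite /hi /lo; nra.
have Jm : J%:R <= c * m%:R.
  apply: le_trans J_hi _; rewrite ler_pM2r// /c lerDl divr_ge0 ?(ltW a10)//.
  by rewrite /hi; lra.
have Jk : J%:R <= c * k%:R.
  apply: le_trans J_hi _; apply: (@le_trans _ _ ((hi + 1) / a1 * k%:R)).
    rewrite -mulrA ler_wpM2l//; first by rewrite /hi; lra.
    by rewrite mulrC ler_pdivlMr// mulrC.
  by rewrite ler_pM2r// /c lerDr /hi; lra.
have bm := hN m mN J Jm; have bk := hN k kN J Jk.
set Bm := [set j : 'I_J | _ & _]%SET in bm; set Bk := [set j : 'I_J | _ & _]%SET in bk.
pose S := [set j : 'I_J | (J0 <= j)%N]%SET.
have cS : (m <= #|S|)%N.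
  rewrite -[leqLHS]card_ord -(card_imset _ (@rshift_inj J0 m)).
  apply: subset_leq_card; apply/fintype.subsetP => _ /imsetP[i _ ->]; by rewrite inE leq_addr.
have : (#|Bm :|: Bk| < #|S|)%N.
  apply: leq_trans cS; apply: leq_ltn_trans (leq_card_setU _ _) _.
  rewrite -(ltr_nat R) natrD; apply: (@le_lt_trans _ _ (theta * m%:R + theta * (a2 * m%:R))).
    by rewrite lerD// (le_trans bk)// ler_pM2l.
  rewrite (_ : _ + _ = m%:R / 3); first by rewrite ltr_pdivrMr// mulr_natr; nra.
  by rewrite /theta; field; rewrite gt_eqF// addr_gt0.
move=> lt; have /subsetPn[j jS jB] : ~~ (S \subset Bm :|: Bk).
  by apply/negP => /subset_leq_card; rewrite leqNgt lt.
have J0j : (J0 <= j)%N by move: jS; rewrite inE.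
have mj : (m <= j)%N.
  rewrite -(ler_nat R); apply: (@le_trans _ _ (lo * m%:R)).
    by rewrite ler_peMl// /lo lerDl ltW.
  by apply: (ltW (lt_le_trans J0_lo _)); rewrite ler_nat.
have kj : (k <= j)%N.
  rewrite -(ler_nat R); apply: (le_trans km2); apply: (@le_trans _ _ (lo * m%:R)).
    by rewrite ler_pM2r// /lo lerDr.
  by apply: (ltW (lt_le_trans J0_lo _)); rewrite ler_nat.
exists j; first exact: leq_trans mj.
by move: jB; rewrite !inE mj kj /= negb_or.
Unshelve. all: by end_near. Qed.

(** The cocycle relation through a common good integer compares [phi k] with
[phi m], however [k] varies with [m]. *)
Lemma regular_variation_uniform (a1 a2 eps : R) : 0 < a1 -> 0 < eps ->
  \forall m \near \oo, forall k : nat, a1 <= k%:R / m%:R <= a2 ->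
   `|phi k / phi m - (k%:R / m%:R) `^ rho| <= eps.
Proof.
move=> a10 eps0.
have [kappa k0 kP] := @powR_bounds R a1 a2 `|rho| a10.
pose eta := Num.min 2^-1 (eps / (4 * kappa)).
have eta0 : 0 < eta by rewrite lt_min invr_gt0 ltr0n divr_gt0// mulr_gt0.
near=> m.
have good (k : nat) : a1 <= k%:R / m%:R <= a2 ->
    exists2 j, (0 < j)%N & ~~ rv_bad eta m j && ~~ rv_bad eta k j.
  by move: k; near: m; exact: rv_common_good.
move=> k km.
have m1 : (0 < m)%N by near: m; exists 1%N.
have mR : 0 < m%:R :> R by rewrite ltr0n.
have k1 : (0 < k)%N.
  rewrite -(ltr_nat R); case/andP: km => + _; rewrite ler_pdivlMr//.
  by apply: lt_le_trans; rewrite mulr_gt0.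
have [j j0] := good k km.
rewrite /rv_bad -!leNgt => /andP[gm gk].
have mk := rv_ratio_gt0 m1 k1; have kj := rv_ratio_gt0 k1 j0.
rewrite (rv_ratio_cocycle m1 k1 j0) in gm.
have eta2 : eta <= 2^-1 by rewrite ge_min lexx.
have r_close : `|rv_ratio m k - 1| <= 4 * eta.
  move: gm gk; rewrite !ler_norml; set x := rv_ratio m k in mk *; set y := rv_ratio k j in kj *.
  move=> /andP[g1 g2] /andP[g3 g4].
  have y2 : 2^-1 <= y by lra.
  have x3 : x <= 3.
    have : x * 2^-1 <= x * y by rewrite ler_wpM2l// ltW.
    lra.
  have h : `|x * (y - 1)| <= 3 * eta.
    rewrite normrM gtr0_norm//; apply: ler_pM => //; first exact: ltW.
    by rewrite ler_norml; lra.
  move: h; rewrite ler_norml mulrBr mulr1; lra.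
have -> : phi k / phi m = rv_ratio m k * (k%:R / m%:R) `^ rho.
  have km0 : 0 < k%:R / m%:R :> R by rewrite divr_gt0// ltr0n.
  by rewrite /rv_ratio -mulrA -powRD ?(gt_eqF km0) ?implybT// addNr powRr0 mulr1.
rewrite -[X in _ - X]mul1r -mulrBl normrM (ger0_norm (powR_ge0 _ _)).
have /andP[_ pk] := kP _ rho km (lexx _).
have := ler_pM (normr_ge0 _) (powR_ge0 _ _) r_close pk; move=> /le_trans; apply.
have : eta <= eps / (4 * kappa) by rewrite ge_min lexx orbT.
by rewrite ler_pdivlMr ?mulr_gt0//; lra.
Unshelve. all: by end_near. Qed.

End regular_variation.

(** * The empirical copula in mean square over the block sizes *)

Section block_size_sums.
Context {R : realType} (m : nat -> nat) (a1 a2 : R).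

Definition admissible (n k : nat) : bool := a1 <= k%:R / (m n)%:R <= a2.

Lemma block_sizesE n k : block_sizes m `[a1, a2] n k = admissible n k.
Proof. by rewrite /block_sizes /= in_itv. Qed.

Lemma sum_block_sizes n l (F : nat -> R) :
  (forall k, admissible n k -> (k < l)%N) ->
  \sum_(k \in block_sizes m `[a1, a2] n) F k = \sum_(k < l | admissible n k) F k.
Proof.
move=> kl; rewrite [RHS]big_mkcond /=.
rewrite (@fsbig_ord _ _ _ l (fun k => if admissible n k then F k else 0)).
rewrite [LHS]fsbig_mkcond [RHS]fsbig_mkcond; apply: eq_fsbigr => k _.
rewrite /patch; have -> : (k \in block_sizes m `[a1, a2] n) = admissible n k.
  by apply/idP/idP; rewrite inE block_sizesE.
case: (boolP (admissible n k)) => [ak|_]; last by case: ifP.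
by rewrite (_ : k \in `I_l)// inE /=; exact: kl.
Qed.

End block_size_sums.

(** The constants follow from [(p + q) ^ 2 <= 2 p ^ 2 + 2 q ^ 2]; the factor [iq],
which is at most one, bounds its own square. *)
Lemma deviation_square (R : realFieldType) (b Al Dl sm S3 iq e x : R) :
  0 <= b -> 0 <= Al -> 0 <= sm -> Dl <= Al * sm -> e <= 2 * iq -> 0 <= iq <= 1 ->
  sm ^+ 2 <= 3 * S3 -> `|x| <= Dl + b * (2 * e + Dl) ->
  x ^+ 2 <= 6 * (b + 1) ^+ 2 * Al ^+ 2 * S3 + 32 * b ^+ 2 * iq.
Proof.
move=> b0 A0 sm0 DA eq /andP[q0 q1] smS xle.
pose u := (b + 1) * (Al * sm); pose v := b * (4 * iq).
have xuv : `|x| <= u + v.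
  apply: (le_trans xle); have := ler_wpM2l b0 eq; have := ler_wpM2l b0 DA.
  by rewrite /u /v; lra.
have -> : x ^+ 2 = `|x| ^+ 2 by rewrite real_normK ?num_real.
apply: (@le_trans _ _ ((u + v) ^+ 2)).
  by rewrite lerXn2r ?nnegrE// (le_trans _ xuv).
apply: (@le_trans _ _ (2 * u ^+ 2 + 2 * v ^+ 2)).
  by have := sqr_ge0 (u - v); lra.
apply: lerD.
  have -> : 2 * u ^+ 2 = 2 * (b + 1) ^+ 2 * Al ^+ 2 * sm ^+ 2 by rewrite /u; ring.
  have -> : 6 * (b + 1) ^+ 2 * Al ^+ 2 * S3 = 2 * (b + 1) ^+ 2 * Al ^+ 2 * (3 * S3) by ring.
  by rewrite ler_wpM2l// mulr_ge0 ?sqr_ge0// mulr_ge0 ?sqr_ge0.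
have -> : 2 * v ^+ 2 = 32 * b ^+ 2 * iq * iq by rewrite /v; ring.
by rewrite ler_piMr// mulr_ge0// mulr_ge0// sqr_ge0.
Qed.

Section uniform_L2.
Context {disp : measure_display} {T : measurableType disp} {R : realType}.
Context {P : probability T R} {d : nat} (X : int -> 'I_d -> {RV P >-> R}).
Hypotheses (X_stationary : strictly_stationary X)
  (X_continuous : forall j, continuous (cdf (X 1 j))) (d_gt0 : (0 < d)%N).
Variables (m : nat -> nat) (a1 a2 : R) (wt : nat -> nat -> R) (phi : nat -> R).
Hypotheses (a1_gt0 : 0 < a1) (a1_lt_a2 : a1 < a2)
  (m_range : forall n, (0 < n)%N -> (0 < m n <= n)%N)
  (ratio_cvg : (n%:R / (m n)%:R : R) @[n --> \oo] --> +oo)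
  (beta_cvg : beta_mix X (m n) * (n%:R / (m n)%:R) `^ (2^-1) @[n --> \oo] --> (0 : R))
  (bias_dominates : Num.sqrt (n%:R / (m n)%:R) * phi (m n) @[n --> \oo] --> +oo)
  (wt_gt0 : forall n k : nat, (0 < n)%N -> block_sizes m `[a1, a2] n k -> 0 < wt n k)
  (wt_sum1 : forall n : nat, (0 < n)%N -> \sum_(k \in block_sizes m `[a1, a2] n) wt n k = 1).

(** The mean square over [k] is at most [K * m / n] off an event of probability at most [eta], and
[m / n] is negligible against [phi m ^ 2]. *)
Lemma emp_copula_L2 (tau eta : R) : 0 < tau -> 0 < eta ->
  \forall n \near \oo, exists E : set T, [/\ measurable E, pr P E <= eta &
    forall v, ~ E v -> forall u, cube u ->
      \sum_(k \in block_sizes m `[a1, a2] n)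
        wt n k * (emp_copula X n k u v - block_copula X k u) ^+ 2 <= tau * phi (m n) ^+ 2].
Proof.
move=> tau0 eta0.
pose C0 : R := 2 + 2 * ((8 * d)%:R ^+ d) ^+ 4.
have C00 : 0 < C0 by rewrite ltr_wpDr// mulr_ge0// !exprn_ge0.
(* Markov's inequality at level [t] for each of the three families of blocks
   leaves a total probability of [eta]. *)
pose t : R := 3 * C0 / eta.
have t0 : 0 < t by rewrite divr_gt0// mulr_gt0.
pose K : R := 144 * (d.+1%:R) ^+ 2 * (a2 + 2) ^+ 2 * t ^+ 2 + 32 * d%:R ^+ 2.
have a20 : 0 < a2 by exact: lt_trans a1_lt_a2.
have K0 : 0 <= K.
  apply: addr_ge0; last by rewrite mulr_ge0// sqr_ge0.
  by rewrite mulr_ge0 ?sqr_ge0// mulr_ge0 ?sqr_ge0// mulr_ge0 ?sqr_ge0.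
near=> n.
have n0 : (0 < n)%N by near: n; exists 1%N.
have /andP[m0 mn] := m_range n0.
set q : R := n%:R / (m n)%:R.
have mR : 0 < (m n)%:R :> R by rewrite ltr0n.
have mR1 : 1 <= (m n)%:R :> R by rewrite ler1n.
have nR : 0 < n%:R :> R by rewrite ltr0n.
have qbig : 2 * a2 <= q.
  by rewrite /q; near: n; move/cvgryPge : ratio_cvg; apply.
have beta_small : beta_mix X (m n) * Num.sqrt q <= 4^-1.
  have q0 : 0 <= q by rewrite divr_ge0.
  rewrite -powR12_sqrt//; apply: le_trans (ler_norm _) _.
  by rewrite -[X in `|X|]subr0 distrC /q; near: n; move/cvgrPdist_le : beta_cvg; apply; rewrite invr_gt0.
have bias_big : Num.sqrt (K / tau) <= Num.sqrt q * phi (m n).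
  by rewrite /q; near: n; move/cvgryPge : bias_dominates; apply.
have q0 : 0 < q by rewrite divr_gt0.
have q1 : 1 <= q by rewrite ler_pdivlMr// mul1r ler_nat.
(* There are at most [n / m + 1 <= 2 q] blocks. *)
pose s : R := Num.sqrt (2 * q).
have s2 : s ^+ 2 = 2 * q by rewrite sqr_sqrtr// mulr_ge0// ltW.
have s0 : 0 < s by rewrite sqrtr_gt0 mulr_gt0.
(* Blocks longer than every admissible block size, and than the distance [m n]
   at which the mixing coefficient is controlled. *)
pose l := (Num.truncn ((a2 + 1) * (m n)%:R)).+1.
have l_big : (a2 + 1) * (m n)%:R < l%:R by exact: truncnS_gt.
have l_small : l%:R <= (a2 + 2) * (m n)%:R.
  have /andP[h _] : (Num.truncn ((a2 + 1) * (m n)%:R))%:R <= (a2 + 1) * (m n)%:R <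
      (Num.truncn ((a2 + 1) * (m n)%:R)).+1%:R.
    by apply: truncn_itv; rewrite mulr_ge0// addr_ge0// ltW.
  by rewrite /l mulrSr; lra.
have l0 : (0 < l)%N by [].
have ml : (m n <= l)%N.
  by rewrite -(ler_nat R); apply: (ltW (le_lt_trans _ l_big)); rewrite ler_peMl// lerDr ltW.
have kl k : admissible m a1 a2 n k -> (k < l)%N.
  move=> /andP[_]; rewrite ler_pdivrMr// => h; rewrite -(ltr_nat R).
  apply: (le_lt_trans h); apply: le_lt_trans l_big.
  by rewrite ler_pM2r// lerDl.
have kn k : admissible m a1 a2 n k -> 2 * k%:R <= n%:R :> R.
  move=> /andP[_]; rewrite ler_pdivrMr// => h.
  by move: qbig; rewrite /q ler_pdivlMr//; lra.
have k_gt0 k : admissible m a1 a2 n k -> (0 < k)%N.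
  move=> /andP[+ _]; rewrite ler_pdivlMr// => h; rewrite -(ltr_nat R).
  by apply: lt_le_trans h; rewrite mulr_gt0.
pose B := (n %/ l).+1.
have Bs : B%:R <= s ^+ 2.
  rewrite s2 /B mulrSr mulr_natl mulr2n lerD//.
  rewrite ler_pdivlMr// -natrM ler_nat; apply: leq_trans (leq_divM n l).
  by rewrite leq_mul2l ml orbT.
have nB k : (n.+1 - k <= 3 * B * l)%N \/ k = 0%N.
  case: k => [|k]; [by right|left].
  rewrite subSS; apply: leq_trans (leq_subr _ _) _.
  by apply: leq_trans (ltnW (ltn_ceil n l0)) _; rewrite leq_mul2r leq_pmull ?orbT.
(* The mesh [2 ^- L] lies between [1 / q] and [2 / q]: coarse enough for the
   moment bound, and negligible against the rate [1 / sqrt q]. *)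
pose L := trunc_log 2 (n %/ m n).
have nm1 : (0 < n %/ m n)%N by rewrite divn_gt0.
have qdiv : (n %/ m n)%:R <= q by rewrite ler_pdivlMr// -natrM ler_nat leq_divM.
have Ls : 2 ^+ L <= s ^+ 2.
  apply: (@le_trans _ _ (n %/ m n)%:R).
    by rewrite -natrX ler_nat; exact: trunc_logP.
  by rewrite s2; lra.
have Lq : 2 ^- L <= 2 / q.
  have h : q <= 2 * 2 ^+ L.
    rewrite -exprS -natrX ler_pdivrMr// -natrM ler_nat.
    apply: leq_trans (ltnW (ltn_ceil n m0)) _; rewrite leq_mul2r.
    by rewrite (trunc_log_ltn (n %/ m n))// orbT.
  have p0 : 0 < 2 ^+ L :> R by rewrite exprn_gt0.
  by rewrite ler_pdivlMr// mulrC ler_pdivrMr.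
pose Q (k : 'I_l) := admissible m a1 a2 n k.
pose w (k : 'I_l) := wt n k.
have Q0 (k : 'I_l) : Q k -> (0 < k)%N by exact: k_gt0.
have w0 (k : 'I_l) : Q k -> 0 <= w k.
  by move=> Qk; apply/ltW/wt_gt0 => //; rewrite block_sizesE.
have w1 : \sum_(k | Q k) w k = 1 by rewrite -(wt_sum1 n0) (sum_block_sizes _ kl).
pose dev r v := norm_dev X w Q (active (l := l) n) r (observed X L l r B (sample X v)).
exists (\big[setU/set0]_(r < 3) [set v | t * s < dev r v]).
have mdev r : measurable [set v | t * s < dev r v] by exact: measurable_norm_dev.
have beta_s : B%:R * (2 * beta_mix X (m n) / s) <= 1.
  have [b0|b0] := leP (beta_mix X (m n)) 0.
    apply: le_trans ler01; rewrite mulrC pmulr_lle0 ?ltr0n// pmulr_lle0 ?invr_gt0//; lra.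
  apply: (@le_trans _ _ (s ^+ 2 * (2 * beta_mix X (m n) / s))).
    by rewrite ler_wpM2r// divr_ge0 ?(ltW s0)// mulr_ge0// ltW.
  rewrite (_ : _ * _ = 2 * beta_mix X (m n) * s); last by field; rewrite gt_eqF.
  have sq : s <= 2 * Num.sqrt q.
    rewrite /s sqrtrM// ler_wpM2r ?sqrtr_ge0//.
    rewrite -[leRHS]ger0_norm// -sqrtr_sqr ler_wsqrtr//; lra.
  have := ler_wpM2l (ltW b0) sq; lra.
split.
- by apply: bigsetU_measurable => r _; exact: mdev.
- apply: le_trans (pr_bigsetU_le _ _ (fun r : 'I_3 => mdev r)) _.
  apply: (@le_trans _ _ (\sum_(r < 3) C0 / t)); last first.
    rewrite sumr_const card_ord /t -mulr_natl le_eqVlt; apply/orP; left; apply/eqP.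
    by field; rewrite !gt_eqF.
  apply: ler_sum => r _; rewrite /dev.
  apply: le_trans (norm_dev_tail X_stationary X_continuous d_gt0 l0 _ Q0 w0 w1 r ml s0 t0 Bs Ls) _.
  rewrite ler_pM2r ?invr_gt0// /C0; lra.
move=> v nE u cu; rewrite (sum_block_sizes _ kl) -/Q.
have dev_le (r : 'I_3) : dev r v <= t * s.
  rewrite leNgt; apply/negP => h; apply: nE; rewrite -bigcup_seq.
  by exists r => //=; exact: mem_index_enum.
pose md r k := max_dev (fun (k i : 'I_l) (y : {ffun 'I_l -> {ffun 'I_l -> {ffun 'I_d -> 'I_((2 ^ L).+1)}}}) => y k i)
  (active (l := l) n r) (fun k => cell_law_of X k) (observed X L l r B (sample X v)) k.
have md0 r k : 0 <= md r k by exact: bigmax_ge_id.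
have dev_sq (r : 'I_3) : \sum_(k | Q k) w k * md r k ^+ 2 <= (t * s) ^+ 2.
  have h : 0 <= \sum_(k | Q k) w k * md r k ^+ 2 by exact: weighted_sum_ge0.
  rewrite -(sqr_sqrtr h) ler_sqr ?nnegrE ?sqrtr_ge0 ?(mulr_ge0 (ltW t0) (ltW s0))//.
  exact: dev_le.
pose Al : R := 2 * l%:R / n%:R.
have Al0 : 0 <= Al by rewrite divr_ge0// mulr_ge0.
have each (k : 'I_l) : Q k -> (emp_copula X n k u v - block_copula X k u) ^+ 2 <=
    6 * d.+1%:R ^+ 2 * Al ^+ 2 * (\sum_(r < 3) md r k ^+ 2) + 32 * d%:R ^+ 2 / q.
  move=> Qk; have k0 := Q0 k Qk; have kn2 := kn k Qk.
  have knat : (k <= n)%N.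
    by rewrite -(ler_nat R); have := ler0n R k; lra.
  have NE : (n.+1 - k)%:R = n%:R + 1 - k%:R :> R.
    by rewrite natrB ?(leqW knat)// -natr1.
  have NR : n%:R / 2 <= (n.+1 - k)%:R :> R by rewrite NE; lra.
  have N0 : 0 < (n.+1 - k)%:R :> R by apply: lt_le_trans NR; rewrite divr_gt0.
  pose sm := \sum_(r < 3) md r k.
  have sm0 : 0 <= sm by exact: sumr_ge0.
  pose Dl : R := l%:R / (n.+1 - k)%:R * sm.
  have Dl0 : 0 <= Dl by rewrite mulr_ge0// divr_ge0.
  have DlA : Dl <= Al * sm.
    rewrite ler_wpM2r// /Al ler_pdivrMr// mulrAC ler_pdivlMr// [2 * _]mulrC -mulrA ler_wpM2l//.
    by move: NR; lra.
  have close (x : {ffun 'I_d -> 'I_((2 ^ L).+1).+1}) :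
      `|grid_freq X k (nblocks n k) x (sample X v) - (nblocks n k)%:R * grid_prob X k x| <=
      (nblocks n k)%:R * Dl.
    have -> : (nblocks n k)%:R * Dl = l%:R * sm.
      by rewrite /Dl /nblocks; field; rewrite gt_eqF.
    apply: (grid_freq_dev X l0 x (sample X v) k0).
    by case: (nB k) k0 => // ->.
  have Ngt0 : (0 < nblocks n k)%N by rewrite -(ltr_nat R).
  have := emp_copula_close X_stationary X_continuous k0 Ngt0 Dl0 close cu.
  rewrite -[d.+1%:R]natr1 => /(deviation_square (ler0n R d) Al0 sm0 DlA); apply => //.
  - by rewrite invr_ge0 (ltW q0) invf_le1.
  - have := cauchy_weighted (fun r : 'I_3 => md r k) (fun=> @ler01 R).
    rewrite sumr_const card_ord; under eq_bigr do rewrite mul1r.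
    by under [in X in _ <= _ * X]eq_bigr do rewrite mul1r.
apply: (@le_trans _ _ (K / q)); last first.
  have -> : tau * phi (m n) ^+ 2 = tau * (Num.sqrt q * phi (m n)) ^+ 2 / q.
    by rewrite exprMn sqr_sqrtr ?(ltW q0)//; field; rewrite gt_eqF.
  rewrite ler_pM2r ?invr_gt0// mulrC -ler_pdivrMr//.
  have Kt0 : 0 <= K / tau by rewrite divr_ge0// ltW.
  rewrite -[leLHS](sqr_sqrtr Kt0) lerXn2r ?nnegrE ?sqrtr_ge0//.
  exact: le_trans (sqrtr_ge0 _) bias_big.
apply: (@le_trans _ _ (6 * d.+1%:R ^+ 2 * Al ^+ 2 * (\sum_(r < 3) \sum_(k | Q k) w k * md r k ^+ 2)
   + 32 * d%:R ^+ 2 / q)).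
  rewrite exchange_big mulr_sumr -[X in _ + X]mul1r -[X in X * (_ / q)]w1 mulr_suml -big_split /=.
  apply: ler_sum => k Qk; rewrite -mulr_sumr [X in _ <= X + _]mulrCA -mulrDr.
  by rewrite ler_wpM2l ?w0//; exact: each.
have sum3 : \sum_(r < 3) \sum_(k | Q k) w k * md r k ^+ 2 <= 3 * (t * s) ^+ 2.
  rewrite mulr_natl -[X in _ *+ X](card_ord 3) -sumr_const.
  by apply: ler_sum => r _; exact: dev_sq.
have AlE : Al <= 2 * (a2 + 2) / q.
  rewrite /Al /q invf_div ler_pdivrMr// -!mulrA ler_pM2l//.
  by rewrite mulrC mulrA mulfVK ?gt_eqF// mulrC.
have Al2 : Al ^+ 2 <= (2 * (a2 + 2) / q) ^+ 2 by rewrite lerXn2r ?nnegrE// (le_trans Al0).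
rewrite [leRHS]mulrDl lerD2r.
apply: (@le_trans _ _ (6 * d.+1%:R ^+ 2 * (2 * (a2 + 2) / q) ^+ 2 * (3 * (t * s) ^+ 2))).
  apply: ler_pM => //.
  - by rewrite !mulr_ge0// sqr_ge0.
  - by apply: sumr_ge0 => r _; exact: weighted_sum_ge0.
  - by rewrite ler_wpM2l// mulr_ge0// sqr_ge0.
rewrite [(t * s) ^+ 2]exprMn s2 le_eqVlt; apply/orP; left; apply/eqP; field.
by rewrite gt_eqF.
Unshelve. all: by end_near. Qed.

End uniform_L2.

(** * The second order function and the weights *)

Section second_order_function.
Context {disp : measure_display} {T : measurableType disp} {R : realType}.
Context {P : probability T R} {d : nat} (X : int -> 'I_d -> {RV P >-> R}).
Hypotheses (X_stationary : strictly_stationary X)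
  (X_continuous : forall j, continuous (cdf (X 1 j))).

Lemma block_copula_lip k (u v : 'rV[R]_d) : (0 < k)%N ->
  `|block_copula X k u - block_copula X k v| <= d%:R * `|u - v|.
Proof.
move=> k0.
have half (u' v' : 'rV[R]_d) : block_copula X k u' <= block_copula X k v' + d%:R * `|u' - v'|.
  apply: (pr_margins_le X_stationary X_continuous (D := fun j => [set z | z <= u' 0 j])
     (D' := fun j => [set z | z <= v' 0 j])) => // [j|j|j]; try exact: down_closed_le.
  exists (v' 0 j) => z /= z1 /negP; rewrite -ltNge => /ltW ->/=.
  apply: (le_trans z1); rewrite -lerBlDl; apply: le_trans (ler_norm _) _.
  have -> : u' 0 j - v' 0 j = (u' - v') 0 j by rewrite !mxE.
  rewrite [leRHS]/Num.norm /= mx_normrE.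
  exact: (le_bigmax _ (fun ij : 'I_1 * 'I_d => `|(u' - v') ij.1 ij.2|) (0, j)).
by rewrite ler_norml; have := half u v; have := half v u; rewrite distrC; lra.
Qed.

Lemma block_copula01 k u : (0 < k)%N -> 0 <= block_copula X k u <= 1.
Proof.
move=> k0; rewrite /block_copula pr_ge0 /= pr_le1//.
apply: (measurable_cylinder X (I := setT)
  (E := [set x | forall j, uniformized X k 1 j x <= u 0 j])).
apply: cylinder_forall => j.
by apply: (@cylinder_uniformized _ _ _ _ _ X setT [set z | z <= u 0 j] k 1 j (@down_closed_le _ _)).
Qed.

Variables (Cinf S : 'rV[R]_d -> R) (phi : nat -> R) (rho : R).
Hypotheses (C_cvg : forall u, cube u -> block_copula X k u @[k --> \oo] --> Cinf u)
  (so : second_order X Cinf phi rho S).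

Lemma limit_copula_lip (u v : 'rV[R]_d) : cube u -> cube v ->
  `|Cinf u - Cinf v| <= d%:R * `|u - v|.
Proof.
move=> cu cv.
have h : `|block_copula X k u - block_copula X k v| @[k --> \oo] --> `|Cinf u - Cinf v|.
  by apply: cvg_norm; apply: cvgB; exact: C_cvg.
apply: (cvgr_to_le h) => //.
by exists 1%N => // k /= k0; exact: block_copula_lip.
Qed.

Lemma limit_copula01 u : cube u -> 0 <= Cinf u <= 1.
Proof.
move=> cu; have h := C_cvg cu; apply/andP; split.
  apply: (cvgr_to_ge h) => //.
  by exists 1%N => // k /= k0; case/andP: (block_copula01 u k0).
apply: (cvgr_to_le h) => //.
by exists 1%N => // k /= k0; case/andP: (block_copula01 u k0).
Qed.

Lemma second_order_at (eps : R) : 0 < eps -> exists2 k, (0 < k)%N &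
  forall u, cube u -> `|block_copula X k u - Cinf u - phi k * S u| <= eps * phi k.
Proof.
move=> e0; case: so => _ _ _ _ /(_ _ e0) [N _ hN].
by exists N.+1 => // u cu; apply: hN => //=.
Qed.

(** Up to a fixed error, [S] is a difference of two functions with values in [0, 1]
divided by the number [phi k], for some large [k]. *)
Lemma second_order_bounded : exists2 M : R, 0 < M & forall u, cube u -> `|S u| <= M.
Proof.
have [k k0 hk] := second_order_at ltr01.
have pk : 0 < phi k by case: so => + _ _ _ _; apply.
exists (1 + (phi k)^-1); first by rewrite addr_gt0// invr_gt0.
move=> u cu; have := hk u cu; have := block_copula01 u k0; have := limit_copula01 cu.
move=> c1 c2; rewrite mul1r => h.
rewrite -(ler_pM2l pk) -[X in X * `|_|](gtr0_norm pk) -normrM mulrDr mulr1 mulfV ?gt_eqF//.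
by move: h; rewrite !ler_norml; lra.
Qed.

(** Up to an arbitrarily small error, [S] is a Lipschitz function, though with a
constant that grows as the error decreases. *)
Lemma second_order_uniform_continuity (eps : R) : 0 < eps -> exists2 delta : R, 0 < delta &
  forall u v, cube u -> cube v -> `|u - v| <= delta -> `|S u - S v| <= eps.
Proof.
move=> e0; have e4 : 0 < eps / 4 by rewrite divr_gt0.
have [k k0 hk] := second_order_at e4.
have pk : 0 < phi k by case: so => + _ _ _ _; apply.
have d0 : 0 < 4 * (d%:R + 1) :> R by rewrite mulr_gt0// ltr_wpDl.
exists (eps * phi k / (4 * (d%:R + 1))); first by rewrite divr_gt0// mulr_gt0.
move=> u v cu cv; rewrite ler_pdivlMr// => uv.
have h1 := block_copula_lip u v k0; have h2 := limit_copula_lip cu cv.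
have h3 := hk u cu; have h4 := hk v cv.
rewrite -(ler_pM2l pk) -[X in X * `|_|](gtr0_norm pk) -normrM mulrBr.
have n0 := normr_ge0 (u - v).
by move: h1 h2 h3 h4; rewrite !ler_norml; lra.
Qed.

Lemma second_order_away (U : set 'rV[R]_d) : compact U ->
  U `<=` [set u | cube u /\ S u != 0] ->
  exists2 s0 : R, 0 < s0 & forall u, U u -> s0 <= `|S u|.
Proof.
move=> cU US.
have [->|/set0P U0] := eqVneq U set0; first by exists 1.
have cont : {within U, continuous (fun u => `|S u|)}.
  apply/subspace_continuousP => u Uu; apply/cvgrPdist_le => e e0.
  have [delta delta0 h] := second_order_uniform_continuity e0.
  rewrite near_withinE; near=> v => Uv.
  apply: le_trans (ler_dist_dist _ _) _.
  apply: h; [exact: (US _ Uu).1|exact: (US _ Uv).1|].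
  near: v; apply: filterS (nbhsx_ballx u delta delta0) => v; rewrite -ball_normE; exact: ltW.
have [c cU' hc] := compact_EVT_min U0 cU cont.
exists `|S c|; last by move=> u Uu; apply: hc; rewrite inE.
by rewrite normr_gt0; move: cU'; rewrite inE => /US[].
Unshelve. all: by end_near. Qed.

End second_order_function.

Section weights.
Context {R : realType}.
Variables (m : nat -> nat) (a1 a2 : R) (wt : nat -> nat -> R) (f : R -> R).
Hypotheses (a1_gt0 : 0 < a1) (a1_lt_a2 : a1 < a2)
  (m_gt0 : forall n, (0 < n)%N -> (0 < m n)%N) (m_cvg : m @ \oo --> \oo)
  (wt_gt0 : forall n k : nat, (0 < n)%N -> block_sizes m `[a1, a2] n k -> 0 < wt n k)
  (wt_limit : forall eps : R, 0 < eps -> \forall n \near \oo,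
     forall a : R, a1 <= a <= a2 ->
     block_sizes m `[a1, a2] n (Num.truncn ((m n)%:R * a)) ->
     `|(m n)%:R * wt n (Num.truncn ((m n)%:R * a)) - f a| <= eps)
  (f_continuous : {within `[a1, a2], continuous f})
  (f_int1 : (\int[lebesgue_measure]_(a in `[a1, a2]) (f a)%:E)%E = 1%E).

Lemma density_positive_point : exists2 x, a1 <= x <= a2 & 0 < f x.
Proof.
apply: contrapT => h.
have f0 x : `[a1, a2]%classic x -> (0 <= - (f x)%:E)%E.
  rewrite /= in_itv /= => xa; rewrite lee_fin oppr_ge0 leNgt; apply/negP => fx.
  by apply: h; exists x.
have := integral_ge0N lebesgue_measure f0.
have -> : (\int[lebesgue_measure]_(x in `[a1, a2]) (- - (f x)%:E) = 1)%E.
  by rewrite -f_int1; apply: eq_integral => x _; rewrite oppeK.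
have := integral_ge0 lebesgue_measure f0.
set I := (\int[_]_(_ in _) _)%E; case: I => //= r.
  by rewrite lee_fin => r0 [] e; have := ltr01 (R := R); rewrite e oppr_gt0 ltNge r0.
Qed.

Lemma density_positive_interval : exists al be c : R,
  [/\ a1 <= al, al < be, be <= a2, 0 < c & forall x, al <= x <= be -> c <= f x].
Proof.
have [x0 x0a fx0] := density_positive_point.
have [delta /= d0 hd] : exists2 delta : R, 0 < delta &
    forall x, a1 <= x <= a2 -> `|x0 - x| < delta -> f x0 / 2 <= f x.
  have x0in : `[a1, a2]%classic x0 by rewrite /= in_itv.
  have e0 : 0 < f x0 / 2 by rewrite divr_gt0.
  have /subspace_continuousP/(_ _ x0in)/cvgrPdist_le/(_ _ e0) := f_continuous.
  rewrite near_withinE => -[delta /= d0 hd]; exists delta => // x xa xd.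
  have := hd x xd; rewrite /= in_itv /= => /(_ xa); rewrite ler_norml => /andP[_ h].
  have {}h : f x0 - f x <= f x0 / 2 :> R by exact: h.
  lra.
have d2 : 0 < delta / 2 by rewrite divr_gt0.
have /andP[x1 x2] := x0a.
have [lt|ge] := ltP x0 a2.
  exists x0, (Num.min (x0 + delta / 2) a2), (f x0 / 2).
  split=> //; first by rewrite lt_min lt ltrDl d2.
  - by rewrite ge_min lexx orbT.
  - by rewrite divr_gt0.
  - move=> x /andP[h1]; rewrite le_min => /andP[h2 h3]; apply: hd; first lra.
    by rewrite ltr_norml; lra.
exists (Num.max (x0 - delta / 2) a1), x0, (f x0 / 2).
split=> //.
- by rewrite le_max lexx orbT.
- by rewrite gt_max ltrBlDr ltrDl d2 (lt_le_trans a1_lt_a2 ge).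
- by rewrite divr_gt0.
- move=> x /andP[]; rewrite ge_max => /andP[h1 h2] h3; apply: hd; first lra.
  by rewrite ltr_norml; lra.
Qed.

(** A small weighted sum of squares forces a small term in every fixed
subinterval on which the limiting weight density is positive. *)
Lemma weighted_pick (al be c : R) : a1 <= al -> al < be -> be <= a2 -> 0 < c ->
  (forall x, al <= x <= be -> c <= f x) ->
  \forall n \near \oo, forall (r : nat -> R) (theta : R), 0 < theta ->
    (forall k, 0 <= r k) ->
    \sum_(k \in block_sizes m `[a1, a2] n) wt n k * r k <= c * (be - al) / 8 * theta ->
    exists2 k : nat, al <= k%:R / (m n)%:R <= be & r k <= theta.
Proof.
move=> a1al alb ba2 c0 cf.
have c2 : 0 < c / 2 by rewrite divr_gt0.
have ba : 0 < be - al by rewrite subr_gt0.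
near=> n; move=> r theta theta0 r0 hsum.
have n0 : (0 < n)%N by near: n; exists 1%N.
have mn0 := m_gt0 n0.
have mR : 0 < (m n)%:R :> R by rewrite ltr0n.
have mbig : 2 / (be - al) <= (m n)%:R.
  near: n.
  suff : \forall k \near \oo, 2 / (be - al) <= (k : nat)%:R :> R by exact: m_cvg.
  exists (Num.truncn (2 / (be - al))).+1 => // k /= h.
  by apply: ltW; apply: (lt_le_trans (truncnS_gt _)); rewrite ler_nat.
have wlim : forall a : R, a1 <= a <= a2 ->
     block_sizes m `[a1, a2] n (Num.truncn ((m n)%:R * a)) ->
     `|(m n)%:R * wt n (Num.truncn ((m n)%:R * a)) - f a| <= c / 2.
  by near: n; exact: wt_limit.
apply: contrapT => no.
have w_lb k : al <= k%:R / (m n)%:R <= be -> c / 2 <= (m n)%:R * wt n k.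
  move=> kab; have kE : Num.truncn ((m n)%:R * (k%:R / (m n)%:R) : R) = k.
    by rewrite mulrC divfK ?gt_eqF// natrK.
  have ka : a1 <= k%:R / (m n)%:R <= a2 by lra.
  have := wlim _ ka; rewrite kE block_sizesE => /(_ ka).
  rewrite ler_norml => /andP[h _]; have fc := cf _ kab.
  have {}h : - (c / 2) <= (m n)%:R * wt n k - f (k%:R / (m n)%:R) :> R by exact: h.
  lra.
have al0 : 0 <= (m n)%:R * al.
  by rewrite mulr_ge0 ?(ltW mR)// (le_trans (ltW a1_gt0) a1al).
pose K0 := (Num.truncn ((m n)%:R * al)).+1.
pose c0' := Num.truncn ((m n)%:R * (be - al)).
have bal0 : 0 <= (m n)%:R * (be - al) by rewrite mulr_ge0 ?(ltW mR)// ltW.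
have /andP[K1 K2] := truncn_itv al0; have /andP[c1 c3] := truncn_itv bal0.
have inJ k : (K0 <= k < K0 + c0')%N -> al <= k%:R / (m n)%:R <= be.
  move=> /andP[k1 k2]; rewrite ler_pdivlMr// ler_pdivrMr//.
  have h1 : K0%:R <= k%:R :> R by rewrite ler_nat.
  have h2 : k%:R + 1 <= K0%:R + c0'%:R :> R by rewrite -natrD natr1 ler_nat.
  have K0E : K0%:R = (Num.truncn ((m n)%:R * al))%:R + 1 :> R by rewrite -natr1.
  have K0lb : (m n)%:R * al < K0%:R by [].
  rewrite -/c0' in c1; move: h1 h2 K1 K0lb c1; rewrite K0E; lra.
pose l := (K0 + c0' + (Num.truncn (a2 * (m n)%:R)).+1)%N.
have kl k : admissible m a1 a2 n k -> (k < l)%N.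
  move=> /andP[_]; rewrite ler_pdivrMr// => h.
  have : (k < (Num.truncn (a2 * (m n)%:R)).+1)%N.
    by rewrite -(ltr_nat R); apply: (le_lt_trans h); exact: truncnS_gt.
  by move=> h'; apply: leq_trans h' _; exact: leq_addl.
move: hsum; rewrite (sum_block_sizes _ kl) leNgt => /negP; apply.
pose G k := if admissible m a1 a2 n k then wt n k * r k else 0.
have G0 k : 0 <= G k.
  rewrite /G; case: ifP => // ak; rewrite mulr_ge0//.
  by apply/ltW/wt_gt0 => //; rewrite block_sizesE.
have -> : \sum_(k < l | admissible m a1 a2 n k) wt n k * r k = \sum_(0 <= k < l) G k.
  by rewrite big_mkcond big_mkord.
have K0l : (K0 <= K0 + c0')%N by exact: leq_addr.
have c0l : (K0 + c0' <= l)%N by exact: leq_addr.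
rewrite (big_cat_nat (n := K0)) ?(leq_trans K0l)//= (big_cat_nat (m := K0) (n := (K0 + c0')%N))//=.
apply: (@lt_le_trans _ _ (\sum_(K0 <= k < K0 + c0') G k)); last first.
  have s1 : 0 <= \sum_(0 <= k < K0) G k by exact: sumr_ge0.
  have s2 : 0 <= \sum_(K0 + c0' <= k < l) G k by exact: sumr_ge0.
  lra.
apply: (@lt_le_trans _ _ (\sum_(K0 <= k < K0 + c0') (c / 2 / (m n)%:R * theta))); last first.
  rewrite !big_nat; apply: ler_sum => k kJ; have kab := inJ k kJ.
  rewrite /G (_ : admissible m a1 a2 n k = true); last by rewrite /admissible; lra.
  apply: ler_pM; rewrite ?(ltW theta0)//.
  - by rewrite divr_ge0 ?(ltW mR)// ltW.
  - by rewrite ler_pdivrMr// [leRHS]mulrC; exact: w_lb.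
  - by rewrite leNgt; apply/negP => h; apply: no; exists k => //; exact: ltW.
rewrite sumr_const_nat addKn -[_ *+ c0']mulr_natl.
have c0_lb : (be - al) / 2 * (m n)%:R <= c0'%:R :> R.
  move: mbig; rewrite ler_pdivrMr// => mbig.
  by rewrite /c0'; move: c3; rewrite mulrSr; lra.
apply: (@lt_le_trans _ _ ((be - al) / 2 * (m n)%:R * (c / 2 / (m n)%:R * theta))); last first.
  by rewrite ler_wpM2r// mulr_ge0 ?(ltW theta0)// divr_ge0 ?(ltW mR)// ltW.
rewrite (_ : (be - al) / 2 * _ * _ = c * (be - al) / 4 * theta); last by field; rewrite gt_eqF.
by rewrite ltr_pM2r// ltr_pM2l ?mulr_gt0// ltf_pV2 ?posrE// ltr_nat.
Unshelve. all: by end_near. Qed.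

End weights.

(** * Consistency of the penalized estimator *)

Section outer_probability.
Context {disp : measure_display} {T : measurableType disp} {R : realType}.
Context (P : probability T R).

(** Outer probability is bounded by the probability of any measurable event that
covers the exceptional set. *)
Lemma oP1_of_events (Z : nat -> T -> R) :
  (forall eps delta : R, 0 < eps -> 0 < delta -> \forall n \near \oo,
    exists E : set T, [/\ measurable E, pr P E <= delta &
      forall v, ~ E v -> `|Z n v| <= eps]) -> oP1 P Z.
Proof.
move=> H eps eps0; apply/fine_cvgP.
have bound (delta : R) : 0 < delta -> \forall n \near \oo,
    (mu_ext P [set w | (eps < `|Z n w|)%R] <= delta%:E)%E.
  move=> d0; apply: filterS (H eps delta eps0 d0) => n [E [mE PE hE]].
  apply: (@le_trans _ _ (P E)); last by rewrite -(EFin_pr P mE) lee_fin.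
  rewrite -(measurable_mu_extE P mE); apply: le_mu_ext => v /= Zv.
  by apply: contrapT => /hE; rewrite leNgt Zv.
have ge0 n : (0 <= mu_ext P [set w | (eps < `|Z n w|)%R])%E by exact: mu_ext_ge0.
split.
  apply: filterS (bound 1 ltr01) => n h.
  by rewrite ge0_fin_numE//; apply: (le_lt_trans h); exact: ltry.
apply/cvgrPdist_le => delta d0; apply: filterS (bound delta d0) => n h /=.
have fin : mu_ext P [set w | (eps < `|Z n w|)%R] \is a fin_num.
  by rewrite ge0_fin_numE//; apply: (le_lt_trans h); exact: ltry.
rewrite sub0r normrN ger0_norm ?fine_ge0//.
by rewrite -lee_fin fineK.
Qed.

End outer_probability.

Section penalized.
Context {disp : measure_display} {T : measurableType disp} {R : realType}.
Context {P : probability T R} {d : nat} (X : int -> 'I_d -> {RV P >-> R}).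
Variables (m : nat -> nat) (a1 a2 : R) (wt : nat -> nat -> R) (K1 K2 eta : R).
Hypotheses (K2_lt0 : K2 < 0) (eta_ge0 : 0 <= eta).

Notation RSS := (RSS X m `[a1, a2] wt).
Notation RSS_pen := (RSS_pen X m `[a1, a2] wt K1 K2 eta).

Variables (n : nat) (v : T) (u : 'rV[R]_d).
Hypothesis (wt_ge0 : forall k, admissible m a1 a2 n k -> 0 <= wt n k).

Lemma RSS_ge0 b0 b1 rho : 0 <= RSS n v u b0 b1 rho.
Proof.
apply: fsumr_ge0 => k; rewrite block_sizesE => ak.
by rewrite mulr_ge0 ?sqr_ge0// wt_ge0.
Qed.

(** The penalty costs at most a constant factor at the true parameters, so a
minimizer of the penalized criterion nearly minimizes the plain one. *)
Lemma penalized_minimizer_RSS b0 b1 rho c0 c1 r : K1 <= rho <= K2 -> K1 <= r <= K2 ->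
  RSS_pen n v u b0 b1 rho <= RSS_pen n v u c0 c1 r ->
  RSS n v u b0 b1 rho <= (1 + eta / - K2) * RSS n v u c0 c1 r.
Proof.
move=> hrho hr; rewrite /Defs.RSS_pen; set I := (X in inf X).
have Ige y : I y -> 0 <= y by move=> [b [b' [kap [_ yE]]]]; rewrite yE; exact: RSS_ge0.
have lbI : has_lbound I by exists 0 => y /Ige.
have I0 : 0 <= inf I.
  by apply: lb_le_inf => [|y /Ige//]; exists (RSS n v u c0 c1 r), c0, c1, r.
have Ile : inf I <= RSS n v u c0 c1 r by apply: ge_inf => //; exists c0, c1, r.
have pos : 0 <= eta / `|rho| * inf I by rewrite mulr_ge0 ?I0 ?divr_ge0 ?normr_ge0 ?eta_ge0.
move=> h; apply: (@le_trans _ _ (RSS n v u c0 c1 r + eta / `|r| * inf I)).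
  by apply: le_trans h; rewrite lerDl.
rewrite mulrDl mul1r lerD2l; apply: ler_pM => //; first by rewrite divr_ge0 ?normr_ge0 ?eta_ge0.
rewrite ler_wpM2l// lef_pV2 ?posrE ?oppr_gt0//.
  by case/andP: hr => _ h2; rewrite ltr0_norm ?lerN2// (le_lt_trans h2).
by case/andP: hr => _ h2; rewrite normr_gt0 lt_eqF// (le_lt_trans h2).
Qed.

End penalized.

Lemma sqr_add_le (R : realFieldType) (a b : R) : (a + b) ^+ 2 <= 2 * (a ^+ 2 + b ^+ 2).
Proof. by have := sqr_ge0 (a - b); lra. Qed.

Lemma alternate_sevenths (R : realFieldType) (a1 a2 al be h x0 x1 x2 x3 : R) :
  a1 <= al -> be <= a2 -> be = al + 7 * h ->
  al + (2 * 0)%:R * h <= x0 <= al + (2 * 0 + 1)%:R * h ->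
  al + (2 * 1)%:R * h <= x1 <= al + (2 * 1 + 1)%:R * h ->
  al + (2 * 2)%:R * h <= x2 <= al + (2 * 2 + 1)%:R * h ->
  al + (2 * 3)%:R * h <= x3 <= al + (2 * 3 + 1)%:R * h ->
  [/\ a1 <= x0, x0 + h <= x1, x1 + h <= x2, x2 + h <= x3 & x3 <= a2].
Proof. by rewrite !natrD !natrM => *; split; lra. Qed.

Section main.
Context {disp : measure_display} {T : measurableType disp} {R : realType}.
Context {P : probability T R} {d : nat} (X : int -> 'I_d -> {RV P >-> R}).
Variables (Cinf S : 'rV[R]_d -> R) (phi : nat -> R) (rho_phi K1 K2 eta a1 a2 : R)
  (m : nat -> nat) (wt : nat -> nat -> R) (f : R -> R)
  (b0_hat b1_hat rho_hat : nat -> T -> 'rV[R]_d -> R).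
Hypotheses (d_gt0 : (0 < d)%N)
  (X_stationary : strictly_stationary X)
  (X_continuous : forall j, continuous (cdf (X 1 j)))
  (K1_lt_K2 : K1 < K2) (K2_lt0 : K2 < 0) (eta_ge0 : 0 <= eta)
  (so : second_order X Cinf phi rho_phi S)
  (rho_phi_range : K1 <= rho_phi <= K2)
  (a1_gt0 : 0 < a1) (a1_lt_a2 : a1 < a2)
  (m_range : forall n, (0 < n)%N -> (0 < m n <= n)%N)
  (C_cvg : forall u, cube u -> block_copula X k u @[k --> \oo] --> Cinf u)
  (m_cvg : m @ \oo --> \oo)
  (ratio_cvg : (n%:R / (m n)%:R : R) @[n --> \oo] --> +oo)
  (beta_cvg : beta_mix X (m n) * (n%:R / (m n)%:R) `^ (2^-1) @[n --> \oo] --> (0 : R))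
  (bias_dominates : Num.sqrt (n%:R / (m n)%:R) * phi (m n) @[n --> \oo] --> +oo)
  (wt_gt0 : forall n k : nat, (0 < n)%N -> block_sizes m `[a1, a2] n k -> 0 < wt n k)
  (wt_sum1 : forall n : nat, (0 < n)%N -> \sum_(k \in block_sizes m `[a1, a2] n) wt n k = 1)
  (wt_limit : forall eps : R, 0 < eps -> \forall n \near \oo,
     forall a : R, a1 <= a <= a2 ->
     block_sizes m `[a1, a2] n (Num.truncn ((m n)%:R * a)) ->
     `|(m n)%:R * wt n (Num.truncn ((m n)%:R * a)) - f a| <= eps)
  (f_continuous : {within `[a1, a2], continuous f})
  (f_int1 : (\int[lebesgue_measure]_(a in `[a1, a2]) (f a)%:E)%E = 1%E)
  (est : penalized_estimator X m `[a1, a2] wt K1 K2 eta b0_hat b1_hat rho_hat).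

Notation RSS := (RSS X m `[a1, a2] wt).
Notation adm := (admissible m a1 a2).

Lemma block_size_bound n k : (0 < m n)%N -> adm n k ->
  (k < (Num.truncn (a2 * (m n)%:R)).+1)%N.
Proof.
move=> mn0 /andP[_]; rewrite ler_pdivrMr ?ltr0n// => h.
by rewrite -(ltr_nat R); apply: (le_lt_trans h); exact: truncnS_gt.
Qed.

(** The second order condition at block size [k] involves [phi k]; regular
variation trades it for [phi m], which costs an error proportional to the bounded
function [S]. *)
Lemma bias_expansion (e : R) : 0 < e -> \forall n \near \oo, forall k, adm n k ->
  forall u, cube u ->
   `|block_copula X k u - Cinf u - phi (m n) * S u * (k%:R / (m n)%:R) `^ rho_phi| <=
   e * phi (m n).
Proof.
move=> e0.
have [phi_gt0 rv _ _ so'] := so.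
have [Sb Sb0 hSb] := second_order_bounded C_cvg so.
have [kappa k0 kP] := @powR_bounds R a1 a2 `|rho_phi| a1_gt0.
pose e1 := e / (2 * (kappa + 1)); pose e2 := Num.min 1 (e / (2 * Sb)).
have k1 : 0 < kappa + 1 by rewrite addr_gt0.
have e10 : 0 < e1 by rewrite divr_gt0// mulr_gt0.
have e20 : 0 < e2 by rewrite lt_min ltr01 divr_gt0// mulr_gt0.
have [N1 _ hN1] := so' _ e10.
have rvu := regular_variation_uniform phi_gt0 rv a2 a1_gt0 e20.
near=> n.
have rvn : forall k : nat, a1 <= k%:R / (m n)%:R <= a2 ->
    `|phi k / phi (m n) - (k%:R / (m n)%:R) `^ rho_phi| <= e2.
  by near: n; exact: (m_cvg rvu).
have mbig : N1%:R / a1 <= (m n)%:R.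
  near: n; suff : \forall k \near \oo, N1%:R / a1 <= (k : nat)%:R :> R by exact: m_cvg.
  exists (Num.truncn (N1%:R / a1)).+1 => // k /= h.
  by apply: ltW; apply: (lt_le_trans (truncnS_gt _)); rewrite ler_nat.
have n0 : (0 < n)%N by near: n; exists 1%N.
have /andP[mn0 _] := m_range n0.
have mR : 0 < (m n)%:R :> R by rewrite ltr0n.
move=> k ak u cu.
have ppos : 0 < phi (m n) by exact: phi_gt0.
have kN : (N1 <= k)%N.
  rewrite -(ler_nat R); case/andP: (ak) => + _; rewrite ler_pdivlMr//; apply: le_trans.
  by rewrite mulrC -ler_pdivrMr.
have h1 := hN1 k kN u cu; have h2 := rvn k ak; have /andP[_ h3] := kP _ rho_phi ak (lexx _).
set x := (k%:R / (m n)%:R) `^ rho_phi in h2 h3 *.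
set y := phi k / phi (m n) in h2.
have yE : phi k = y * phi (m n) by rewrite /y divfK ?gt_eqF.
have e21 : e2 <= 1 by rewrite ge_min lexx.
have yk : y <= kappa + 1 by move: h2; rewrite ler_norml; lra.
have -> : block_copula X k u - Cinf u - phi (m n) * S u * x =
    (block_copula X k u - Cinf u - phi k * S u) + phi (m n) * (S u * (y - x)).
  by rewrite yE; ring.
apply: le_trans (ler_normD _ _) _.
have p1 : e1 * phi k <= e / 2 * phi (m n).
  rewrite yE mulrA ler_pM2r//; apply: (@le_trans _ _ (e1 * (kappa + 1))).
    by rewrite ler_pM2l.
  by rewrite /e1 le_eqVlt; apply/orP; left; apply/eqP; field; rewrite gt_eqF.
have p2 : `|phi (m n) * (S u * (y - x))| <= e / 2 * phi (m n).
  rewrite normrM gtr0_norm// mulrC ler_pM2r// normrM.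
  apply: (@le_trans _ _ (Sb * e2)); first by apply: ler_pM => //; exact: hSb.
  have : e2 <= e / (2 * Sb) by rewrite ge_min lexx orbT.
  by rewrite ler_pdivlMr ?mulr_gt0//; lra.
by move: h1 p1 p2; lra.
Unshelve. all: by end_near. Qed.

(** Four of the seven parts of an interval with positive density, separated by the
other three, supply the points for identification. *)
Lemma estimator_close (U : set 'rV[R]_d) (eps delta : R) : compact U ->
  U `<=` [set u | cube u /\ S u != 0] -> 0 < eps -> 0 < delta ->
  \forall n \near \oo, exists E : set T, [/\ measurable E, pr P E <= delta &
    forall v, ~ E v -> forall u, U u -> `|rho_hat n v u - rho_phi| <= eps].
Proof.
move=> cU US eps0 delta0.
have [phi_gt0 _ _ _ _] := so.
have [s0 s00 hs0] := second_order_away X_stationary X_continuous C_cvg so cU US.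
have [al [be [c [a1al alb ba2 c0 cf]]]] := density_positive_interval a1_lt_a2 f_continuous f_int1.
pose h := (be - al) / 7.
have h0 : 0 < h by rewrite divr_gt0// subr_gt0.
have be_E : be = al + 7 * h by rewrite /h; field.
have [tau tau0 four] := four_points a2 a1_gt0 K1_lt_K2 K2_lt0 h0 s00 eps0.
(* The sum of squares that is small enough for [weighted_pick] on parts of
   length [h] to produce residuals below [tau]. *)
pose Theta := c * h / 8 * tau ^+ 2.
have Th0 : 0 < Theta by rewrite mulr_gt0 ?exprn_gt0// divr_gt0// mulr_gt0.
(* [Lam] is twice the total of the residual sums at the truth and at the fit, in
   units of the former. *)
pose Lam := 2 * (2 + eta / - K2).
have Lam0 : 0 < Lam.
  by rewrite mulr_gt0// ltr_wpDr// divr_ge0// oppr_ge0 ltW.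
pose theta := Theta / Lam.
have th0 : 0 < theta by rewrite divr_gt0.
pose e := Num.sqrt theta / 2.
have e0 : 0 < e by rewrite divr_gt0// sqrtr_gt0.
have e_sq : e ^+ 2 = theta / 4.
  by rewrite exprMn sqr_sqrtr ?(ltW th0)//; field.
have th4 : 0 < theta / 4 by rewrite divr_gt0.
have m_gt0 n : (0 < n)%N -> (0 < m n)%N by move=> /m_range/andP[].
pose pick i := @weighted_pick R m a1 a2 wt f a1_gt0 m_gt0 m_cvg wt_gt0 wt_limit
  (al + (2 * i)%:R * h) (al + (2 * i + 1)%:R * h) c.
pose good (i n : nat) := forall r : nat -> R, (forall k, 0 <= r k) ->
    \sum_(k \in block_sizes m `[a1, a2] n) wt n k * r k <= Theta ->
    exists2 k : nat, al + (2 * i)%:R * h <= k%:R / (m n)%:R <= al + (2 * i + 1)%:R * h &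
      r k <= tau ^+ 2.
have pick_i (i : nat) : (i < 4)%N -> \forall n \near \oo, good i n.
  move=> i4.
  have i3 : (2 * i + 1)%:R <= 7 :> R by rewrite ler_nat; case: i i4 => [|[|[|[|]]]].
  have ih : 0 <= (2 * i)%:R * h by rewrite mulr_ge0// ltW.
  have i3h : (2 * i + 1)%:R * h <= 7 * h by rewrite ler_pM2r.
  have ihh : (2 * i + 1)%:R * h = (2 * i)%:R * h + h by rewrite natrD mulrDl mul1r.
  have hyp1 : a1 <= al + (2 * i)%:R * h by lra.
  have hyp2 : al + (2 * i)%:R * h < al + (2 * i + 1)%:R * h by rewrite ihh; lra.
  have hyp3 : al + (2 * i + 1)%:R * h <= a2 by lra.
  have hyp4 x : al + (2 * i)%:R * h <= x <= al + (2 * i + 1)%:R * h -> c <= f x.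
    by move=> hx; apply: cf; lra.
  apply: filterS (pick i hyp1 hyp2 hyp3 c0 hyp4) => n H r r0 hr.
  apply: (H r (tau ^+ 2)) => //; first by rewrite exprn_gt0.
  apply: (le_trans hr); rewrite /Theta le_eqVlt; apply/orP; left; apply/eqP.
  by rewrite ihh; ring.
near=> n.
have n0 : (0 < n)%N by near: n; exists 1%N.
have mn0 := m_gt0 n n0.
have mR : 0 < (m n)%:R :> R by rewrite ltr0n.
have ppos : 0 < phi (m n) by exact: phi_gt0.
have [E [mE PE hE]] : exists E : set T, [/\ measurable E, pr P E <= delta &
    forall v, ~ E v -> forall u, cube u ->
      \sum_(k \in block_sizes m `[a1, a2] n)
        wt n k * (emp_copula X n k u v - block_copula X k u) ^+ 2 <=
      theta / 4 * phi (m n) ^+ 2].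
  near: n; exact: (emp_copula_L2 X_stationary X_continuous d_gt0 a1_gt0 a1_lt_a2
    m_range ratio_cvg beta_cvg bias_dominates wt_gt0 wt_sum1 th4 delta0).
have bias : forall k, adm n k -> forall u, cube u ->
   `|block_copula X k u - Cinf u - phi (m n) * S u * (k%:R / (m n)%:R) `^ rho_phi| <=
   e * phi (m n).
  by near: n; exact: bias_expansion.
have p0 : good 0%N n by near: n; exact: pick_i.
have p1 : good 1%N n by near: n; exact: pick_i.
have p2 : good 2%N n by near: n; exact: pick_i.
have p3 : good 3%N n by near: n; exact: pick_i.
exists E; split=> // v nE u Uu.
have [cu Su] := US _ Uu.
pose l := (Num.truncn (a2 * (m n)%:R)).+1.
have kl k : adm n k -> (k < l)%N by exact: block_size_bound.
have wt0 k : adm n k -> 0 <= wt n k.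
  by move=> ak; apply/ltW/wt_gt0 => //; rewrite block_sizesE.
have wsum : \sum_(k < l | adm n k) wt n k = 1 by rewrite -(wt_sum1 n0) (sum_block_sizes _ kl).
have [hrho hmin] := est v n0 cu.
pose x k : R := k%:R / (m n)%:R.
pose truth := RSS n v u (Cinf u) (phi (m n) * S u) rho_phi.
pose fit := RSS n v u (b0_hat n v u) (b1_hat n v u) (rho_hat n v u).
have truth_le : truth <= theta * phi (m n) ^+ 2.
  rewrite /truth /Defs.RSS (sum_block_sizes _ kl).
  have := hE v nE u cu; rewrite (sum_block_sizes _ kl) => hdev.
  apply: (@le_trans _ _ (2 * (\sum_(k < l | adm n k) wt n k *
      (emp_copula X n k u v - block_copula X k u) ^+ 2) + 2 * (e * phi (m n)) ^+ 2)).
    rewrite mulr_sumr -[X in _ + X]mul1r -[X in _ + X * _]wsum mulr_suml -big_split /=.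
    apply: ler_sum => k ak; have hb := bias k ak u cu.
    rewrite [2 * (_ * _)]mulrCA -mulrDr ler_wpM2l ?wt0//.
    rewrite -/(x k) in hb *.
    set A := emp_copula X n k u v - block_copula X k u.
    set B := block_copula X k u - Cinf u - phi (m n) * S u * x k `^ rho_phi in hb.
    have -> : emp_copula X n k u v - Cinf u - phi (m n) * S u * x k `^ rho_phi = A + B.
      by rewrite /A /B; ring.
    have B2 : B ^+ 2 <= (e * phi (m n)) ^+ 2.
      rewrite -(real_normK (num_real B)) lerXn2r ?nnegrE//.
      exact: le_trans hb.
    rewrite -mulrDr; apply: le_trans (sqr_add_le A B) _.
    by rewrite ler_pM2l// lerD2l.
  by rewrite exprMn e_sq; move: hdev; lra.
have fit_le : fit <= (1 + eta / - K2) * truth.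
  apply: (penalized_minimizer_RSS K2_lt0 eta_ge0 _ hrho rho_phi_range) => //.
  exact: hmin.
pose c0' := (b0_hat n v u - Cinf u) / phi (m n); pose c1' := b1_hat n v u / phi (m n).
pose r k := (S u * x k `^ rho_phi - c0' - c1' * x k `^ rho_hat n v u) ^+ 2.
have r0 k : 0 <= r k by exact: sqr_ge0.
have rsum : \sum_(k \in block_sizes m `[a1, a2] n) wt n k * r k <= Theta.
  rewrite (sum_block_sizes _ kl).
  have p20 : 0 < phi (m n) ^+ 2 by rewrite exprn_gt0.
  rewrite -(ler_pM2l p20).
  apply: (@le_trans _ _ (2 * (truth + fit))).
    rewrite /truth /fit /Defs.RSS !(sum_block_sizes _ kl) mulrDr !mulr_sumr -big_split /=.
    apply: ler_sum => k ak; rewrite -/(x k).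
    rewrite [leLHS]mulrCA ![2 * (_ * _)]mulrCA -mulrDr ler_wpM2l ?wt0//.
    set A := emp_copula X n k u v - Cinf u - _; set B := emp_copula X n k u v - b0_hat n v u - _.
    have -> : phi (m n) ^+ 2 * r k = (B - A) ^+ 2.
      rewrite /r -exprMn; congr (_ ^+ 2).
      by rewrite /A /B /c0' /c1'; field; rewrite gt_eqF.
    rewrite (_ : A * (2 * A) + B * (2 * B) = 2 * (B ^+ 2 + (- A) ^+ 2)).
      exact: sqr_add_le.
    by ring.
  have -> : phi (m n) ^+ 2 * Theta = Lam * (theta * phi (m n) ^+ 2).
    by rewrite /theta; field; rewrite gt_eqF.
  apply: (@le_trans _ _ (Lam * truth)); last by rewrite ler_pM2l.
  by rewrite /Lam; move: fit_le; lra.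
have [k0 hk0 rk0] := p0 r r0 rsum; have [k1 hk1 rk1] := p1 r r0 rsum.
have [k2 hk2 rk2] := p2 r r0 rsum; have [k3 hk3 rk3] := p3 r r0 rsum.
rewrite -/(x k0) in hk0; rewrite -/(x k1) in hk1.
rewrite -/(x k2) in hk2; rewrite -/(x k3) in hk3.
have [sep0 sep1 sep2 sep3 sep4] := alternate_sevenths a1al ba2 be_E hk0 hk1 hk2 hk3.
have root k : r k <= tau ^+ 2 ->
    `|S u * x k `^ rho_phi - c0' - c1' * x k `^ rho_hat n v u| <= tau.
  by rewrite /r -(real_normK (num_real (_ - _))) ler_sqr ?nnegrE// ltW.
apply: (four (S u) c0' c1' rho_phi (rho_hat n v u) (x k0) (x k1) (x k2) (x k3)) => //.
- exact: hs0.
- by move=> y; rewrite !inE => /or4P[] /eqP ->; exact: root.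
Unshelve. all: by end_near. Qed.

End main.

Theorem proposition3p11
  (R : realType) (disp : measure_display) (T : measurableType disp)
  (P : probability T R) (d : nat) (X : int -> 'I_d -> {RV P >-> R})
  (Cinf S : 'rV[R]_d -> R) (phi : nat -> R) (rho_phi : R)
  (K1 K2 eta a1 a2 : R) (m : nat -> nat)
  (wt : nat -> nat -> R) (f : R -> R)
  (b0_hat b1_hat rho_hat : nat -> T -> 'rV[R]_d -> R)
  (d_gt0 : (0 < d)%N)
  (X_stationary : strictly_stationary X)
  (X_continuous : forall j, continuous (cdf (X 1 j)))
  (K1_lt_K2 : K1 < K2) (K2_lt0 : K2 < 0) (eta_ge0 : 0 <= eta)
  (so : second_order X Cinf phi rho_phi S)
  (rho_phi_range : K1 <= rho_phi <= K2)
  (a1_gt0 : 0 < a1) (a1_lt_a2 : a1 < a2)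
  (m_incr : forall n n' : nat, (0 < n <= n')%N -> (m n <= m n')%N)
  (ecc : ECC X Cinf phi rho_phi S m `[a1, a2])
  (bias_dominates : Num.sqrt (n%:R / (m n)%:R) * phi (m n) @[n --> \oo] --> +oo)
  (wt_gt0 : forall n k : nat, (0 < n)%N ->
     block_sizes m `[a1, a2] n k -> 0 < wt n k)
  (wt_sum1 : forall n : nat, (0 < n)%N ->
     \sum_(k \in block_sizes m `[a1, a2] n) wt n k = 1)
  (wt_limit : forall eps : R, 0 < eps -> \forall n \near \oo,
     forall a : R, a1 <= a <= a2 ->
     block_sizes m `[a1, a2] n (Num.truncn ((m n)%:R * a)) ->
     `|(m n)%:R * wt n (Num.truncn ((m n)%:R * a)) - f a| <= eps)
  (f_continuous : {within `[a1, a2], continuous f})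
  (f_int1 : (\int[lebesgue_measure]_(a in `[a1, a2]) (f a)%:E)%E = 1%E)
  (est : penalized_estimator X m `[a1, a2] wt K1 K2 eta b0_hat b1_hat rho_hat) :
  (forall U : set 'rV[R]_d, compact U ->
     U `<=` [set u | cube u /\ S u != 0] ->
     oP1 P (fun n w => sup [set `|rho_hat n w u - rho_phi| | u in U])) /\
  (forall U : {fset 'rV[R]_d}, U != fset0%fset ->
     (forall u, u \in U -> cube u /\ S u != 0) ->
     oP1 P (fun n w =>
       (#|` U|%:R)^-1 * (\sum_(u <- U) rho_hat n w u) - rho_phi)).
Proof.
have [m_range [_ C_cvg] [m_cvg ratio_cvg _ beta_cvg _] _ _] := ecc.
have close := fun U eps delta => @estimator_close _ _ _ P d X Cinf S phi rho_phi K1 K2 eta a1 a2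
  m wt f b0_hat b1_hat rho_hat d_gt0 X_stationary X_continuous K1_lt_K2 K2_lt0 eta_ge0 so
  rho_phi_range a1_gt0 a1_lt_a2 m_range C_cvg m_cvg ratio_cvg beta_cvg bias_dominates
  wt_gt0 wt_sum1 wt_limit f_continuous f_int1 est U eps delta.
split=> [U cU US|U U0 US]; apply: oP1_of_events => eps delta eps0 delta0.
  apply: filterS (close U eps delta cU US eps0 delta0) => n [E [mE PE hE]].
  exists E; split=> // v nE.
  have [->|/set0P[u0 Uu0]] := eqVneq U set0.
    by rewrite image_set0 sup0 normr0 ltW.
  have le u : U u -> `|rho_hat n v u - rho_phi| <= eps by exact: hE.
  rewrite ger0_norm.
    by apply: ge_sup => [|_ [u Uu <-]]; [exists `|rho_hat n v u0 - rho_phi|, u0|exact: le].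
  apply: (@le_trans _ _ `|rho_hat n v u0 - rho_phi|) => //.
  by apply: ub_le_sup; [exists eps => _ [u Uu <-]; exact: le|exists u0].
have cU : compact [set` U] by apply: finite_compact; exact: finite_fset.
have US' : [set` U] `<=` [set u | cube u /\ S u != 0] by move=> u /= /US.
apply: filterS (close _ eps delta cU US' eps0 delta0) => n [E [mE PE hE]].
exists E; split=> // v nE.
have card0 : 0 < #|` U|%:R :> R by rewrite ltr0n cardfs_gt0.
have -> : (#|` U|%:R)^-1 * (\sum_(u <- U) rho_hat n v u) - rho_phi =
    (#|` U|%:R)^-1 * \sum_(u <- U) (rho_hat n v u - rho_phi).
  rewrite sumrB mulrBr big_const_seq count_predT iter_addr_0; congr (_ - _).
  by rewrite -[rho_phi *+ _]mulr_natl mulKf// gt_eqF.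
rewrite normrM gtr0_norm ?invr_gt0// ler_pdivrMl// mulr_natl.
apply: le_trans (ler_norm_sum _ _ _) _.
apply: (@le_trans _ _ (\sum_(u <- U) eps)); last first.
  by rewrite big_const_seq count_predT iter_addr_0.
by rewrite big_seq [leRHS]big_seq; apply: ler_sum => u uU; exact: hE.
Qed.
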